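(* Let $\mathcal{S}\subset\mathbb{R}^{n+1}$ be a smooth hypersurface and $p\in\mathcal{S}$. Denote by $\lambda_l(p,\varepsilon)\equiv\lambda_l(\mathrm{Cyl}_p(\varepsilon))$, $l=1,\dots,n+1$, and $V_p(\varepsilon)\equiv V(\mathrm{Cyl}_p(\varepsilon))$ the covariance eigenvalues and the volume of the cylindrical domain of $\mathcal{S}$ at $p$. Define the corresponding curvature descriptors at scale $\varepsilon>0$ and point $p$, for any $\mu=1,\dots,n$, by $$\mathcal R(\mathrm{Cyl}_p(\varepsilon))=\frac{2(n+2)}{\varepsilon^2}\left[\frac{2(n+4)}{\varepsilon^2}\frac{\lambda_{n+1}(p,\varepsilon)}{V_n(\varepsilon)}+3\left(1-\frac{V_p(\varepsilon)}{V_n(\varepsilon)}\right)\right],$$ $$H(\mathrm{Cyl}_p(\varepsilon))=(\pm)\sqrt{\frac{2(n+2)}{\varepsilon^2}\left[\frac{2(n+4)}{\varepsilon^2}\frac{\lambda_{n+1}(p,\varepsilon)}{V_n(\varepsilon)}+2\left(1-\frac{V_p(\varepsilon)}{V_n(\varepsilon)}\right)\right]},$$ $$\kappa_\mu^2(\mathrm{Cyl}_p(\varepsilon))=\frac{n+2}{\varepsilon^2}\left[\frac{n+4}{\varepsilon^2}\left(\frac{\lambda_\mu(p,\varepsilon)}{V_n(\varepsilon)}-\frac{\varepsilon^2}{n+2}\right)-\frac{V_p(\varepsilon)}{V_n(\varepsilon)}+1\right],$$ where the overall sign can be chosen by fixing a normal orientation from $(\pm)=\mathrm{sgn}\langle\mathbf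 e_{n+1}(\mathrm{Cyl}_p(\varepsilon)),\mathbf s(\mathrm{Cyl}_p(\varepsilon))\rangle$; the eigenvectors $\mathbf e_\mu(\mathrm{Cyl}_p(\varepsilon))$ and $\mathbf e_{n+1}(\mathrm{Cyl}_p(\varepsilon))$ are descriptors of the principal and normal directions respectively. Then, as $\varepsilon\to0$, the truncation errors satisfy $$|H^2(p)-H^2(\mathrm{Cyl}_p(\varepsilon))|\le\mathcal{O}(\varepsilon^2),\quad|\mathcal R(p)-\mathcal R(\mathrm{Cyl}_p(\varepsilon))|\le\mathcal{O}(\varepsilon^2),\quad|\kappa_\mu^2(p)-\kappa_\mu^2(\mathrm{Cyl}_p(\varepsilon))|\le\mathcal{O}(\varepsilon^2).$$
   Context: $V_n(\varepsilon)=\pi^{n/2}\varepsilon^n/\Gamma(\tfrac n2+1)$ is the volume of the ball of radius $\varepsilon$ in $\mathbb{R}^n$. $\mathrm{Cyl}_p(\varepsilon)=\mathcal{S}\cap\{q\in\mathbb{R}^{n+1}:\|\mathrm{proj}_{T_p\mathcal{S}}(q-p)\|\le\varepsilon\}$. With dVol the induced Riemannian measure: $V(\mathrm{Cyl}_p(\varepsilon))$ is its volume; $\mathbf s(\mathrm{Cyl}_p(\varepsilon))=\frac{1}{V}\int_{\mathrm{Cyl}_p(\varepsilon)}(\mathbf X-\mathbf p)\,\mathrm{dVol}$ is its barycenter (with $p$ as origin); $C(\mathrm{Cyl}_p(\varepsilon))=\int_{\mathrm{Cyl}_p(\varepsilon)}(\mathbf X-\mathbf p)\otimes(\mathbf X-\mathbf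 p)\,\mathrm{dVol}$ is its covariance matrix. For small $\varepsilon$ the covariance matrix has $n$ tangent eigenvalues $\lambda_1,\dots,\lambda_n$ of the form $V_n(\varepsilon)[\varepsilon^2/(n+2)+\mathcal{O}(\varepsilon^4)]$ and one normal eigenvalue $\lambda_{n+1}=V_n(\varepsilon)\,\mathcal{O}(\varepsilon^4)$; $\mathbf e_l(\mathrm{Cyl}_p(\varepsilon))$ are the corresponding unit eigenvectors. $\kappa_1(p),\dots,\kappa_n(p)$ are the principal curvatures of $\mathcal{S}$ at $p$ with respect to a unit normal, $H(p)=\sum_\mu\kappa_\mu(p)$, and $\mathcal R(p)=H(p)^2-\sum_\mu\kappa_\mu(p)^2$ is the scalar curvature. The tangent eigenvalues are labeled correspondingly with the squared principal curvatures: $\lambda_\mu(p,\varepsilon)$ has $\varepsilon^4V_n(\varepsilon)$-coefficient $\frac{1}{2(n+2)(n+4)}\big(\sum_\alpha\kappa_\alpha^2(p)+2\kappa_\mu^2(p)\big)$. Throughout one works inside a sufficiently small neighborhood of $p$ in which $\mathcal{S}$ is the graph over $T_p\mathcal{S}$ of a smooth function vanishing to second order at $p$. *)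

(* Defs.v *)
From HB Require Import structures.
From mathcomp Require Import all_boot all_order all_algebra.
From mathcomp Require Import all_classical all_reals all_analysis.

Set Implicit Arguments.
Unset Strict Implicit.
Unset Printing Implicit Defensive.

Import Order.TTheory GRing.Theory Num.Theory.
Import numFieldNormedType.Exports.

Local Open Scope classical_set_scope.
Local Open Scope ring_scope.

Section LebesgueRn.
Context {R : realType}.
Local Open Scope ereal_scope.
Local Notation tup n := (n.-tuple (measurableTypeR R)).

Definition tcons n (x : measurableTypeR R * tup n) : tup n.+1 :=
  [tuple of x.1 :: x.2].

Definition tuncons n (x : tup n.+1) : measurableTypeR R * tup n :=
  (thead x, [tuple of behead x]).

Lemma tconsK n : cancel (@tcons n) (@tuncons n).
Proof. by case=> a x; congr pair; apply/val_inj. Qed.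

Lemma measurable_tcons n : measurable_fun setT (@tcons n).
Proof. exact: measurable_cons. Qed.

Lemma measurable_tuncons n : measurable_fun setT (@tuncons n).
Proof.
by apply/measurable_fun_pairP; split;
  [exact: measurable_tnth|exact: measurable_behead].
Qed.

Definition leb_succ n (m : set (tup n) -> \bar R) : set (tup n.+1) -> \bar R :=
  pushforward (lebesgue_measure \x m) (@tcons n).

Section leb_succ_measure.
Variables (n : nat) (m : {sigma_finite_measure set (tup n) -> \bar R}).

Let mtcons A : measurable A -> measurable (@tcons n @^-1` A).
Proof. by move=> mA; rewrite -[X in measurable X]setTI; exact: measurable_tcons. Qed.

Let leb_succ0 : leb_succ m set0 = 0.
Proof. by rewrite /leb_succ/pushforward preimage_set0 measure0. Qed.

Let leb_succ_ge0 A : 0 <= leb_succ m A.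
Proof. exact: (measure_ge0 (lebesgue_measure \x m)). Qed.

Let leb_succ_sigma_additive : semi_sigma_additive (leb_succ m).
Proof.
move=> F mF tF mUF; rewrite /leb_succ/pushforward preimage_bigcup.
apply: measure_semi_sigma_additive.
- by move=> k; exact: mtcons.
- apply/trivIsetP => /= i j _ _ ij; rewrite -preimage_setI.
  by move/trivIsetP : tF => /(_ _ _ _ _ ij) ->//; rewrite preimage_set0.
- by rewrite -preimage_bigcup; exact: mtcons.
Qed.

HB.instance Definition _ := isMeasure.Build _ _ _
  (leb_succ m) leb_succ0 leb_succ_ge0 leb_succ_sigma_additive.

Let leb_succ_sigma_finite : sigma_finite setT (leb_succ m).
Proof.
have /sigma_finiteP[F [TF ndF Foo]] := sigma_finiteT (@lebesgue_measure R).
have /sigma_finiteP[G [TG ndG Goo]] := sigma_finiteT m.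
exists (fun k => @tuncons n @^-1` (F k `*` G k)).
  rewrite -preimage_bigcup [X in _ @^-1` X](_ : _ = setT) ?preimage_setT//.
  apply/seteqP; split => // -[x y] _.
  have [i _ Fx] : (\bigcup_i F i) x by rewrite -TF.
  have [j _ Gy] : (\bigcup_i G i) y by rewrite -TG.
  exists (maxn i j) => //; split.
    by move: x Fx; exact/subsetPset/ndF/leq_maxl.
  by move: y Gy; exact/subsetPset/ndG/leq_maxr.
move=> k; have [mF Fy] := Foo k; have [mG Gy] := Goo k; split.
  rewrite -[X in measurable X]setTI; apply: measurable_tuncons => //.
  exact: measurableX.
rewrite /leb_succ/pushforward -comp_preimage (_ : _ \o _ = id); last first.
  by apply/funext => x; exact: tconsK.
by rewrite preimage_id product_measure1E// lte_mul_pinfty// ge0_fin_numE.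
Qed.

HB.instance Definition _ := Measure_isSigmaFinite.Build _ _ _
  (leb_succ m) leb_succ_sigma_finite.

End leb_succ_measure.

(* Lebesgue measure on R^n, on the product sigma-algebra: the iterated product
   of the one-dimensional measure, transported along (a, t) |-> a :: t. *)
Fixpoint lebesgueRn n : {sigma_finite_measure set (tup n) -> \bar R} :=
  if n is k.+1 then leb_succ (lebesgueRn k) else dirac [tuple].

End LebesgueRn.

Section EuclideanGeometry.
Context {R : realType}.

Definition dotv n (u v : 'rV[R]_n) : R := \sum_i u 0 i * v 0 i.

(* The norm of the normed module 'rV[R]_n is the sup norm, hence this one. *)
Definition enorm n (u : 'rV[R]_n) : R := Num.sqrt (dotv u u).

Definition basis_vec n (i : 'I_n) : 'rV[R]_n := delta_mx 0 i.

Fixpoint Ck (k n : nat) (U : set 'rV[R]_n) (f : 'rV[R]_n -> R) : Prop :=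
  (forall x, U x -> {for x, continuous f}) /\
  if k is k'.+1 then
    forall i, (forall x, U x -> derivable f x (basis_vec i)) /\
              Ck k' U (fun x => 'D_(basis_vec i) f x)
  else True.

Definition smooth_on n (U : set 'rV[R]_n) (f : 'rV[R]_n -> R) : Prop :=
  forall k, Ck k U f.

End EuclideanGeometry.

Section Parametrizations.
Context {R : realType} {n : nat}.
Implicit Types (X : 'rV[R]_n -> 'rV[R]_n.+1) (x : 'rV[R]_n) (nu : 'rV[R]_n.+1).

Definition first_form X x : 'M[R]_n :=
  \matrix_(i, j) dotv ('D_(basis_vec i) X x) ('D_(basis_vec j) X x).

Definition second_form X x nu : 'M[R]_n :=
  \matrix_(i, j)
    dotv ('D_(basis_vec i) (fun y => 'D_(basis_vec j) X y) x) nu.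

(* The eigenvalues, with multiplicity, of the shape operator, whose matrix in
   the basis of the partial derivatives of X is given by the Weingarten
   equations. *)
Definition principal_curvatures X x nu (kappa : 'I_n -> R) : Prop :=
  char_poly (invmx (first_form X x) *m second_form X x nu) =
  \prod_i ('X - (kappa i)%:P).

Definition row_of_tuple (t : n.-tuple (measurableTypeR R)) : 'rV[R]_n :=
  \row_i tnth t i.

(* Integral of phi over the part of the image of the injective map X that lies
   in A, for the Riemannian measure sqrt(det g) dx induced by the Euclidean
   metric. *)
Definition integral_dVol X (A : set 'rV[R]_n.+1) (phi : 'rV[R]_n.+1 -> R) : R :=
  \int[lebesgueRn n]_(t in [set t | A (X (row_of_tuple t))])
    (phi (X (row_of_tuple t)) *
     Num.sqrt (\det (first_form X (row_of_tuple t)))).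

Definition volume X (A : set 'rV[R]_n.+1) : R := integral_dVol X A (fun=> 1).

Definition barycenter X (p : 'rV[R]_n.+1) (A : set 'rV[R]_n.+1) : 'rV[R]_n.+1 :=
  (volume X A)^-1 *: \row_i integral_dVol X A (fun q => (q - p) 0 i).

Definition covariance X (p : 'rV[R]_n.+1) (A : set 'rV[R]_n.+1) : 'M[R]_n.+1 :=
  \matrix_(i, j) integral_dVol X A (fun q => (q - p) 0 i * (q - p) 0 j).

End Parametrizations.

Section Hypersurfaces.
Context {R : realType} {n : nat}.
Implicit Types (S : set 'rV[R]_n.+1) (p : 'rV[R]_n.+1).

Definition tangent_space S p : set 'rV[R]_n.+1 :=
  [set v | exists gamma : R -> 'rV[R]_n.+1,
    [/\ gamma 0 = p, \forall t \near 0, S (gamma t)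
      & is_derive (0 : R) 1 gamma v]].

(* The rows of [frame] are to be an orthonormal basis of the tangent space and
   [normal] a unit normal; [nbhd] is the neighborhood to which the hypersurface
   is restricted and [base] the set over which it is a graph. *)
Record graph_chart := GraphChart {
  nbhd : set 'rV[R]_n.+1;
  base : set 'rV[R]_n;
  frame : 'M[R]_(n, n.+1);
  normal : 'rV[R]_n.+1;
  height : 'rV[R]_n -> R }.

Definition chart_map p (c : graph_chart) (x : 'rV[R]_n) : 'rV[R]_n.+1 :=
  p + x *m frame c + height c x *: normal c.

(* Near p, S is the graph over its tangent space of a smooth function vanishing
   to second order. *)
Record is_tangent_chart S p (c : graph_chart) : Prop := IsTangentChart {
  nbhd_open : open (nbhd c);
  nbhd_point : nbhd c p;
  base_open : open (base c);
  base_origin : base c 0;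
  frame_orthonormal : frame c *m (frame c)^T = 1%:M;
  frame_tangent : tangent_space S p = [set v | (v <= frame c)%MS];
  normal_orthogonal : frame c *m (normal c)^T = 0;
  normal_unit : enorm (normal c) = 1;
  height_smooth : smooth_on (base c) (height c);
  height_origin : height c 0 = 0;
  height_critical : forall i, 'D_(basis_vec i) (height c) 0 = 0;
  chart_graph : S `&` nbhd c = chart_map p c @` base c }.

Definition smooth_hypersurface S : Prop :=
  forall p, S p -> exists c, is_tangent_chart S p c.

(* v |-> v *m frame^T *m frame is the orthogonal projection onto the row space
   of an orthonormal frame. *)
Definition cylinder S p (c : graph_chart) (eps : R) : set 'rV[R]_n.+1 :=
  S `&` nbhd c `&`
  [set q | enorm ((q - p) *m (frame c)^T *m frame c) <= eps].

Definition cyl_volume S p c (eps : R) : R :=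
  volume (chart_map p c) (cylinder S p c eps).

Definition cyl_barycenter S p c (eps : R) : 'rV[R]_n.+1 :=
  barycenter (chart_map p c) p (cylinder S p c eps).

Definition cyl_covariance S p c (eps : R) : 'M[R]_n.+1 :=
  covariance (chart_map p c) p (cylinder S p c eps).

(* [lam] lists the eigenvalues of C with multiplicity and [e] corresponding unit
   eigenvectors (row vectors, C being symmetric).  The index [ord_max] is the
   normal one and [lift ord_max mu] is the mu-th tangent one.  An eigenvalue
   labeling with lam_(n+1) = V_n(eps) O(eps^4) and
     lam_mu = V_n(eps) [eps^2 / (n+2) +
       eps^4 (sum_a kappa_a^2 + 2 kappa_mu^2) / (2 (n+2) (n+4)) + o(eps^4)]
   satisfies the last two clauses for all small eps, and so do only the
   labelings that differ from it by exchanging indices mu of equal kappa_mu^2;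
   stating them this way assumes no part of the expansion. *)
Definition labeled_eigensystem (kappa : 'I_n -> R) (C : 'M[R]_n.+1)
    (lam : 'I_n.+1 -> R) (e : 'I_n.+1 -> 'rV[R]_n.+1) : Prop :=
  [/\ char_poly C = \prod_l ('X - (lam l)%:P),
      forall l, e l *m C = lam l *: e l /\ enorm (e l) = 1,
      forall mu, lam ord_max <= lam (lift ord_max mu)
    & forall mu mu', kappa mu ^+ 2 < kappa mu' ^+ 2 ->
        lam (lift ord_max mu) <= lam (lift ord_max mu')].

End Hypersurfaces.
Arguments graph_chart : clear implicits.

Section Descriptors.
Context {R : realType}.

Definition Gamma (a : R) : R :=
  \int[lebesgue_measure]_(t in `]0, +oo[) (t `^ (a - 1) * expR (- t)).

Definition ball_volume (n : nat) (eps : R) : R :=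
  pi `^ (n%:R / 2) * eps ^+ n / Gamma (n%:R / 2 + 1).

Definition mean_curvature n (kappa : 'I_n -> R) : R := \sum_mu kappa mu.

Definition scalar_curvature n (kappa : 'I_n -> R) : R :=
  mean_curvature kappa ^+ 2 - \sum_mu kappa mu ^+ 2.

(* In the descriptors, V stands for the volume V_p(eps), lam_n for the normal
   eigenvalue and lam_t for a tangent one. *)

Definition scalar_descriptor n (eps V lam_n : R) : R :=
  2 * (n%:R + 2) / eps ^+ 2 *
  (2 * (n%:R + 4) / eps ^+ 2 * (lam_n / ball_volume n eps) +
   3 * (1 - V / ball_volume n eps)).

Definition mean_descriptor n (eps V lam_n : R) (e_n s : 'rV[R]_n.+1) : R :=
  Num.sg (dotv e_n s) *
  Num.sqrt (2 * (n%:R + 2) / eps ^+ 2 *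
    (2 * (n%:R + 4) / eps ^+ 2 * (lam_n / ball_volume n eps) +
     2 * (1 - V / ball_volume n eps))).

Definition principal_sq_descriptor n (eps V lam_t : R) : R :=
  (n%:R + 2) / eps ^+ 2 *
  ((n%:R + 4) / eps ^+ 2 *
     (lam_t / ball_volume n eps - eps ^+ 2 / (n%:R + 2)) -
   V / ball_volume n eps + 1).

End Descriptors.

(* Main.v *)
(* In the chart x |-> p + x F + h(x) N the cylinder is the image of the ball of
   radius eps, so the volume, the barycenter and the covariance matrix are
   integrals over that ball.  Replacing h and the area element by Taylor
   polynomials turns them, up to O(eps^k V_n(eps)), into moments of the ball,
   which follow from Gaussian integrals by the layer cake formula.  In a frame of
   principal directions the covariance form then equals
     V_n(eps) (sum_mu m_mu u_mu^2 + nu y^2)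
   up to O(eps^6) and a cross term of size O(eps^4) between the tangent part u and
   the normal part y.  Since the tangent weights m_mu are of order eps^2, AM-GM
   absorbs the cross term at the cost of O(eps^6) in the weights one looks at, and
   Courant-Fischer gives lambda_mu = V_n (m_mu + O(eps^6)) and
   lambda_(n+1) = V_n (nu + O(eps^6)).  The descriptors invert the leading
   coefficients of these expansions.  For the mean curvature it remains to see that
   the sign does not vanish when H <> 0: the normal eigenvector is almost normal,
   while the barycenter is eps^2 H / (2 (n + 2)) N + O(eps^3). *)

Require Import Defs.
From mathcomp Require Import all_boot all_order all_algebra.
From mathcomp Require Import all_classical all_reals all_analysis.
From mathcomp Require Import measurable_realfun ring lra zify.

Set Implicit Arguments.
Unset Strict Implicit.
Unset Printing Implicit Defensive.

Import Order.TTheory GRing.Theory Num.Theory.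
Import numFieldNormedType.Exports.

Local Open Scope classical_set_scope.
Local Open Scope ring_scope.

(** * Orthogonal diagonalization and counting of eigenvalues *)

(** The descriptors divide [lam / V_n] by [eps^4] and the volume defect by [eps^2], so an error
    [O(eps^2)] requires the eigenvalues up to [V_n O(eps^6)] and the volume up to [V_n O(eps^4)].
    The terms one order below disappear by parity: the Taylor parts concerned are odd and have
    integral zero over a ball. The labeling orders only tangent eigenvalues of different squared
    curvature and leaves ties free. Eigenvalues are therefore located by counting dimensions,
    comparing [lam i] with indices of strictly larger or strictly smaller weight, and not through
    sorted spectra. Each count tolerates a crude error, half of the leading tangent weight, in the
    block that is not looked at; this is the room in which the cross term disappears. The integrands
    on the hypersurface are squeezed between polynomials in the chart coordinates, so that
    measurability and integrability are only ever checked for the latter. *)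

Lemma char_poly_orthoJ (R : comNzRingType) n (P A : 'M[R]_n) :
  P *m P^T = 1%:M -> char_poly (P *m A *m P^T) = char_poly A.
Proof.
move=> PPt; rewrite /char_poly.
have PP : map_mx polyC P *m map_mx polyC P^T = 1%:M.
  by rewrite -map_mxM PPt map_mx1.
have -> : char_poly_mx (P *m A *m P^T) =
    map_mx polyC P *m char_poly_mx A *m map_mx polyC P^T.
  rewrite /char_poly_mx mulmxBr mulmxBl !map_mxM mul_mx_scalar -scalemxAl.
  by rewrite PP scalemx1.
by rewrite !det_mulmx mulrAC -det_mulmx PP det1 mul1r.
Qed.

Lemma tr_orthoJ (R : comNzRingType) n (B M : 'M[R]_n) :
  B *m B^T = 1%:M -> \tr (B *m M *m B^T) = \tr M.
Proof. by move=> BB; rewrite mxtrace_mulC mulmxA (mulmx1C BB) mul1mx. Qed.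

Section RowDot.
Variable R : rcfType.
Implicit Types (n : nat).

Lemma row_dotE n (v w : 'rV[R]_n) : (v *m w^T) 0 0 = \sum_i v 0 i * w 0 i.
Proof. by rewrite !mxE; apply: eq_bigr => i _; rewrite !mxE. Qed.

Lemma row_dot_ge0 n (v : 'rV[R]_n) : 0 <= (v *m v^T) 0 0.
Proof. by rewrite row_dotE sumr_ge0 // => i _; rewrite -expr2 sqr_ge0. Qed.

Lemma row_dot_eq0 n (v : 'rV[R]_n) : ((v *m v^T) 0 0 == 0) = (v == 0).
Proof.
apply/idP/eqP => [|->]; last by rewrite mul0mx mxE.
rewrite row_dotE psumr_eq0 => [/allP v0|i _]; last by rewrite -expr2 sqr_ge0.
apply/rowP => i; have := v0 i; rewrite mem_index_enum => /(_ isT).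
by rewrite mulf_eq0 orbb mxE => /eqP.
Qed.

(* A Householder reflection exchanges [e_0] and [u]. *)
Lemma ortho_extend n (u : 'rV[R]_n.+1) : u *m u^T = 1%:M ->
  exists P : 'M[R]_n.+1, P *m P^T = 1%:M /\ row 0 P = u.
Proof.
move=> uu; pose e : 'rV[R]_n.+1 := delta_mx 0 0; pose w := u - e.
have ee : e *m e^T = 1%:M.
  by rewrite trmx_delta mul_delta_mx; apply/matrixP => i j; rewrite !ord1 !mxE.
have [/eqP w0|w0] := boolP (w == 0).
  exists 1%:M; rewrite trmx1 mulmx1; split => //.
  by rewrite rowE mulmx1 -/e; apply/eqP; rewrite eq_sym -subr_eq0 -/w w0.
set s := (w *m w^T) 0 0.
have s0 : s != 0 by rewrite row_dot_eq0.
have sE : w *m w^T = s%:M by rewrite [LHS]mx11_scalar.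
have eu : u *m e^T = e *m u^T.
  by rewrite [RHS]mx11_scalar -[in RHS](trmxK e) -trmx_mul mxE -mx11_scalar.
(* As [u] and [e] are unit vectors, [|u - e|^2 = 2 - 2 <e, u> = -2 <e, u - e>]; this is what makes
   the reflection send [e] to [u]. *)
have ew : e *m w^T = (- (s / 2))%:M.
  have : w *m w^T = (-2) *: (e *m w^T).
    rewrite /w linearB/= mulmxBl !mulmxBr uu ee eu scalerBr.
    rewrite !scaleNr !scaler_nat !mulr2n opprD opprK; set a := e *m u^T.
    by rewrite opprK opprD addrACA [RHS]addrC addrACA [RHS]addrACA [1%:M - _]addrC.
  rewrite sE => /(congr1 (fun M => (-2)^-1 *: M)).
  rewrite scalerA mulVf ?scale1r ?oppr_eq0 ?pnatr_eq0// => <-.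
  by rewrite scale_scalar_mx invrN mulNr mulrC.
exists (1%:M - (2 / s) *: (w^T *m w)); split.
  have -> : (1%:M - (2 / s) *: (w^T *m w))^T = 1%:M - (2 / s) *: (w^T *m w).
    by rewrite [LHS]linearB/= trmx1 [X in _ - X]linearZ/= trmx_mul trmxK.
  set A := w^T *m w.
  have AA : A *m A = s *: A.
    by rewrite /A mulmxA -(mulmxA w^T) sE mul_mx_scalar -scalemxAl.
  rewrite mulmxBl !mulmxBr !mul1mx !mulmx1 -scalemxAl -scalemxAr AA !scalerA.
  have -> : 2 / s * (2 / s) * s = 2 / s + 2 / s by field.
  by rewrite scalerDl opprB addrK subrK.
rewrite rowE -/e mulmxBr mulmx1 -scalemxAr mulmxA ew mul_scalar_mx scalerA.
have -> : 2 / s * - (s / 2) = -1 by field.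
by rewrite scaleN1r opprK /w addrC subrK.
Qed.

(** Induction that keeps the given order of the eigenvalues: a unit eigenvector for [lam 0] is
    completed to an orthogonal matrix, symmetry makes the conjugate of [M] block diagonal, and
    cancelling the factor ['X - lam 0] leaves the same situation for the lower block. As the
    characteristic polynomial comes already split, the existence of real eigenvalues is not at
    issue. *)
Lemma ortho_diag n (M : 'M[R]_n) (lam : 'I_n -> R) :
  M^T = M -> char_poly M = \prod_i ('X - (lam i)%:P) ->
  exists Q, Q *m Q^T = 1%:M /\ Q *m M *m Q^T = diag_mx (\row_i lam i).
Proof.
elim: n => [|n IH] in M lam *.
  by exists 1%:M; split; apply/matrixP => -[].
move=> Msym cM.
have /eigenvalueP[v vM v0] : eigenvalue M (lam 0).
  rewrite eigenvalue_root_char cM /root horner_prod big_ord_recl.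
  by rewrite !hornerE subrr mul0r.
pose s := Num.sqrt ((v *m v^T) 0 0).
have s2 : s ^+ 2 = (v *m v^T) 0 0 by rewrite sqr_sqrtr ?row_dot_ge0.
have s0 : s != 0 by rewrite -sqrf_eq0 s2 row_dot_eq0.
pose u := s^-1 *: v.
have uM : u *m M = lam 0 *: u by rewrite -scalemxAl vM !scalerA mulrC.
have uu : u *m u^T = 1%:M.
  rewrite linearZ/= -scalemxAl -scalemxAr scalerA [v *m _]mx11_scalar -s2.
  by rewrite scale_scalar_mx -expr2 exprVn mulVf ?sqrf_eq0.
have [P [PP P0]] := ortho_extend uu.
pose N : 'M[R]_(1 + n) := P *m M *m P^T.
have Nsym : N^T = N by rewrite /N !trmx_mul trmxK Msym mulmxA.
have N0 j : N 0 j = (lam 0)%:M 0 j.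
  have -> : N 0 j = (row 0 N) 0 j by rewrite [RHS]mxE.
  rewrite /N !row_mul P0 uM -P0 -scalemxAl -row_mul PP !mxE.
  by rewrite eq_sym mulr_natr.
have NP : N = P *m M *m P^T by [].
have cNM : char_poly N = char_poly M by exact: char_poly_orthoJ.
clearbody N.
have NE : N = block_mx (lam 0)%:M 0 0 (drsubmx N).
  rewrite -[LHS]submxK; congr block_mx; apply/matrixP => i j; rewrite !mxE.
  - rewrite (_ : lshift n i = 0) ?N0 ?mxE; last by apply: val_inj; rewrite /= ord1.
    by rewrite !ord1 (_ : lshift n 0 = 0)//; apply: val_inj.
  - rewrite (_ : lshift n i = 0) ?N0 ?mxE//; apply: val_inj.
    by rewrite /= !ord1.
  - rewrite -Nsym mxE (_ : lshift n j = 0) ?N0 ?mxE//; apply: val_inj.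
    by rewrite /= !ord1.
set N' := drsubmx N in NE.
have N'sym : N'^T = N' by rewrite /N' trmx_drsub Nsym.
have cN : char_poly N' = \prod_i ('X - (lam (lift 0 i))%:P).
  move: cNM; rewrite cM big_ord_recl NE {1}/char_poly /char_poly_mx.
  rewrite map_block_mx !map_mx0 -[_%:M]/(_%:M : 'M[{poly R}]_(1 + n)).
  rewrite (scalar_mx_block 1 n) opp_block_mx add_block_mx !subr0.
  rewrite det_lblock det_mx11 !mxE mulr1n.
  by move/mulfI; apply; rewrite polyXsubC_eq0.
have [Q [QQ QN]] := IH _ _ N'sym cN.
pose Q1 : 'M[R]_(1 + n) := block_mx 1%:M 0 0 Q.
have Q1Q1 : Q1 *m Q1^T = 1%:M.
  rewrite /Q1 tr_block_mx !trmx0 trmx1 mulmx_block !mulmx0 !mul0mx mulmx1.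
  by rewrite QQ !addr0 add0r -scalar_mx_block.
exists (Q1 *m P); split.
  by rewrite trmx_mul mulmxA -(mulmxA Q1 P) PP mulmx1.
have key : Q1 *m N *m Q1^T = block_mx (lam 0)%:M 0 0 (Q *m N' *m Q^T).
  rewrite NE /Q1 tr_block_mx !trmx0 trmx1 !mulmx_block.
  by rewrite !(mulmx0, mul0mx, mulmx1, mul1mx, addr0, add0r).
rewrite trmx_mul !mulmxA -(mulmxA Q1) -(mulmxA Q1) -NP [LHS]key QN.
apply/matrixP => i j; rewrite [RHS]mxE [in RHS]mxE.
case: (@split_ordP 1 n i) => i' ->; case: (@split_ordP 1 n j) => j' ->.
- rewrite [LHS]block_mxEul mxE !ord1 !eqxx; congr (lam _ *+ _); exact: val_inj.
- by rewrite [LHS]block_mxEur mxE -val_eqE /= ord1.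
- by rewrite [LHS]block_mxEdl mxE -val_eqE /= ord1.
- rewrite [LHS]block_mxEdr !mxE -[in RHS]val_eqE /= eqn_add2l.
  by congr (lam _ *+ _); exact: val_inj.
Qed.

(* The dimension count of the Courant-Fischer principle: a vector supported by
   the first family of eigenvectors and by the second one exists. *)
Lemma eigen_count n (M : 'M[R]_n) (Q Q' : 'M[R]_n) (lam mu : 'I_n -> R)
    (I J : {set 'I_n}) (a b : R) :
  Q *m Q^T = 1%:M -> Q' *m Q'^T = 1%:M ->
  Q *m M *m Q^T = diag_mx (\row_i lam i) ->
  (forall v : 'rV[R]_n, (v *m M *m v^T) 0 0 <= \sum_j mu j * (v *m Q'^T) 0 j ^+ 2) ->
  (forall i, i \in I -> a <= lam i) -> (forall j, j \in J -> mu j <= b) ->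
  (n < #|I| + #|J|)%N -> a <= b.
Proof.
move=> QQ QQ' QM le_quad aI bJ nIJ.
(* A row vector killed by [K] has no component along the rows of [Q] outside [I] nor along the rows
   of [Q'] outside [J]. [K] has fewer than [n] columns, so its left kernel is non-zero. *)
pose K := row_mx (colsub (@enum_val _ (mem (~: I))) Q^T)
                 (colsub (@enum_val _ (mem (~: J))) Q'^T).
have cIJ : (#|~: I| + #|~: J| < n)%N.
  have := cardsC I; have := cardsC J; rewrite card_ord; move: nIJ; clear.
  by move: #|I| #|J| #|~: I| #|~: J| => *; lia.
have K0 : kermx K != 0.
  rewrite kermx_eq0 /row_free; apply/eqP => rK.
  have := rank_leq_col K; rewrite rK => /leq_trans/(_ (ltnW cIJ)).
  by have := rank_leq_col K; rewrite rK leqNgt cIJ.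
pose v := nz_row (kermx K).
have v0 : v != 0 by rewrite nz_row_eq0.
have /sub_kermxP : (v <= kermx K)%MS by exact: nz_row_sub.
rewrite mul_mx_row -[RHS]row_mx0 => /eq_row_mx[vI vJ].
have zI i : i \notin I -> (v *m Q^T) 0 i = 0.
  move=> iI; have iI' : i \in mem (~: I) by rewrite /= inE.
  move/rowP: vI => /(_ (enum_rank_in iI' i)); rewrite [RHS]mxE => <-.
  rewrite [LHS]mxE [RHS]mxE; apply: eq_bigr => k _.
  by rewrite [in RHS]mxE enum_rankK_in.
have zJ i : i \notin J -> (v *m Q'^T) 0 i = 0.
  move=> iI; have iI' : i \in mem (~: J) by rewrite /= inE.
  move/rowP: vJ => /(_ (enum_rank_in iI' i)); rewrite [RHS]mxE => <-.
  rewrite [LHS]mxE [RHS]mxE; apply: eq_bigr => k _.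
  by rewrite [in RHS]mxE enum_rankK_in.
have norm1 (P : 'M[R]_n) : P *m P^T = 1%:M -> (v *m v^T) 0 0 = \sum_i (v *m P^T) 0 i ^+ 2.
  move=> /mulmx1C PP; transitivity ((v *m P^T *m (v *m P^T)^T) 0 0).
    by rewrite trmx_mul trmxK !mulmxA -(mulmxA v) PP mulmx1.
  by rewrite row_dotE; apply: eq_bigr => i _; rewrite expr2.
have quadE : (v *m M *m v^T) 0 0 = \sum_i lam i * (v *m Q^T) 0 i ^+ 2.
  have -> : v *m M *m v^T = v *m Q^T *m diag_mx (\row_i lam i) *m (v *m Q^T)^T.
    rewrite -QM trmx_mul trmxK !mulmxA -(mulmxA v Q^T Q) (mulmx1C QQ) mulmx1.
    by rewrite -(mulmxA _ Q^T Q) (mulmx1C QQ) mulmx1.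
  rewrite row_dotE; apply: eq_bigr => i _; rewrite mul_mx_diag !mxE expr2.
  by rewrite mulrAC mulrC mulrA.
have vv : 0 < (v *m v^T) 0 0 by rewrite lt_def row_dot_ge0 row_dot_eq0 v0.
rewrite -(ler_pM2r vv).
apply: le_trans (_ : (v *m M *m v^T) 0 0 <= _).
  rewrite quadE (norm1 _ QQ) mulr_sumr ler_sum // => i _.
  have [/aI ai|/zI ->] := boolP (i \in I); last by rewrite expr0n /= !mulr0.
  by rewrite ler_wpM2r ?sqr_ge0.
apply: le_trans (le_quad v) _.
rewrite (norm1 _ QQ') mulr_sumr ler_sum // => i _.
have [/bJ ai|/zJ ->] := boolP (i \in J); last by rewrite expr0n /= !mulr0.
by rewrite ler_wpM2r ?sqr_ge0.
Qed.

End RowDot.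

(** [I] consists of [i] and the indices of strictly larger weight, [J] of those of weight at most
    [hi i]; their sizes add up to [n + 1]. Only strict inequalities between weights have to be
    reflected by [lam], so indices of equal weight may be listed in any order. *)
Lemma eigen_le (R : rcfType) n (M Q : 'M[R]_n) (lam hi : 'I_n -> R) (i : 'I_n) :
  M^T = M -> char_poly M = \prod_l ('X - (lam l)%:P) -> Q *m Q^T = 1%:M ->
  (forall v : 'rV_n, (v *m M *m v^T) 0 0 <= \sum_j hi j * (v *m Q^T) 0 j ^+ 2) ->
  (forall l, hi i < hi l -> lam i <= lam l) -> lam i <= hi i.
Proof.
move=> MM cM QQ Mhi hi_lam; have [B [BB BM]] := ortho_diag MM cM.
apply: (eigen_count (I := i |: [set l | hi i < hi l]) (J := [set l | hi l <= hi i])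
  BB QQ BM Mhi).
- by move=> l; rewrite !inE => /orP[/eqP->//|/hi_lam].
- by move=> l; rewrite inE.
rewrite cardsU1 inE ltxx/= -addnA.
have -> : [set l | hi l <= hi i]%SET = (~: [set l | hi i < hi l])%SET.
  by apply/setP => l; rewrite !inE leNgt.
by rewrite cardsC card_ord.
Qed.

Lemma eigen_ge (R : rcfType) n (M Q : 'M[R]_n) (lam lo : 'I_n -> R) (i : 'I_n) :
  M^T = M -> char_poly M = \prod_l ('X - (lam l)%:P) -> Q *m Q^T = 1%:M ->
  (forall v : 'rV_n, \sum_j lo j * (v *m Q^T) 0 j ^+ 2 <= (v *m M *m v^T) 0 0) ->
  (forall l, lo l < lo i -> lam l <= lam i) -> lo i <= lam i.
Proof.
move=> MM cM QQ Mlo lo_lam; have [B [BB BM]] := ortho_diag MM cM.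
have BNM : B *m (- M) *m B^T = diag_mx (\row_l (- lam l)).
  by rewrite mulmxN mulNmx BM; apply/matrixP => k l; rewrite !mxE mulNrn.
rewrite -lerN2.
apply: (eigen_count (I := i |: [set l | lo l < lo i]) (J := [set l | lo i <= lo l])
  (mu := fun l => - lo l) BB QQ BNM).
- move=> v; rewrite mulmxN mulNmx mxE lerNl -sumrN.
  by under eq_bigr do rewrite mulNr opprK; exact: Mlo.
- by move=> l; rewrite !inE lerN2 => /orP[/eqP->//|/lo_lam].
- by move=> l; rewrite inE lerN2.
rewrite cardsU1 inE ltxx/= -addnA.
have -> : [set l | lo i <= lo l]%SET = (~: [set l | lo l < lo i])%SET.
  by apply/setP => l; rewrite !inE leNgt.
by rewrite cardsC card_ord.
Qed.

(** * Eigenvalues of a nearly diagonal form with one distinguished index *)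

Section SplitSpectrum.
Variables (R : rcfType) (n : nat) (M Q : 'M[R]_n.+1) (lam : 'I_n.+1 -> R).
Variables (f : 'I_n -> R) (g dt dn : R).
Hypotheses (MM : M^T = M) (cM : char_poly M = \prod_l ('X - (lam l)%:P)).
Hypothesis QQ : Q *m Q^T = 1%:M.
Hypothesis MD : forall v : 'rV_n.+1,
  let T := \sum_(mu < n) (v *m Q^T) 0 (lift ord_max mu) ^+ 2 in
  let y := (v *m Q^T) 0 ord_max in
  `|(v *m M *m v^T) 0 0 -
    (\sum_(mu < n) f mu * (v *m Q^T) 0 (lift ord_max mu) ^+ 2 + g * y ^+ 2)| <=
  dt * T + dn * y ^+ 2.
Hypothesis lam_max : forall mu, lam ord_max <= lam (lift ord_max mu).

(** Diagonal weights shifted by the errors: [mark dt dn] bounds the form from above and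
    [mark (- dt) (- dn)] from below. *)
Let mark (a : R) (b : R) l : R := if unlift ord_max l is Some mu then f mu + a else g + b.

Let mark_sum a b (w : 'rV[R]_n.+1) : \sum_l mark a b l * w 0 l ^+ 2 =
  \sum_(mu < n) f mu * w 0 (lift ord_max mu) ^+ 2 + g * w 0 ord_max ^+ 2 +
  (a * \sum_(mu < n) w 0 (lift ord_max mu) ^+ 2 + b * w 0 ord_max ^+ 2).
Proof.
rewrite (bigD1_ord ord_max)//= /mark unlift_none.
under eq_bigr do rewrite liftK mulrDl.
by rewrite big_split/= -mulr_sumr; ring.
Qed.

Let hi_bound (v : 'rV[R]_n.+1) : (v *m M *m v^T) 0 0 <= \sum_l mark dt dn l * (v *m Q^T) 0 l ^+ 2.
Proof. by rewrite mark_sum -lerBlDl; apply: le_trans (ler_norm _) (MD v). Qed.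

Let lo_bound (v : 'rV[R]_n.+1) :
  \sum_l mark (- dt) (- dn) l * (v *m Q^T) 0 l ^+ 2 <= (v *m M *m v^T) 0 0.
Proof.
rewrite mark_sum -lerBrDl !mulNr -opprD lerNl.
by apply: le_trans (ler_norm _) _; rewrite normrN; exact: MD.
Qed.

(** The bound does not involve [dn]: the normal index only has to fall on the right side of the two
    counts. From above this is [g + dn <= f mu + dt]; from below it is [lam_max]. Hence [dn] may be
    much larger than [dt]. *)
Lemma tangent_eigenvalue mu :
  (forall nu nu', f nu < f nu' -> lam (lift ord_max nu) <= lam (lift ord_max nu')) ->
  g + dn <= f mu + dt -> `|lam (lift ord_max mu) - f mu| <= dt.
Proof.
move=> f_lam gf; rewrite ler_distl; apply/andP; split.
  have := eigen_ge (i := lift ord_max mu) MM cM QQ lo_bound; rewrite {3}/mark liftK.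
  apply=> l; rewrite /mark liftK; have [nu ->|->] := unliftP ord_max l.
    by rewrite ltrD2r => /f_lam.
  by move=> _; exact: lam_max.
have := eigen_le (i := lift ord_max mu) MM cM QQ hi_bound; rewrite {3}/mark liftK.
apply=> l; rewrite /mark liftK; have [nu ->|->] := unliftP ord_max l.
  by rewrite ltrD2r => /f_lam.
by rewrite ltNge gf.
Qed.

(** The roles are exchanged: [lam_max] serves the upper bound, the separation of the lower weights
    the lower bound, and [dt] is allowed to be crude. *)
Lemma normal_eigenvalue : (forall mu, g - dn <= f mu - dt) -> `|lam ord_max - g| <= dn.
Proof.
move=> gf; rewrite ler_distl; apply/andP; split.
  have := eigen_ge (i := ord_max) MM cM QQ lo_bound; rewrite {3}/mark unlift_none.
  apply=> l; rewrite /mark unlift_none; have [nu ->|->] := unliftP ord_max l.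
    by rewrite ltNge gf.
  by [].
have := eigen_le (i := ord_max) MM cM QQ hi_bound; rewrite {3}/mark unlift_none.
by apply=> l _; have [nu ->|-> //] := unliftP ord_max l; exact: lam_max.
Qed.

End SplitSpectrum.

(** * Integrals over balls *)

Section Integration.
Local Open Scope ereal_scope.

Section Sandwich.
Context d (T : measurableType d) (R : realType).
Variable mu : {measure set T -> \bar R}.
Implicit Types (D : set T).

(* Unlike [ge0_le_integral] and [le_Rintegral], the next lemmas ask nothing of
   the measurability of the function that is compared. *)
Lemma ge0_le_integral_nomeas D (f g : T -> \bar R) :
  (forall x, D x -> 0 <= f x) -> (forall x, D x -> f x <= g x) ->
  \int[mu]_(x in D) f x <= \int[mu]_(x in D) g x.
Proof.
move=> f0 fg; rewrite [leLHS]integral_mkcond [leRHS]integral_mkcond.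
have g0 x : D x -> 0 <= g x by move=> Dx; exact: le_trans (f0 _ Dx) (fg _ Dx).
rewrite !ge0_integralTE; [|exact: erestrict_ge0..].
apply: le_ereal_sup => _ [h /= hf <-]; exists h => // x.
exact: le_trans (hf x) (lee_restrict fg x).
Qed.

Lemma le_integral_sandwich D (g1 f g2 : T -> R) : measurable D ->
  mu.-integrable D (EFin \o g1) -> mu.-integrable D (EFin \o g2) ->
  (forall x, D x -> (g1 x <= f x <= g2 x)%R) ->
  (\int[mu]_(x in D) g1 x <= \int[mu]_(x in D) f x <= \int[mu]_(x in D) g2 x)%R.
Proof.
move=> mD i1 i2 gfg.
have le_int (u v : T -> R) : (forall x, D x -> (u x <= v x)%R) ->
    \int[mu]_(x in D) (u x)%:E <= \int[mu]_(x in D) (v x)%:E.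
  move=> uv; rewrite [leLHS]integralE [leRHS]integralE leeB//.
    apply: ge0_le_integral_nomeas => // x /mem_set.
    by apply: funepos_le => y /set_mem/uv; rewrite lee_fin.
  apply: ge0_le_integral_nomeas => // x /mem_set.
  by apply: funeneg_le => y /set_mem/uv; rewrite lee_fin.
have l1 := le_int _ _ (fun x Dx => proj1 (andP (gfg x Dx))).
have l2 := le_int _ _ (fun x Dx => proj2 (andP (gfg x Dx))).
have f1 := integrable_fin_num mD i1; have f2 := integrable_fin_num mD i2.
(* The two outer integrals are finite, which forces the middle one to be finite; only then is [fine]
   monotone. *)
have ff : \int[mu]_(x in D) (f x)%:E \is a fin_num.
  move: (l1) (l2) f1 f2; rewrite !fin_numE /=.
  case: (\int[mu]_(x in D) (f x)%:E) => //; case: (\int[mu]_(x in D) (g1 x)%:E) => //;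
    case: (\int[mu]_(x in D) (g2 x)%:E) => //.
by rewrite /Rintegral !fine_le.
Qed.

End Sandwich.

(** * Layer cake formula and Gamma values at half-integers *)

Section LayerCake.
Context {R : realType}.
Local Notation mu := (@lebesgue_measure R).

Lemma integral_expRN_tail (a : R) : (0 <= a)%R ->
  \int[mu]_(s in `[a, +oo[) (expR (- s))%:E = (expR (- a))%:E.
Proof.
move=> a0.
rewrite (@ge0_continuous_FTC2y _ _ (fun s => - expR (- s))%R _ 0)//.
- by rewrite sub0e EFinN oppeK.

- apply: continuous_subspaceT => x.
  by apply: continuous_comp; [exact: opp_continuous|exact: continuous_expR].
- rewrite -oppr0; apply: cvgN; exact: cvgr_expR.
- apply: cvgN; apply: cvg_comp; last exact: continuous_expR.
  by apply: cvgN; exact: cvg_at_right_filter.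
- move=> x _; rewrite derive1E.
  have h : is_derive x 1%R (fun s => - expR (- s))%R (expR (- x)).
    by apply: trigger_derive; rewrite mulrN1 opprK.
  exact: derive_val.
Qed.

(** [expR (- g x)] is the integral of [expR (- s)] over [s >= g x]; Tonelli exchanges the two
    integrals. Sublevel sets for [s < 0] are empty since [g] is nonnegative, and the endpoint
    [s = 0] is negligible. *)
Lemma layer_cake d (T : measurableType d)
    (m : {sigma_finite_measure set T -> \bar R}) (f g : T -> R) :
  measurable_fun setT f -> measurable_fun setT g ->
  (forall x, 0 <= f x)%R -> (forall x, 0 <= g x)%R ->
  \int[m]_x (f x * expR (- g x))%:E =
  \int[mu]_(s in `]0%R, +oo[)
    ((expR (- s))%:E * \int[m]_(x in [set x | (g x <= s)%R]) (f x)%:E).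
Proof.
move=> mf mg f0 g0.
pose E := [set z : T * measurableTypeR R | (g z.1 <= z.2)%R].
have mE : measurable E.
  rewrite -[E]setTI; apply: (measurable_fun_le measurableT).
    exact: measurableT_comp.
  exact: measurable_snd.
pose F (z : T * measurableTypeR R) := (f z.1 * (expR (- z.2) * \1_E z))%:E.
have mF : measurable_fun setT F.
  apply/measurable_EFinP; apply: measurable_funM; first exact: measurableT_comp.
  apply: measurable_funM; last exact: measurable_indic.
  apply: measurableT_comp => //; apply: measurableT_comp => //.
have F0 z : 0 <= F z by rewrite lee_fin !mulr_ge0// expR_ge0.
transitivity (\int[m]_x \int[mu]_s F (x, s)).
  apply: eq_integral => x _; rewrite EFinM -integral_expRN_tail//.
  rewrite -ge0_integralZl_EFin//; last first.
    apply/measurable_EFinP; apply: measurable_funTS.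
    by apply: measurableT_comp => //; exact: measurableT_comp.
  rewrite integral_mkcond; apply: eq_integral => s _.
  rewrite patchE /F indicE/= -EFinM; case: ifPn => [/set_mem|/negP sgx].
    rewrite /= in_itv/= andbT => gxs.
    by rewrite mem_set// mulr1.
  rewrite memNset ?mulr0// => gxs; apply: sgx; apply: mem_set.
  by rewrite /= in_itv/= andbT.
rewrite (fubini_tonelli F)//.
have FE s : \int[m]_x F (x, s) =
    (expR (- s))%:E * \int[m]_(x in [set x | (g x <= s)%R]) (f x)%:E.
  rewrite [in RHS]integral_mkcond -ge0_integralZl_EFin ?expR_ge0//.
  - apply: eq_integral => x _; rewrite patchE /F indicE/=.
    case: ifPn => [/set_mem/= gxs|/negP sgx].
      by rewrite mem_set// mulr1 mulrC.
    by rewrite memNset ?mulr0 ?mule0// => gxs; apply: sgx; apply: mem_set.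
  - by move=> x _; rewrite patchE; case: ifP; rewrite ?lee_fin.
  - apply/(measurable_restrictT _ _).1; last first.
      by apply: measurable_funTS; exact/measurable_EFinP.
    rewrite -[X in measurable X]setTI.
    exact: measurable_fun_le.
under eq_integral do rewrite FE.
rewrite integral_itv_obnd_cbnd; last first.
  apply: measurable_funTS; under eq_fun do rewrite -FE.
  exact: measurable_fun_fubini_tonelli_G.
rewrite [RHS]integral_mkcond; apply: eq_integral => s _.
rewrite patchE; case: ifPn => // /negP s0.
rewrite (_ : [set x | _] = set0) ?integral_set0 ?mule0//.
apply/seteqP; split => // x /= gxs; apply: s0; apply: mem_set.
by rewrite /= in_itv/= andbT (le_trans (g0 x)).
Qed.
(* This is [Gamma (N / 2 + 1)], see [Gamma_half]. *)
Definition gamma_half (N : nat) : \bar R :=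
  \int[mu]_(s in `]0%R, +oo[) (Num.sqrt s ^+ N * expR (- s))%:E.

Lemma measurable_sqrt : measurable_fun [set: R] (@Num.sqrt R).
Proof. by apply: continuous_measurable_fun => x; exact: sqrt_continuous. Qed.

Lemma measurable_gamma_half N (A : set R) :
  measurable_fun A (fun s : R => (Num.sqrt s ^+ N * expR (- s))%:E).
Proof.
apply: measurable_funTS; apply/measurable_EFinP; apply: measurable_funM.
  by apply: measurable_funX; exact: measurable_sqrt.
by apply: measurableT_comp => //; exact: measurableT_comp.
Qed.

Lemma gamma_half_ge0 N : 0 <= gamma_half N.
Proof.
apply: integral_ge0 => s _.
by rewrite lee_fin mulr_ge0 ?expR_ge0// exprn_ge0// sqrtr_ge0.
Qed.

(* This is the layer cake formula for a function whose integral over the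
   sublevel set [g <= s] is proportional to a power of [sqrt s]. *)
Lemma layer_cake_homogeneous d (T : measurableType d)
    (m : {sigma_finite_measure set T -> \bar R}) (f g : T -> R) N (M : \bar R) :
  measurable_fun setT f -> measurable_fun setT g ->
  (forall x, 0 <= f x)%R -> (forall x, 0 <= g x)%R -> 0 <= M ->
  (forall s : R, (0 < s)%R ->
    \int[m]_(x in [set x | (g x <= s)%R]) (f x)%:E = M * (Num.sqrt s ^+ N)%:E) ->
  \int[m]_x (f x * expR (- g x))%:E = M * gamma_half N.
Proof.
move=> mf mg f0 g0 M0 hM; rewrite layer_cake// /gamma_half -ge0_integralZl//.
- apply: eq_integral => s /set_mem/=; rewrite in_itv/= andbT => s0.
  by rewrite hM// muleCA EFinM [(_%:E * _%:E)%E]muleC.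
- exact: measurable_gamma_half.
Qed.

Lemma integral_sqrtX N (s : R) : (0 < s)%R ->
  \int[mu]_(u in `[0%R, s]) ((N%:R / 2 + 1) * Num.sqrt u ^+ N)%:E =
  (Num.sqrt s ^+ N.+2)%:E.
Proof.
move=> s0.
have cX k : continuous (fun u : R => Num.sqrt u ^+ k)%R.
  move=> x; apply: (@continuous_comp _ _ _ (@Num.sqrt R) (fun u => u ^+ k)%R).
    exact: sqrt_continuous.
  exact: exprn_continuous.
have cF : continuous (fun u : R => (N%:R / 2 + 1) * Num.sqrt u ^+ N)%R.
  by move=> x; apply: cvgM; [exact: cvg_cst|exact: cX].
have dX (x : R) : (0 < x)%R ->
    is_derive x 1%R (fun u : R => Num.sqrt u ^+ N.+2)%R
      ((N%:R / 2 + 1) * Num.sqrt x ^+ N)%R.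
  move=> x0; have ds := is_derive1_sqrt x0.
  rewrite -(exprfctE (@Num.sqrt R)).
  apply: (is_derive_eq (@is_deriveX _ _ _ N.+2 _ _ _ ds)).
  have sx : Num.sqrt x != 0%R by rewrite gt_eqF// sqrtr_gt0.
  by rewrite /GRing.scale/= exprS -[N.+2]addn2 natrD; field.
rewrite (@continuous_FTC2 _ _ (fun u => Num.sqrt u ^+ N.+2)%R)//.
- by rewrite sqrtr0 expr0n sube0.
- apply: continuous_subspaceT; exact: cF.
- split.
  + by move=> x; rewrite in_itv/= => /andP[x0 _]; have [] := dX _ x0.
  + by apply: cvg_at_right_filter; exact: cX.
  + by apply: cvg_at_left_filter; exact: cX.
- by move=> x; rewrite in_itv/= => /andP[x0 _]; rewrite derive1E; have [] := dX _ x0.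
Qed.

(** The functional equation [Gamma(z + 1) = z Gamma(z)] at [z = N/2 + 1]. The layer cake formula
    replaces integration by parts: with [g u = max(u, 0)], the integral of [z u^(N/2)] over the
    sublevel set of [s] is [s^z]. For [N > 0] the default value [Num.sqrt u = 0] at [u < 0] makes
    the integrand vanish on the negative axis. *)
Lemma gamma_half_rec N : (0 < N)%N ->
  gamma_half N.+2 = (N%:R / 2 + 1)%:E * gamma_half N.
Proof.
move=> N0.
have q0 : (0 <= N%:R / 2 + 1 :> R)%R by rewrite addr_ge0// divr_ge0.
pose f (u : R) := ((N%:R / 2 + 1) * Num.sqrt u ^+ N)%R.
have f0 u : (0 <= f u)%R by rewrite mulr_ge0// exprn_ge0// sqrtr_ge0.
have fneg u : (u <= 0)%R -> f u = 0%R.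
  by move=> u0; rewrite /f ler0_sqrtr// expr0n (gtn_eqF N0) mulr0.
have mf : measurable_fun setT f.
  by apply: measurable_funM => //; apply: measurable_funX; exact: measurable_sqrt.
have := @layer_cake_homogeneous _ _ mu f (fun u => Num.max u 0)%R N.+2 1 mf.
rewrite mul1e => <-//; last 3 first.
- by apply: measurable_maxr.
- by move=> u; rewrite le_max lexx orbT.
- move=> s s0; rewrite mul1e -integral_sqrtX//.
  rewrite [LHS]integral_mkcond [RHS]integral_mkcond; apply: eq_integral => u _.
  rewrite !patchE; case: ifPn => [/set_mem/=|/negP hu].
    rewrite ge_max => /andP[us _]; case: ifPn => // /negP hu.
    rewrite -/(f u) fneg//; rewrite leNgt; apply/negP => u0.
    by apply: hu; apply: mem_set; rewrite /= in_itv/= (ltW u0).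
  case: ifPn => // /set_mem/=; rewrite in_itv/= => /andP[u0 us].
  by exfalso; apply: hu; apply: mem_set; rewrite /= ge_max us ltW.
rewrite /gamma_half -ge0_integralZl_EFin//; last exact: measurable_gamma_half.
rewrite [RHS]integral_mkcond; apply: eq_integral => u _.
rewrite patchE; case: ifPn => [/set_mem/=|/negP hu].
  rewrite in_itv/= andbT => u0; rewrite max_l ?ltW// -EFinM; congr (_%:E).
  by rewrite /f mulrA.
rewrite fneg ?mul0r// leNgt; apply/negP => u0.
by apply: hu; apply: mem_set; rewrite /= in_itv/= u0.
Qed.

Lemma integral_even_power k (a : R) : (0 < a)%R ->
  \int[mu]_(x in `[(- a)%R, a]) (x ^+ k.*2)%:E =
  (2 / k.*2.+1%:R)%:E * (a ^+ k.*2.+1)%:E.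
Proof.
move=> a0.
have k0 : (k.*2.+1%:R != 0 :> R)%R by rewrite pnatr_eq0.
have dX (x : R) : is_derive x 1%R (fun u : R => k.*2.+1%:R^-1 * u ^+ k.*2.+1)%R
   (x ^+ k.*2)%R.
  have d1 : is_derive x 1%R (fun u : R => u ^+ k.*2.+1)%R (k.*2.+1%:R * x ^+ k.*2)%R.
    apply: DeriveDef; first exact: exprn_derivable.
    by rewrite exp_derive/= /GRing.scale/= mulr1.
  apply: (is_derive_eq (is_deriveZ k.*2.+1%:R^-1%R d1)).
  by rewrite /GRing.scale/= mulrA mulVf ?mul1r.
have cX (x : R) : {for x, continuous (fun u : R => k.*2.+1%:R^-1 * u ^+ k.*2.+1)%R}.
  by apply: differentiable_continuous; apply/derivable1_diffP; have [] := dX x.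
rewrite (@continuous_FTC2 _ _ (fun u => k.*2.+1%:R^-1 * u ^+ k.*2.+1)%R)//.
- rewrite -EFinB -EFinM exprNn -signr_odd/= odd_double/= expr1; congr (_%:E).
  by field.
- by rewrite gtrN.
- by apply: continuous_subspaceT => x; exact: exprn_continuous.
- split.
  + by move=> x _; have [] := dX x.
  + by apply: cvg_at_right_filter; exact: cX.
  + by apply: cvg_at_left_filter; exact: cX.
- by move=> x _; rewrite derive1E; have [] := dX x.
Qed.

(** Layer cake with [g x = x^2], whose sublevel sets are the intervals of radius [Num.sqrt s]. The
    value is [Gamma(k + 1/2)]. *)
Lemma gauss_moment k :
  \int[mu]_x (x ^+ k.*2 * expR (- x ^+ 2))%:E =
  (2 / k.*2.+1%:R)%:E * gamma_half k.*2.+1.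
Proof.
apply: layer_cake_homogeneous => //.
- by move=> x; rewrite -mul2n exprM exprn_ge0// sqr_ge0.
- by move=> x; rewrite sqr_ge0.
- move=> s s0; rewrite -integral_even_power ?sqrtr_gt0//.
  congr (integral _ _ _); apply/seteqP; split => x /=.
    rewrite in_itv/= => xs.
    by rewrite -ler_norml -sqrtr_sqr ler_wsqrtr.
  rewrite in_itv/= -ler_norml => xs.
  rewrite -(sqr_sqrtr (ltW s0)) -[leLHS]real_normK ?num_real//.
  by rewrite lerXn2r ?nnegrE ?sqrtr_ge0.
Qed.

End LayerCake.

(** * Scaling, Gaussian integrals and ball volumes in dimension n *)

Section LebesgueRn.
Context {R : realType}.
Local Notation mu := (@lebesgue_measure R).
Local Notation tup n := (n.-tuple (measurableTypeR R)).

Lemma integral_lebesgueRnS n (f : tup n.+1 -> \bar R) :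
  measurable_fun setT f -> (forall t, 0 <= f t) ->
  \int[lebesgueRn n.+1]_t f t =
  \int[mu]_x \int[lebesgueRn n]_t f [tuple of x :: t].
Proof.
move=> mf f0.
have := @ge0_integral_pushforward _ _ _ _ _ (@tcons R n) (@measurable_tcons R n)
  (mu \x lebesgueRn n) setT f measurableT mf (fun t _ => f0 t).
rewrite preimage_setT => pf; transitivity (\int[mu \x lebesgueRn n]_z (f \o @tcons R n) z).
  exact: pf.
rewrite fubini_tonelli1//=.
by apply: measurableT_comp => //; exact: measurable_tcons.
Qed.

Lemma integral_lebesgueRn0 (f : tup 0 -> \bar R) :
  measurable_fun setT f -> \int[lebesgueRn 0]_t f t = f [tuple].
Proof. by move=> mf; rewrite integral_dirac// diracT mul1e. Qed.

Lemma measurable_tcons_sec n (f : tup n.+1 -> \bar R) (x : R) :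
  measurable_fun setT f -> measurable_fun setT (fun t : tup n => f [tuple of x :: t]).
Proof.
move=> mf; apply: measurableT_comp => //.
by apply: measurable_cons => //; exact: measurable_cst.
Qed.

Lemma integral_lebesgueRn_prod n (phi : 'I_n -> measurableTypeR R -> R) (c : 'I_n -> R) :
  (forall i, measurable_fun setT (phi i)) -> (forall i x, 0 <= phi i x)%R ->
  (forall i, \int[mu]_x (phi i x)%:E = (c i)%:E) ->
  \int[lebesgueRn n]_t (\prod_i phi i (tnth t i))%R%:E = (\prod_i c i)%R%:E.
Proof.
have mprod k (psi : 'I_k -> measurableTypeR R -> R) : (forall i, measurable_fun setT (psi i)) ->
    measurable_fun setT (fun t : tup k => (\prod_i psi i (tnth t i))%R%:E).
  move=> mpsi; apply/measurable_EFinP; apply: measurable_prod => i _.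
  by apply: measurableT_comp => //; exact: measurable_tnth.
elim: n => [|n IH] in phi c * => mphi phi0 hc.
  by rewrite integral_lebesgueRn0 ?big_ord0//; exact: mprod.
rewrite integral_lebesgueRnS; last 2 first.
- exact: mprod.
- by move=> t; rewrite lee_fin prodr_ge0.
rewrite [in RHS]big_ord_recl EFinM -hc -ge0_integralZr//; last 3 first.
- exact/measurable_EFinP.
- by move=> x _; rewrite lee_fin.
- rewrite lee_fin prodr_ge0// => i _.
  by rewrite -lee_fin -hc integral_ge0// => x _; rewrite lee_fin.
apply: eq_integral => x _.
under eq_integral do rewrite big_ord_recl tnth0 EFinM.
rewrite ge0_integralZl_EFin//.
- congr (_ * _); rewrite -(IH (fun i => phi (lift ord0 i)))//.
  apply: eq_integral => t _; congr (_%:E); apply: eq_bigr => i _.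
  by rewrite tnthS.
- by move=> t _; rewrite lee_fin prodr_ge0.
- under eq_fun do under eq_bigr do rewrite tnthS.
  exact: (mprod n (fun i => phi (lift ord0 i))).
Qed.

(** [|c|] times the image measure under [x -> c x] has the right value on half-open intervals, hence
    is the Lebesgue measure. Negative [c] is included, as reflections are used for parity; the
    preimage of an interval is then half-open on the other side, with the same length. *)
Lemma lebesgue_measure_scale (c : R) (f : R -> \bar R) : c != 0%R ->
  measurable_fun setT f -> (forall x, 0 <= f x) ->
  \int[mu]_x f x = `|c|%:E * \int[mu]_x f (c * x)%R.
Proof.
move=> c0 mf f0.
have mc : measurable_fun setT (fun x : measurableTypeR R => (c * x)%R : measurableTypeR R).
  exact: measurable_funM.
pose phi (x : measurableTypeR R) : measurableTypeR R := (c * x)%R.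
pose pm : {measure set (measurableTypeR R) -> \bar R} :=
  @measure_function_pushforward__canonical__measure_function_Measure
    _ _ _ _ _ mu phi mc.
pose k : {nonneg R} := NngNum (normr_ge0 c).
transitivity (\int[mscale k pm]_x f x).
  apply: eq_measure_integral => A mA _.
  apply: lebesgue_measure_unique => //= _ [[a b]] _ <-.
  rewrite /mscale/= /pushforward lebesgue_measure_itv/= lte_fin.
  have [cn|cp|ceq0] := ltgtP c 0%R; last by rewrite ceq0 eqxx in c0.
  - rewrite (_ : _ @^-1` _ = `[(b / c)%R, (a / c)%R[%classic); last first.
      apply/seteqP; split => x /=; rewrite !in_itv/= => /andP[h1 h2]; apply/andP.
        by split; [rewrite ler_ndivrMr// mulrC|rewrite ltr_ndivlMr// mulrC].
      by split; [rewrite /phi mulrC -ltr_ndivlMr|rewrite /phi mulrC -ler_ndivrMr].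
    rewrite lebesgue_measure_itv/= lte_fin ltr_ndivlMr// divfK ?lt_eqF//.
    case: ifPn => _; last by rewrite mule0.
    by rewrite -!EFinB -EFinM ltr0_norm//; congr (_%:E); field; rewrite lt_eqF.
  - rewrite (_ : _ @^-1` _ = `](a / c)%R, (b / c)%R]%classic); last first.
      apply/seteqP; split => x /=; rewrite !in_itv/= => /andP[h1 h2]; apply/andP.
        by split; [rewrite ltr_pdivrMr// mulrC|rewrite ler_pdivlMr// mulrC].
      by split; [rewrite /phi mulrC -ltr_pdivrMr|rewrite /phi mulrC -ler_pdivlMr].
    rewrite lebesgue_measure_itv/= lte_fin ltr_pdivrMr// divfK ?gt_eqF//.
    case: ifPn => _; last by rewrite mule0.
    by rewrite -!EFinB -EFinM gtr0_norm//; congr (_%:E); field; rewrite gt_eqF.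
by rewrite ge0_integral_mscale//= ge0_integral_pushforward.
Qed.

Definition tscale n (c : 'I_n -> R) (t : tup n) : tup n :=
  [tuple (c i * tnth t i)%R | i < n].

Lemma measurable_tscale n (c : 'I_n -> R) : measurable_fun setT (tscale c).
Proof.
apply/measurable_fun_tnthP => i.
under [X in measurable_fun _ X]eq_fun do rewrite /= tnth_mktuple.
by apply: measurable_funM => //; exact: measurable_tnth.
Qed.

Lemma tscale_cons n (c : 'I_n.+1 -> R) (x : R) (t : tup n) :
  tscale c [tuple of x :: t] =
  [tuple of (c ord0 * x)%R :: tscale (fun i => c (lift ord0 i)) t].
Proof.
apply: eq_from_tnth => i; rewrite tnth_mktuple.
case: (unliftP ord0 i) => [j|] ->; first by rewrite !tnthS tnth_mktuple.
by rewrite !tnth0.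
Qed.

(** Each coordinate has its own factor of any sign, so that one statement gives dilations, the
    antipodal map and the reflection of a single coordinate. *)
Lemma lebesgueRn_scale n (c : 'I_n -> R) (f : tup n -> \bar R) :
  (forall i, c i != 0%R) -> measurable_fun setT f -> (forall t, 0 <= f t) ->
  \int[lebesgueRn n]_t f t =
  (\prod_i `|c i|)%R%:E * \int[lebesgueRn n]_t f (tscale c t).
Proof.
elim: n => [|n IH] in c f * => c0 mf f0.
  rewrite !integral_lebesgueRn0//; last first.
    by apply: measurableT_comp => //; exact: measurable_tscale.
  by rewrite big_ord0 mul1e; congr f; exact/val_inj/esym/size0nil/size_tuple.
rewrite !integral_lebesgueRnS//; last first.
  by apply: measurableT_comp => //; exact: measurable_tscale.
pose c' i := c (lift ord0 i).
pose G x := \int[lebesgueRn n]_t f [tuple of x :: tscale c' t].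
have mh : measurable_fun setT (fun z : measurableTypeR R * tup n =>
    f [tuple of z.1 :: tscale c' z.2]).
  apply: measurableT_comp => //; apply: measurable_cons; first exact: measurable_fst.
  by apply: measurableT_comp; [exact: measurable_tscale|exact: measurable_snd].
have mG : measurable_fun setT G by exact: (measurable_fun_fubini_tonelli_F _ mh).
have G0 x : 0 <= G x by exact: integral_ge0.
rewrite big_ord_recl mulrC EFinM -muleA.
under [in RHS]eq_integral do under eq_integral do rewrite tscale_cons.
rewrite -(lebesgue_measure_scale (c0 ord0) mG G0) -ge0_integralZl_EFin//; last first.
  by rewrite prodr_ge0.
apply: eq_integral => x _; rewrite (IH c')//; last exact: measurable_tcons_sec.
by move=> i; exact: c0.
Qed.

Definition sqn n (t : tup n) : R := (\sum_i tnth t i ^+ 2)%R.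

Definition cball n (r : R) : set (tup n) := [set t | (sqn t <= r ^+ 2)%R].

Lemma mem_cball n r (t : tup n) : (t \in cball r) = (sqn t <= r ^+ 2)%R.
Proof. by apply/idP/idP => [/set_mem|h] //; exact: mem_set. Qed.

Lemma measurable_sqn n : measurable_fun setT (@sqn n).
Proof.
apply: measurable_sum => i; apply: measurable_funX; exact: measurable_tnth.
Qed.

Lemma sqn_ge0 n (t : tup n) : (0 <= sqn t)%R.
Proof. by apply: sumr_ge0 => i _; rewrite sqr_ge0. Qed.

Lemma measurable_cball n r : measurable (@cball n r).
Proof.
rewrite -[X in measurable X]setTI.
by apply: measurable_fun_le => //; exact: measurable_sqn.
Qed.

Lemma measurable_restrict_cball n (f : tup n -> R) r : measurable_fun setT f ->
  measurable_fun setT ((fun t => (f t)%:E) \_ (@cball n r)).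
Proof.
move=> mf; apply/(measurable_restrictT _ _).1; first exact: measurable_cball.
by apply: measurable_funTS; exact/measurable_EFinP.
Qed.

Lemma cball_homogeneous n (f : tup n -> R) k (r : R) : (0 < r)%R ->
  measurable_fun setT f -> (forall t, 0 <= f t)%R ->
  (forall t, f (tscale (fun=> r) t) = r ^+ k * f t)%R ->
  \int[lebesgueRn n]_(t in cball r) (f t)%:E =
  (\int[lebesgueRn n]_(t in cball 1) (f t)%:E) * (r ^+ (n + k))%:E.
Proof.
move=> r0 mf f0 hf.
have mfb : measurable_fun setT ((fun t => (f t)%:E) \_ (@cball n r)).
  exact: measurable_restrict_cball.
rewrite integral_mkcond (lebesgueRn_scale (c := fun=> r))//; last 2 first.
- by move=> i; rewrite gt_eqF.
- by move=> t; apply: erestrict_ge0 => // *; rewrite lee_fin.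
rewrite prodr_const card_ord gtr0_norm// [in RHS]integral_mkcond.
rewrite [RHS]muleC exprD EFinM -muleA; congr (_ * _).
rewrite -ge0_integralZl_EFin ?exprn_ge0 ?ltW//; last 2 first.
- by move=> t _; apply: erestrict_ge0 => // *; rewrite lee_fin.
- exact: measurable_restrict_cball.
apply: eq_integral => t _.
have sqE : sqn (tscale (fun=> r) t) = (r ^+ 2 * sqn t)%R.
  by rewrite /sqn mulr_sumr; apply: eq_bigr => i _; rewrite tnth_mktuple exprMn.
have ballE : (tscale (fun=> r) t \in cball r) = (t \in cball 1).
  by rewrite !mem_cball sqE -[leRHS]mulr1 ler_pM2l ?exprn_gt0// expr1n.
by rewrite !patchE ballE; case: ifPn => _; rewrite ?mule0// hf EFinM.
Qed.

(** This takes the place of polar coordinates: the sublevel sets of [sqn] are balls of radius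
    [Num.sqrt s], over which the integral of a homogeneous function of degree [k] scales like the
    power [n + k] of the radius. *)
Lemma gauss_cball n (f : tup n -> R) k :
  measurable_fun setT f -> (forall t, 0 <= f t)%R ->
  (forall r t, (0 < r)%R -> f (tscale (fun=> r) t) = r ^+ k * f t)%R ->
  \int[lebesgueRn n]_t (f t * expR (- sqn t))%:E =
  (\int[lebesgueRn n]_(t in cball 1) (f t)%:E) * gamma_half (n + k).
Proof.
move=> mf f0 hf; apply: layer_cake_homogeneous => //.
- exact: measurable_sqn.
- exact: sqn_ge0.
- by apply: integral_ge0 => t _; rewrite lee_fin.
- move=> s s0; rewrite -(@cball_homogeneous _ _ k (Num.sqrt s))//.
  + by congr (integral _ _ _); apply/seteqP; split => t /=;
      rewrite /cball/= sqr_sqrtr// ltW.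
  + by rewrite sqrtr_gt0.
  + by move=> t; rewrite hf// sqrtr_gt0.
Qed.

(** The moments of order [2k] of the probability density [exp(-x^2) / sqrt(pi)]: 1, 1/2 and 3/4 for
    [k = 0, 1, 2]. Beyond 2 the value is arbitrary, since no moment of degree above 4 is taken. *)
Definition gauss_ratio (k : nat) : R :=
  if k is k'.+1 then if k' is 0 then 2^-1 else 3 / 4 else 1.

Lemma gamma_half1 : gamma_half 1 = (Num.sqrt pi / 2 : R)%:E.
Proof.
have := @gauss_moment R 0; rewrite /= divr1.
have -> : \int[mu]_x (x ^+ 0 * expR (- x ^+ 2))%:E = (Num.sqrt pi)%:E.
  by rewrite -integralT_gauss; apply: eq_integral => x _; rewrite expr0 mul1r.
move=> /(congr1 (fun z => (2^-1)%:E * z)).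
rewrite muleA -!EFinM mulVf// mul1e => <-; congr (_%:E); exact: mulrC.
Qed.

Lemma gauss_moment_small k : (k <= 2)%N ->
  \int[mu]_x (x ^+ k.*2 * expR (- x ^+ 2))%:E =
  (Num.sqrt pi * gauss_ratio k : R)%:E.
Proof.
rewrite gauss_moment; case: k => [|[|[|//]]] _ /=.
- rewrite -[0.*2.+1]/1%N gamma_half1 -EFinM; congr (_%:E); by field.
- rewrite -[1.*2.+1]/3%N (gamma_half_rec (isT : 0 < 1)%N) gamma_half1 -!EFinM.
  by congr (_%:E); field.
- rewrite -[2.*2.+1]/5%N (gamma_half_rec (isT : 0 < 3)%N).
  rewrite (gamma_half_rec (isT : 0 < 1)%N) gamma_half1 -!EFinM.
  by congr (_%:E); field.
Qed.

(** Both sides are the Gaussian integral of the monomial: on the left by homogeneity, on the right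
    as a product of one-dimensional integrals. *)
Lemma cball_monomial_gamma n (b : 'I_n -> nat) : (forall i, b i <= 2)%N ->
  (\int[lebesgueRn n]_(t in cball 1) (\prod_i tnth t i ^+ (b i).*2)%R%:E) *
    gamma_half (n + (\sum_i b i).*2) =
  (Num.sqrt pi ^+ n * \prod_i gauss_ratio (b i))%R%:E.
Proof.
move=> b2; rewrite -gauss_cball.
- have -> : (Num.sqrt pi ^+ n = \prod_(i < n) Num.sqrt pi :> R)%R.
    by rewrite prodr_const card_ord.
  rewrite -big_split/=.
  rewrite -(integral_lebesgueRn_prod
    (phi := fun i (x : measurableTypeR R) => x ^+ (b i).*2 * expR (- x ^+ 2))%R).
  + apply: eq_integral => t _; congr (_%:E).
    by rewrite big_split/= /sqn -sumrN expR_sum.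
  + move=> i; apply: measurable_funM; first exact: measurable_funX.
    by apply: measurableT_comp => //; apply: measurableT_comp => //; exact: measurable_funX.
  + by move=> i x; rewrite mulr_ge0 ?expR_ge0// -mul2n exprM exprn_ge0// sqr_ge0.
  + by move=> i; rewrite gauss_moment_small.
- apply: measurable_prod => i _; apply: measurable_funX; exact: measurable_tnth.
- move=> t; apply: prodr_ge0 => i _.
  by rewrite -mul2n exprM exprn_ge0// sqr_ge0.
- move=> r t r0; under eq_bigr do rewrite tnth_mktuple exprMn.
  rewrite big_split/= -expr_sum; congr (r ^+ _ * _)%R.
  by rewrite -mul2n big_distrr/=; apply: eq_bigr => i _; rewrite mul2n.
Qed.

(** Applied to the volume of the unit ball times a Gamma value: their product is a known positive
    real, which makes the Gamma integral finite without any estimate of it. *)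
Lemma mule_fin_pos (x y : \bar R) (r : R) : (0 < r)%R -> 0 <= x -> 0 <= y ->
  x * y = r%:E -> x \is a fin_num /\ y \is a fin_num.
Proof.
move=> r0; case: x => [x| |]//; case: y => [y| |]//; rewrite ?lee_fin => x0 y0.
- by move: x0; rewrite le_eqVlt => /predU1P[<-|x0];
    [rewrite mul0e => -[E]; rewrite -E ltxx in r0|rewrite gt0_muley].
- by move: y0; rewrite le_eqVlt => /predU1P[<-|y0];
    [rewrite mule0 => -[E]; rewrite -E ltxx in r0|rewrite gt0_mulye].
Qed.

Lemma powR_half (x : R) n : (0 <= x)%R -> (x `^ (n%:R / 2) = Num.sqrt x ^+ n)%R.
Proof.
by move=> x0; rewrite mulrC powRrM powR12_sqrt// powR_mulrn// sqrtr_ge0.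
Qed.

Lemma Gamma_half n : Gamma (n%:R / 2 + 1 : R) = fine (gamma_half n : \bar R).
Proof.
congr fine; apply: eq_integral => t /set_mem/=; rewrite in_itv/= andbT => t0.
by rewrite addrK powR_half// ltW.
Qed.

Lemma cball1_gamma n :
  (\int[lebesgueRn n]_(t in cball 1) 1%R%:E) * gamma_half n =
  (Num.sqrt pi ^+ n : R)%:E.
Proof.
have := @cball_monomial_gamma n (fun=> 0%N) (fun=> isT).
rewrite big1// addn0 [(\prod_i gauss_ratio _)%R]big1// mulr1 => <-; congr (_ * _).
Qed.

Lemma sqrt_pi_gt0 : (0 < Num.sqrt pi :> R)%R.
Proof. by rewrite sqrtr_gt0 pi_gt0. Qed.

Lemma gamma_half_fin n : (gamma_half n : \bar R) \is a fin_num.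
Proof.
apply: (proj2 (mule_fin_pos _ _ _ (cball1_gamma n))).
- by rewrite exprn_gt0// sqrt_pi_gt0.
- by apply: integral_ge0 => t _; rewrite lee_fin.
- exact: gamma_half_ge0.
Qed.

Lemma gamma_half_gt0 n : (0 < fine (gamma_half n : \bar R))%R.
Proof.
rewrite lt_def fine_ge0 ?gamma_half_ge0// andbT; apply/eqP => g0.
have := cball1_gamma n; rewrite -(fineK (gamma_half_fin n)) g0 mule0 => -[].
by move/esym/eqP; rewrite expf_eq0 gt_eqF ?sqrt_pi_gt0// andbF.
Qed.

Lemma ball_volumeE n (r : R) : ball_volume n r =
  (Num.sqrt pi ^+ n / fine (gamma_half n : \bar R) * r ^+ n)%R.
Proof. by rewrite /ball_volume Gamma_half powR_half ?pi_ge0// mulrAC. Qed.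

Lemma ball_volume_gt0 n (r : R) : (0 < r)%R -> (0 < ball_volume n r)%R.
Proof.
move=> r0; rewrite ball_volumeE mulr_gt0 ?exprn_gt0// divr_gt0 ?gamma_half_gt0//.
by rewrite exprn_gt0// sqrt_pi_gt0.
Qed.

(** The rising factorial of [n/2 + 1], that is [Gamma(n/2 + 1 + k) / Gamma(n/2 + 1)]. *)
Definition gamma_rising n k : R := (\prod_(j < k) ((n + j.*2)%:R / 2 + 1))%R.

Lemma gamma_rising_gt0 n k : (0 < gamma_rising n k)%R.
Proof. by apply: prodr_gt0 => j _; rewrite ltr_wpDl// divr_ge0. Qed.

Lemma gamma_half_rising n k : (0 < n)%N ->
  gamma_half (n + k.*2) = ((gamma_rising n k)%:E * gamma_half n : \bar R).
Proof.
move=> n0; elim: k => [|k IH]; first by rewrite addn0 /gamma_rising big_ord0 mul1e.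
rewrite doubleS !addnS gamma_half_rec ?addn_gt0 ?n0// IH muleA -EFinM.
by congr (_%:E * _); rewrite /gamma_rising big_ord_recr/= mulrC.
Qed.

Lemma cball_monomial n (b : 'I_n -> nat) (r : R) : (0 < n)%N -> (0 < r)%R ->
  (forall i, b i <= 2)%N ->
  \int[lebesgueRn n]_(t in cball r) (\prod_i tnth t i ^+ (b i).*2)%R%:E =
  (ball_volume n r * r ^+ (\sum_i b i).*2 * (\prod_i gauss_ratio (b i)) /
   gamma_rising n (\sum_i b i))%R%:E.
Proof.
move=> n0 r0 b2; set k := (\sum_i b i)%N.
rewrite (cball_homogeneous (k := k.*2))//; last 3 first.
- apply: measurable_prod => i _; apply: measurable_funX; exact: measurable_tnth.
- move=> t; apply: prodr_ge0 => i _.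
  by rewrite -mul2n exprM exprn_ge0// sqr_ge0.
- move=> t; under eq_bigr do rewrite tnth_mktuple exprMn.
  rewrite big_split/= -expr_sum; congr (r ^+ _ * _)%R.
  by rewrite -mul2n big_distrr/=; apply: eq_bigr => i _; rewrite mul2n.
have := cball_monomial_gamma b2; rewrite -/k.
set M := \int[_]_(t in _) _; set p := (\prod_i gauss_ratio _)%R.
rewrite gamma_half_rising// -(fineK (gamma_half_fin n)) -EFinM ball_volumeE.
have g0 := gamma_half_gt0 n; have c0 := gamma_rising_gt0 n k.
set g := fine _ in g0 *; set c := gamma_rising n k in c0 * => MgE.
have cg0 : (c * g != 0)%R by rewrite mulf_neq0 ?gt_eqF.
have -> : M = (Num.sqrt pi ^+ n * p / (c * g))%R%:E.
  by rewrite EFinM -MgE -muleA -EFinM divff// mule1.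
rewrite -EFinM; congr (_%:E); rewrite exprD; field.
by rewrite !gt_eqF.
Qed.

(** The sign change exchanges the positive and the negative part, so their integrals agree. If both
    are infinite, [fine] still sends the difference to 0; thus integrability does not have to be
    assumed. *)
Lemma cball_odd n (c : 'I_n -> R) (f : tup n -> R) (r : R) :
  (forall i, `|c i| = 1)%R -> measurable_fun setT f ->
  (forall t, f (tscale c t) = - f t)%R ->
  (\int[lebesgueRn n]_(t in cball r) f t = 0)%R.
Proof.
move=> c1 mf fN.
have sqE t : sqn (tscale c t) = sqn t.
  rewrite /sqn; apply: eq_bigr => i _.
  by rewrite tnth_mktuple exprMn -(real_normK (num_real (c i))) c1 expr1n mul1r.
pose g := ((fun t => (f t)%:E) \_ (@cball n r)).
have gN t : g (tscale c t) = - g t.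
  by rewrite /g !patchE !mem_cball sqE; case: ifP => _; rewrite ?oppe0// fN EFinN.
have mg : measurable_fun setT g by exact: measurable_restrict_cball.
have key : \int[lebesgueRn n]_t g^\+ t = \int[lebesgueRn n]_t g^\- t.
  rewrite (lebesgueRn_scale (c := c)) ; last 3 first.
  - by move=> i; rewrite -normr_gt0 c1.
  - exact: measurable_funepos.
  - by move=> t; exact: funepos_ge0.
  rewrite big1// mul1e; apply: eq_integral => t _.
  by rewrite !funeposE !funenegE gN.
rewrite /Rintegral integral_mkcond integralE -/g key.
by case: (\int[_]_t g^\- t) => [x| |] //=; rewrite subrr.
Qed.

Local Open Scope ring_scope.

(** * Moments of polynomials over balls *)

Lemma normr_tnth n (t : tup n) (i : 'I_n) r : 0 <= r -> sqn t <= r ^+ 2 ->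
  `|tnth t i| <= r.
Proof.
move=> r0 tr; rewrite -(ler_pXn2r (n := 2)) ?nnegrE// real_normK ?num_real//.
apply: le_trans tr; rewrite /sqn (bigD1 i)//= lerDl.
by apply: sumr_ge0 => j _; rewrite sqr_ge0.
Qed.

(** A class that contains the polynomials, is closed under sums and products (which integrability
    alone is not), and consists of functions integrable on every ball when [n > 0]. *)
Definition bounded_meas n (f : tup n -> R) : Prop := measurable_fun setT f /\
  forall r : R, 0 < r -> exists K : R, forall t, sqn t <= r ^+ 2 -> `|f t| <= K.

Lemma bounded_meas_cst n (k : R) : bounded_meas (fun _ : tup n => k).
Proof. by split=> [|r _]; [exact: measurable_cst|exists `|k|]. Qed.

Lemma bounded_meas_tnth n (i : 'I_n) : bounded_meas (fun t : tup n => tnth t i).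
Proof.
split=> [|r r0]; first exact: measurable_tnth.
by exists r => t; apply: normr_tnth; exact: ltW.
Qed.

Lemma bounded_measD n (f g : tup n -> R) : bounded_meas f -> bounded_meas g ->
  bounded_meas (fun t => f t + g t).
Proof.
move=> [mf bf] [mg bg]; split=> [|r r0]; first exact: measurable_funD.
have [K fK] := bf r r0; have [L gL] := bg r r0.
by exists (K + L) => t tr; rewrite (le_trans (ler_normD _ _))// lerD ?fK ?gL.
Qed.

Lemma bounded_measM n (f g : tup n -> R) : bounded_meas f -> bounded_meas g ->
  bounded_meas (fun t => f t * g t).
Proof.
move=> [mf bf] [mg bg]; split=> [|r r0]; first exact: measurable_funM.
have [K fK] := bf r r0; have [L gL] := bg r r0.
by exists (K * L) => t tr; rewrite normrM ler_pM ?fK ?gL.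
Qed.

Lemma bounded_measZ n (k : R) (f : tup n -> R) : bounded_meas f ->
  bounded_meas (fun t => k * f t).
Proof. by move=> hf; apply: bounded_measM => //; exact: bounded_meas_cst. Qed.

Lemma bounded_meas_sum n (I : Type) (s : seq I) (f : I -> tup n -> R) :
  (forall i, bounded_meas (f i)) -> bounded_meas (fun t => \sum_(i <- s) f i t).
Proof.
move=> hf; elim: s => [|i s IH].
  by under eq_fun do rewrite big_nil; exact: bounded_meas_cst.
by under eq_fun do rewrite big_cons; exact: bounded_measD.
Qed.

Lemma cball_volume n (r : R) : (0 < n)%N -> 0 < r ->
  lebesgueRn n (cball r) = (ball_volume n r)%:E.
Proof.
move=> n0 r0; have := @cball_monomial n (fun=> 0%N) r n0 r0 (fun=> isT).
rewrite big1// expr0 mulr1 [\prod_i gauss_ratio _]big1// mulr1.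
rewrite /gamma_rising big_ord0 divr1 => <-.
transitivity (\int[lebesgueRn n]_(t in cball r) cst 1%E t)%E.
  by rewrite integral_cst ?mul1e//; exact: measurable_cball.
by apply: eq_integral.
Qed.

Lemma integrable_cball n (r : R) (f : tup n -> R) : (0 < n)%N -> 0 < r ->
  bounded_meas f -> (lebesgueRn n).-integrable (cball r) (EFin \o f).
Proof.
move=> n0 r0 [mf bf]; apply: measurable_bounded_integrable.
- exact: measurable_cball.
- by rewrite [X in (X < _)%E]cball_volume// ltry.
- exact: measurable_funTS.
- have [K fK] := bf r r0; exists K; split; first exact: num_real.
  by move=> M KM t /= tr; rewrite (le_trans (fK t tr))// ltW.
Qed.

Definition cball_int n (r : R) (f : tup n -> R) : R :=
  \int[lebesgueRn n]_(t in cball r) f t.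

Section CballInt.
Variables (n : nat) (r : R).
Hypotheses (n0 : (0 < n)%N) (r0 : 0 < r).
Local Notation V := (ball_volume n r).

Lemma cball_intD f g : bounded_meas f -> bounded_meas g ->
  @cball_int n r (fun t => f t + g t) = cball_int r f + cball_int r g.
Proof.
by move=> hf hg; apply: RintegralD;
  [exact: measurable_cball|exact: integrable_cball..].
Qed.

Lemma cball_intZ k f : bounded_meas f ->
  @cball_int n r (fun t => k * f t) = k * cball_int r f.
Proof.
by move=> hf; apply: RintegralZl; [exact: measurable_cball|exact: integrable_cball].
Qed.

Lemma cball_int_cst k : @cball_int n r (fun=> k) = k * V.
Proof.
rewrite /cball_int Rintegral_cst; last exact: measurable_cball.
by rewrite [X in fine X]cball_volume.
Qed.

Lemma cball_int_sum (I : Type) (s : seq I) (f : I -> tup n -> R) :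
  (forall i, bounded_meas (f i)) ->
  cball_int r (fun t => \sum_(i <- s) f i t) = \sum_(i <- s) cball_int r (f i).
Proof.
move=> hf; elim: s => [|i s IH].
  rewrite big_nil; under [X in cball_int r X]eq_fun do rewrite big_nil.
  by rewrite cball_int_cst mul0r.
rewrite big_cons; under [X in cball_int r X]eq_fun do rewrite big_cons.
by rewrite cball_intD ?IH//; exact: bounded_meas_sum.
Qed.

Lemma cball_int_squares (i j : 'I_n) :
  cball_int r (fun t => tnth t i ^+ 2 * tnth t j ^+ 2) =
  V * r ^+ 4 / ((n%:R + 2) * (n%:R + 4)) * (1 + 2 * (i == j)%:R).
Proof.
pose b (k : 'I_n) : nat := ((k == i) + (k == j))%N.
have sumb (k : 'I_n) : (\sum_(l < n) (l == k) = 1)%N.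
  by rewrite (bigD1 k)//= eqxx big1// => l /negbTE ->.
have b2 l : (b l <= 2)%N by rewrite /b; case: eqP => _; case: eqP.
have := cball_monomial n0 r0 b2.
have -> : (\sum_l b l = 2)%N by rewrite /b big_split/= !sumb.
have -> : \prod_l gauss_ratio (b l) = (1 + 2 * (i == j)%:R) / 4.
  have [ij|ij] := eqVneq i j.
    rewrite (bigD1 i)//= big1 => [|l /negbTE li]; last by rewrite /b -ij li.
    by rewrite /b -ij eqxx/=; field.
  rewrite (bigD1 i)//= (bigD1 j) 1?eq_sym//= big1 => [|l /andP[/negbTE li /negbTE lj]];
    last by rewrite /b li lj.
  by rewrite /b !eqxx (negbTE ij) eq_sym (negbTE ij)/=; field.
(* [gamma_rising n 2] is [(n + 2)(n + 4) / 4], and its 4 cancels the one of the Gaussian moments. *)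
move=> h; transitivity (fine (V * r ^+ 2.*2 * ((1 + 2 * (i == j)%:R) / 4) /
    gamma_rising n 2)%:E); last first.
  rewrite /= /gamma_rising !big_ord_recr big_ord0/= mul1r addn0 natrD.
  have n2 : n%:R + 2 != 0 :> R by rewrite gt_eqF// ltr_wpDl.
  have n4 : n%:R + 4 != 0 :> R by rewrite gt_eqF// ltr_wpDl.
  rewrite -[2.*2]/4%N -[1.*2]/2%N; field.
  by rewrite n2 n4.
rewrite -h /cball_int /Rintegral; congr fine; apply: eq_integral => t _; congr (_%:E).
have one (k : 'I_n) : \prod_l tnth t l ^+ (l == k).*2 = tnth t k ^+ 2.
  rewrite (bigD1 k)//= eqxx big1 ?mulr1// => l /negbTE ->.
  by rewrite expr0.
by under eq_bigr do rewrite /b doubleD exprD; rewrite big_split/= !one.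
Qed.

Definition flip (i : 'I_n) (k : 'I_n) : R := if k == i then -1 else 1.

Lemma cball_int_flip (i : 'I_n) (f : tup n -> R) : bounded_meas f ->
  (forall t, f (tscale (flip i) t) = - f t) -> cball_int r f = 0.
Proof.
move=> [mf _] hf; apply: (cball_odd (c := flip i)) => // k.
by rewrite /flip; case: ifP => _; rewrite ?normrN normr1.
Qed.

Lemma cball_int_tnth2 (i j : 'I_n) :
  cball_int r (fun t => tnth t i * tnth t j) =
  V * r ^+ 2 / (n%:R + 2) * (i == j)%:R.
Proof.
have [<-|ij] := eqVneq i j; last first.
  rewrite mulr0; apply: (@cball_int_flip i).
    by apply: bounded_measM; exact: bounded_meas_tnth.
  by move=> t; rewrite !tnth_mktuple /flip eqxx eq_sym (negbTE ij) mulN1r mul1r mulNr.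
pose b (k : 'I_n) : nat := (k == i).
have sumb : (\sum_l b l = 1)%N.
  by rewrite (bigD1 i)//= /b eqxx big1// => l /negbTE ->.
have b2 l : (b l <= 2)%N by rewrite /b; case: eqP.
have := cball_monomial n0 r0 b2; rewrite sumb.
have -> : \prod_l gauss_ratio (b l) = 2^-1.
  rewrite (bigD1 i)//= big1 => [|l /negbTE li]; last by rewrite /b li.
  by rewrite /b eqxx mulr1.
move=> h; transitivity (fine (V * r ^+ 1.*2 * 2^-1 / gamma_rising n 1)%:E); last first.
  rewrite /= /gamma_rising !big_ord_recr big_ord0/= mul1r addn0.
  have n2 : n%:R + 2 != 0 :> R by rewrite gt_eqF// ltr_wpDl.
  rewrite -[1.*2]/2%N; field; by rewrite n2.
rewrite -h /cball_int /Rintegral; congr fine; apply: eq_integral => t _; congr (_%:E).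
rewrite (bigD1 i)//= /b eqxx big1 ?mulr1 -?expr2// => l /negbTE ->.
by rewrite expr0.
Qed.

(** The pairing formula of Wick and Isserlis, for the ball. If some index occurs an odd number of
    times, reflecting its coordinate gives 0; otherwise the indices match in pairs and the moment is
    one of squares, where [i = j = k = l] counts all three pairings. *)
Lemma cball_int_tnth4 (i j k l : 'I_n) :
  cball_int r (fun t => tnth t i * tnth t j * (tnth t k * tnth t l)) =
  V * r ^+ 4 / ((n%:R + 2) * (n%:R + 4)) *
  ((i == j)%:R * (k == l)%:R + (i == k)%:R * (j == l)%:R +
   (i == l)%:R * (j == k)%:R).
Proof.
have bm (a b c d : 'I_n) :
    bounded_meas (fun t => tnth t a * tnth t b * (tnth t c * tnth t d)).
  by apply: bounded_measM; apply: bounded_measM; exact: bounded_meas_tnth.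
have sqE (a b : 'I_n) :
    cball_int r (fun t => tnth t a * tnth t a * (tnth t b * tnth t b)) =
    V * r ^+ 4 / ((n%:R + 2) * (n%:R + 4)) * (1 + 2 * (a == b)%:R).
  by rewrite -cball_int_squares; congr cball_int; apply/funext => t; rewrite !expr2.
have odd (m : 'I_n) : odd ((i == m) + (j == m) + (k == m) + (l == m)) ->
    cball_int r (fun t => tnth t i * tnth t j * (tnth t k * tnth t l)) = 0.
  move=> om; apply: (@cball_int_flip m) => // t; rewrite !tnth_mktuple /flip.
  by move: om; do 4 case: eqP => _ //=; move=> _; ring.
have [ij|/eqP ij] := eqVneq i j; have [kl|/eqP kl] := eqVneq k l.
- rewrite -ij -kl sqE; case: eqP => _ /=; ring.
- have jkl : (j == k) && (j == l) = false.
    by apply/negP => /andP[/eqP jk /eqP jl]; apply: kl; rewrite -jk -jl.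
  rewrite (odd k).
    by move: jkl; rewrite ij; case: eqP => _; case: eqP => _ //= _; ring.
  by rewrite ij eqxx; move: kl => /eqP/negbTE; rewrite eq_sym => ->; case: eqP.
- have jkl : (i == l) && (j == l) = false.
    by apply/negP => /andP[/eqP il /eqP jl]; apply: ij; rewrite il jl.
  rewrite (odd i).
    by move: jkl; rewrite kl; case: eqP => _; case: eqP => _ //= _; ring.
  by rewrite kl eqxx; move: ij => /eqP/negbTE; rewrite eq_sym => ->; case: eqP.
- have [ik|/eqP ik] := eqVneq i k; have [jl|/eqP jl] := eqVneq j l.
  + rewrite -ik -jl; transitivity (cball_int r
        (fun t : tup n => tnth t i * tnth t i * (tnth t j * tnth t j))).
      by congr cball_int; apply/funext => t; ring.
    rewrite sqE; move: ij => /eqP/negbTE ij.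
    by rewrite ij [j == i]eq_sym ij /=; ring.
  + rewrite (odd j).
      by case: eqP => [il|_]; [case: kl; rewrite -ik -il|rewrite /=; ring].
    rewrite -ik eqxx; move: ij jl => /eqP/negbTE -> /eqP/negbTE.
    by rewrite eq_sym => ->.
  + rewrite (odd i).
      by case: eqP => [il|_]; [case: ij; rewrite jl il|rewrite /=; ring].
    rewrite -jl eqxx; move: ij ik => /eqP/negbTE + /eqP/negbTE.
    by rewrite [i == j]eq_sym [i == k]eq_sym => -> ->.
  + have [il|/eqP il] := eqVneq i l; last first.
      rewrite (odd i); first by rewrite /=; ring.
      rewrite eqxx; move: ij ik il => /eqP/negbTE + /eqP/negbTE + /eqP/negbTE.
      by rewrite [i == j]eq_sym [i == k]eq_sym [i == l]eq_sym => -> -> ->.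
    have [jk|/eqP jk] := eqVneq j k.
      rewrite -il -jk; transitivity (cball_int r
          (fun t : tup n => tnth t i * tnth t i * (tnth t j * tnth t j))).
        by congr cball_int; apply/funext => t; ring.
      by rewrite sqE; move: ij => /eqP/negbTE ->; rewrite /=; ring.
    rewrite (odd j); first by rewrite /=; ring.
    rewrite -il eqxx; move: ij jk => /eqP/negbTE -> /eqP/negbTE.
    by rewrite eq_sym => ->.
Qed.

Definition qform (A : 'M[R]_n) (t : tup n) : R :=
  \sum_i \sum_j A i j * (tnth t i * tnth t j).

Lemma bounded_meas_qform A : bounded_meas (qform A).
Proof.
apply: bounded_meas_sum => i; apply: bounded_meas_sum => j; apply: bounded_measZ.
by apply: bounded_measM; exact: bounded_meas_tnth.
Qed.

Lemma cball_int_qform A : cball_int r (qform A) = V * r ^+ 2 / (n%:R + 2) * \tr A.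
Proof.
have bm i j : bounded_meas (fun t : tup n => tnth t i * tnth t j).
  by apply: bounded_measM; exact: bounded_meas_tnth.
rewrite cball_int_sum; last first.
  by move=> i; apply: bounded_meas_sum => j; exact: bounded_measZ.
rewrite mulr_sumr; apply: eq_bigr => i _.
rewrite cball_int_sum; last by move=> j; exact: bounded_measZ.
under eq_bigr do rewrite cball_intZ// cball_int_tnth2.
rewrite (bigD1 i)//= big1 => [|j /negbTE ji]; last by rewrite eq_sym ji/=; ring.
by rewrite eqxx /=; ring.
Qed.

(** The three pairings contract the coefficients [A i j * B k l] to the three traces: [(ij)(kl)] to
    [tr A tr B], [(ik)(jl)] to [tr (A B^T)] and [(il)(jk)] to [tr (A B)]. *)
Lemma cball_int_qformM A B : cball_int r (fun t => qform A t * qform B t) =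
  V * r ^+ 4 / ((n%:R + 2) * (n%:R + 4)) *
  (\tr A * \tr B + \tr (A *m B^T) + \tr (A *m B)).
Proof.
set C := V * _ / _.
have bm i j k l : bounded_meas
    (fun t : tup n => tnth t i * tnth t j * (tnth t k * tnth t l)).
  by apply: bounded_measM; apply: bounded_measM; exact: bounded_meas_tnth.
have bm2 i j : bounded_meas (fun t : tup n => \sum_k \sum_l A i j * B k l *
    (tnth t i * tnth t j * (tnth t k * tnth t l))).
  apply: bounded_meas_sum => k; apply: bounded_meas_sum => l; exact: bounded_measZ.
transitivity (\sum_i \sum_j \sum_k \sum_l A i j * B k l * (C *
  ((i == j)%:R * (k == l)%:R + (i == k)%:R * (j == l)%:R +
   (i == l)%:R * (j == k)%:R))).
  transitivity (cball_int r (fun t : tup n => \sum_i \sum_j \sum_k \sum_l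
      A i j * B k l * (tnth t i * tnth t j * (tnth t k * tnth t l)))).
    congr cball_int; apply/funext => t; rewrite /qform mulr_suml; apply: eq_bigr => i _.
    rewrite mulr_suml; apply: eq_bigr => j _; rewrite mulr_sumr; apply: eq_bigr => k _.
    by rewrite mulr_sumr; apply: eq_bigr => l _; ring.
  rewrite cball_int_sum; last by move=> i; exact: bounded_meas_sum.
  apply: eq_bigr => i _; rewrite cball_int_sum//; apply: eq_bigr => j _.
  rewrite cball_int_sum; last by move=> k; apply: bounded_meas_sum => l; exact: bounded_measZ.
  apply: eq_bigr => k _; rewrite cball_int_sum; last by move=> l; exact: bounded_measZ.
  by apply: eq_bigr => l _; rewrite cball_intZ// cball_int_tnth4.
have delta (a : 'I_n) (F : 'I_n -> R) : \sum_k (a == k)%:R * F k = F a.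
  rewrite (bigD1 a)//= eqxx big1 ?mul1r ?addr0// => k /negbTE ka.
  by rewrite eq_sym ka mul0r.
transitivity (C * \sum_i \sum_j (A i j * ((i == j)%:R * \tr B) + A i j * B i j + A i j * B j i)).
  rewrite mulr_sumr; apply: eq_bigr => i _; rewrite mulr_sumr; apply: eq_bigr => j _.
  rewrite -[X in A i j * X + _](delta j (fun=> (i == j)%:R * \tr B)).
  transitivity (C * A i j * (\sum_k (k == k)%:R * ((i == j)%:R * B k k) +
     \sum_k (i == k)%:R * (\sum_l (j == l)%:R * B k l) +
     \sum_k (j == k)%:R * (\sum_l (i == l)%:R * B k l))); last first.
    rewrite !delta (eq_bigr (fun k => (i == j)%:R * B k k)); last first.
      by move=> k _; rewrite eqxx mul1r.
    by rewrite -mulr_sumr -/(\tr B); ring.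
  rewrite -!big_split/= mulr_sumr; apply: eq_bigr => k _.
  rewrite -[X in X * (_ * B k k)](delta k (fun l => (k == l)%:R)).
  transitivity (C * A i j * (\sum_l (k == l)%:R * ((i == j)%:R * B k l) +
     (i == k)%:R * (\sum_l (j == l)%:R * B k l) +
     (j == k)%:R * (\sum_l (i == l)%:R * B k l))); last first.
    by rewrite !delta eqxx mul1r.
  rewrite !mulr_sumr -!big_split/= mulr_sumr; apply: eq_bigr => l _; ring.
congr (C * _).
under eq_bigr do rewrite !big_split/=.
rewrite !big_split/=; congr (_ + _ + _).
- rewrite mulr_suml; apply: eq_bigr => i _.
  rewrite (eq_bigr (fun j => (i == j)%:R * (A i j * \tr B))) ?delta// => j _; ring.
- apply: eq_bigr => i _; rewrite mxE; apply: eq_bigr => j _; by rewrite mxE.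
- by apply: eq_bigr => i _; rewrite mxE.
Qed.

End CballInt.

End LebesgueRn.
End Integration.

(** * Taylor approximation *)

Section Taylor.
Context {R : realType}.
Implicit Types (n : nat).

Lemma lip_MVT (g dg : R -> R) (c M : R) :
  (forall s : R, `|s| <= `|c| -> is_derive s 1 g (dg s)) ->
  (forall s, `|s| <= `|c| -> `|dg s| <= M) -> `|g c - g 0| <= M * `|c|.
Proof.
move=> hd hM.
have cont a b : (forall s, s \in `[a, b] -> `|s| <= `|c|) ->
    {within `[a, b], continuous g}.
  move=> hab; apply: derivable_within_continuous => x /hab/hd[]//.
have [c0|c0] := leP 0 c.
  have hab s : s \in `[0, c] -> `|s| <= `|c|.
    by rewrite in_itv/= => /andP[s0 sc]; rewrite !ger0_norm.
  have [||x /hab xc ->] := @MVT_segment _ g dg _ _ c0.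
  - by move=> x /subset_itv_oo_cc/hab/hd.
  - exact: cont.
  - by rewrite subr0 normrM ler_wpM2r// hM.
have hab s : s \in `[c, 0] -> `|s| <= `|c|.
  by rewrite in_itv/= => /andP[s0 sc]; rewrite !ler0_norm ?lerN2// ltW.
have [||x /hab xc] := @MVT_segment _ g dg _ _ (ltW c0).
- by move=> x /subset_itv_oo_cc/hab/hd.
- exact: cont.
- by rewrite distrC => ->; rewrite sub0r normrM normrN ler_wpM2r// hM.
Qed.

Lemma is_derive_line n (f : 'rV[R]_n -> R) (z v : 'rV[R]_n) (t df : R) :
  is_derive (z + t *: v) v f df -> is_derive t 1 (fun s => f (z + s *: v)) df.
Proof.
move=> [dv <-].
have E : (fun h : R => h^-1 *: (f (z + (h *: 1 + t) *: v) - f (z + t *: v))) =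
         (fun h : R => h^-1 *: (f (h *: v + (z + t *: v)) - f (z + t *: v))).
  by apply/funext => h; rewrite scaler1 scalerDl addrCA.
apply: DeriveDef; first by rewrite /derivable/= E.
by rewrite /derive/= E.
Qed.

Lemma is_derive_additive n (L : 'rV[R]_n -> R) (x v : 'rV[R]_n) :
  (forall h y, L (h *: v + y) = h * L v + L y) -> is_derive x v L (L v).
Proof.
move=> hL.
have cv : (fun h : R => h^-1 *: (L (h *: v + x) - L x)) @ 0^' --> L v.
  apply: cvg_near_cst; near=> h; rewrite hL addrK /GRing.scale/= mulKf//.
  near: h; exact: nbhs_dnbhs_neq.
apply: DeriveDef; first by apply/cvg_ex; exists (L v).
by apply/cvg_lim.
Unshelve. all: by end_near. Qed.

Lemma norm_row_le n (u : 'rV[R]_n) (r : R) : 0 <= r ->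
  (forall i, `|u 0 i| <= r) -> `|u| <= r.
Proof.
move=> r0 ur; rewrite [leLHS]/Num.Def.normr/= mx_normrE bigmax_le// => -[i j] _.
by rewrite ord1; exact: ur.
Qed.

Lemma coord_norm_le n (u : 'rV[R]_n) i : `|u 0 i| <= `|u|.
Proof.
by rewrite [leRHS]/Num.Def.normr/= mx_normrE; exact: (le_bigmax _ _ (0, i)).
Qed.

(* The increment is split along a path parallel to the axes. *)
Lemma gradient_bound n (f : 'rV[R]_n -> R) (a u : 'rV[R]_n) (M : R) :
  (forall x, `|x - a| <= `|u| -> forall i, derivable f x (basis_vec i) /\
     `|'D_(basis_vec i) f x| <= M) ->
  `|f (a + u) - f a| <= n%:R * M * `|u|.
Proof.
move=> hf.
pose w (k : nat) : 'rV[R]_n := \row_i (if (i < k)%N then u 0 i else 0).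
have w0 : w 0%N = 0 by apply/rowP => i; rewrite !mxE.
have wn : w n = u by apply/rowP => i; rewrite !mxE ltn_ord.
have wS (k : 'I_n) : w k.+1 = w k + u 0 k *: basis_vec k.
  apply/rowP => i; rewrite !mxE ltnS leq_eqVlt eqxx/=.
  have [->|ik] := eqVneq i k; first by rewrite eqxx ltnn mulr1 add0r.
  by rewrite mulr0 addr0 val_eqE (negbTE ik).
have -> : f (a + u) - f a = \sum_(k < n) (f (a + w k.+1) - f (a + w k)).
  rewrite -(big_mkord xpredT (fun k => f (a + w k.+1) - f (a + w k))).
  by rewrite telescope_sumr// wn w0 addr0.
apply: le_trans (ler_norm_sum _ _ _) _.
have -> : n%:R * M * `|u| = \sum_(k < n) M * `|u|.
  by rewrite sumr_const card_ord -mulrA mulr_natl.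
apply: ler_sum => k _; rewrite wS addrA.
have hx s : `|s| <= `|u 0 k| -> `|a + w k + s *: basis_vec k - a| <= `|u|.
  move=> su; rewrite -(addrA a) [a + _]addrC addrK; apply: norm_row_le => // i.
  rewrite !mxE eqxx/=; have [->|ik] := eqVneq i k.
    by rewrite ltnn mulr1 add0r (le_trans su)// coord_norm_le.
  by rewrite mulr0 addr0; case: ifP => _; rewrite ?coord_norm_le// normr0.
have := @lip_MVT (fun s => f (a + w k + s *: basis_vec k))
  (fun s => 'D_(basis_vec k) f (a + w k + s *: basis_vec k)) (u 0 k) M.
rewrite scale0r addr0 => /(_ _ _)/le_trans; apply.
- move=> s su; apply: is_derive_line; have [? _] := hf _ (hx _ su) k.
  exact: DeriveDef.
- by move=> s su; have [] := hf _ (hx _ su) k.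
- rewrite ler_wpM2l ?coord_norm_le//.
  have [|_] := hf a _ k; first by rewrite subrr normr0.
  exact: le_trans.
Qed.

(** [Ck] speaks of partial derivatives along the basis, whereas Taylor's formula along a ray needs
    an arbitrary direction. After subtraction of the linear part [L], the partial derivatives are
    small near [y] by continuity, and [gradient_bound] makes the increment small against [h]. *)
Lemma is_derive_gradient n (f : 'rV[R]_n -> R) (y v : 'rV[R]_n) :
  (\forall x \near y, forall i, derivable f x (basis_vec i)) ->
  (forall i, {for y, continuous (fun x => 'D_(basis_vec i) f x)}) ->
  is_derive y v f (\sum_i v 0 i * 'D_(basis_vec i) f y).
Proof.
move=> df cf; set S := \sum_i _.
pose L (x : 'rV[R]_n) := \sum_i x 0 i * 'D_(basis_vec i) f y.
have Llin (h : R) (x z : 'rV[R]_n) : L (h *: x + z) = h * L x + L z.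
  rewrite /L mulr_sumr -big_split; apply: eq_bigr => i _ /=.
  by rewrite !mxE mulrDl mulrA.
have LE i : L (basis_vec i) = 'D_(basis_vec i) f y.
  rewrite /L (bigD1 i)//= mxE !eqxx mul1r big1 ?addr0// => j /negbTE ji.
  by rewrite mxE ji mul0r.
have cv : (fun h : R => h^-1 *: (f (h *: v + y) - f y)) @ 0^' --> S.
  apply/cvgrPdist_le => e e0.
  (* Chosen so that the bound [n e' |v|] of [gradient_bound] is at most [e]; the [+ 1] keeps the
     denominator positive. *)
  pose e' := e / (n%:R * `|v| + 1).
  have nv0 : 0 < n%:R * `|v| + 1 by rewrite ltr_wpDl// mulr_ge0.
  have e'0 : 0 < e' by rewrite divr_gt0.
  have : \forall x \near y, forall i, derivable f x (basis_vec i) /\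
      `|'D_(basis_vec i) f x - 'D_(basis_vec i) f y| <= e'.
    have cf' : \forall x \near y, forall i,
        `|'D_(basis_vec i) f x - 'D_(basis_vec i) f y| <= e'.
      apply: (@filter_forall _ _ (fun i => [set x |
        `|'D_(basis_vec i) f x - 'D_(basis_vec i) f y| <= e']) (nbhs y)) => i.
      move/(_ i)/cvgrPdist_le/(_ _ e'0) : cf; apply: filterS => x.
      by rewrite distrC.
    by apply: filterS2 df cf' => x h1 h2 i; split; [exact: h1|exact: h2].
  move=> /nbhs_ballP[d /= d0 hd].
  near=> h.
  have h0 : h != 0 by near: h; exact: nbhs_dnbhs_neq.
  have hv : `|h *: v| < d.
    rewrite normrZ (@le_lt_trans _ _ (`|h| * (`|v| + 1)))//.
      by rewrite ler_wpM2l// lerDl.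
    rewrite -ltr_pdivlMr ?ltr_wpDl//; near: h; apply: dnbhs0_lt.
    by rewrite divr_gt0// ltr_wpDl.
  pose F x := f x - L x.
  have hF x : `|x - y| <= `|h *: v| -> forall i, derivable F x (basis_vec i) /\
      `|'D_(basis_vec i) F x| <= e'.
    move=> xy i; have [|dfx bfx] := hd x _ i.
      by rewrite -ball_normE/= distrC (le_lt_trans xy).
    have dF : is_derive x (basis_vec i) F
        ('D_(basis_vec i) f x - 'D_(basis_vec i) f y).
      apply: is_deriveB; first exact: DeriveDef.
      by rewrite -LE; exact: is_derive_additive.
    by have [? ->] := dF.
  have := gradient_bound hF.
  have L0 x z : L (x + z) = L x + L z by rewrite -[x]scale1r Llin mul1r scale1r.
  have LZ : L (h *: v) = h * S.
    have L00 : L 0 = 0 by rewrite /L big1// => i _; rewrite mxE mul0r.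
    by have := Llin h v 0; rewrite addr0 L00 addr0.
  have -> : F (y + h *: v) - F y = h * (h^-1 * (f (h *: v + y) - f y) - S).
    rewrite /F L0 LZ mulrBr mulVKf// [h *: v + y]addrC; ring.
  rewrite normrM normrZ mulrCA ler_pM2l ?normr_gt0// distrC => /le_trans; apply.
  rewrite mulrAC /e' mulrA ler_pdivrMr// mulrC ler_pM2l//.
  by rewrite lerDl.
apply: DeriveDef; first by apply/cvg_ex; exists S.
by apply/cvg_lim.
Unshelve. all: by end_near. Qed.

(** The homogeneous part of degree [d] of the Taylor expansion at 0. The recursion is Euler's
    identity [d T_d f (x) = sum_i x_i T_(d-1) (D_i f) (x)], which avoids multi-indices and the
    symmetry of higher derivatives. *)
Fixpoint taylor_term n (d : nat) (f : 'rV[R]_n -> R) (x : 'rV[R]_n) : R :=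
  if d is d'.+1 then
    d%:R^-1 * \sum_i x 0 i * taylor_term d' (fun y => 'D_(basis_vec i) f y) x
  else f 0.

Lemma taylor_termZ n d (f : 'rV[R]_n -> R) (c : R) x :
  taylor_term d f (c *: x) = c ^+ d * taylor_term d f x.
Proof.
elim: d f => [|d IH] f /=; first by rewrite mul1r.
rewrite mulrCA; congr (_ * _); rewrite mulr_sumr; apply: eq_bigr => i _.
by rewrite mxE IH exprS; ring.
Qed.

Lemma Ck_continuous n k (U : set 'rV[R]_n) f x : Ck k U f -> U x ->
  {for x, continuous f}.
Proof. by case: k => [|k] [cf _] Ux; exact: cf. Qed.

Lemma Ck_is_derive n k (U : set 'rV[R]_n) f (x v : 'rV[R]_n) : open U -> U x ->
  Ck k.+1 U f -> is_derive x v f (\sum_i v 0 i * 'D_(basis_vec i) f x).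
Proof.
move=> oU Ux [cf df]; apply: is_derive_gradient.
  have : \forall y \near x, U y by exact: open_nbhs_nbhs.
  by apply: filterS => y Uy i; have [d _] := df i; exact: d.
by move=> i; have [_ ck] := df i; exact: Ck_continuous ck Ux.
Qed.

(** Induction on [k]. By Euler's recursion, the derivative of the remainder along the ray [t *: x]
    is the sum of the [x_i] times the remainders of the partial derivatives, one order lower; the
    mean value inequality on [[0, 1]] returns the missing power of [|x|]. *)
Lemma taylor_remainder n k (U : set 'rV[R]_n) f : open U -> U 0 -> Ck k U f ->
  exists K r : R, [/\ 0 <= K, 0 < r & forall x, `|x| <= r ->
    U x /\ `|f x - \sum_(d < k) taylor_term d f x| <= K * `|x| ^+ k].
Proof.
move=> oU U0; have [r0 r00 r0U] : exists2 r, 0 < r & forall x, `|x| <= r -> U x.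
  have : nbhs (0 : 'rV[R]_n) U by exact: open_nbhs_nbhs.
  move=> /nbhs_ballP[d /= d0 hd]; exists (d / 2); first by rewrite divr_gt0.
  move=> x xd; apply: hd; rewrite -ball_normE/= sub0r normrN.
  by apply: le_lt_trans xd _; rewrite ltr_pdivrMr// ltr_pMr// ltr1n.
elim: k f => [|k IH] f Cf.
  have /cvgrPdist_le/(_ _ ltr01)/nbhs_ballP[d /= d0 hd] := Ck_continuous Cf U0.
  exists (`|f 0| + 1), (Num.min (d / 2) r0); split.
  - by rewrite addr_ge0.
  - by rewrite lt_min r00 divr_gt0.
  move=> x; rewrite le_min => /andP[xd xr]; split; first exact: r0U.
  rewrite big_ord0 subr0 expr0 mulr1.
  have : `|f 0 - f x| <= 1.
    apply: hd; rewrite -ball_normE/= sub0r normrN.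
    by apply: le_lt_trans xd _; rewrite ltr_pdivrMr// ltr_pMr// ltr1n.
  rewrite -lerBlDl; apply: le_trans.
  by rewrite distrC (le_trans _ (lerB_dist _ _)).
have /(@choice _ _ _)[Kr hKr] : forall i : 'I_n, exists Kr : R * R,
    [/\ 0 <= Kr.1, 0 < Kr.2 & forall x, `|x| <= Kr.2 -> U x /\
    `|'D_(basis_vec i) f x -
      \sum_(d < k) taylor_term d (fun y => 'D_(basis_vec i) f y) x|
       <= Kr.1 * `|x| ^+ k].
  move=> i; case: Cf => _ /(_ i)[_ /IH[K [r h]]]; by exists (K, r).
pose r := \big[Num.min/r0]_i (Kr i).2.
have rle i : r <= (Kr i).2 by rewrite /r; exact: bigmin_le.
have r_gt0 : 0 < r by rewrite /r lt_bigmin// => i _; have [] := hKr i.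
exists (\sum_i (Kr i).1), r; split => //.
  by apply: sumr_ge0 => i _; have [] := hKr i.
move=> x xr; have Ux t : `|t| <= 1 -> U (t *: x).
  move=> t1; apply: r0U; rewrite normrZ.
  apply: le_trans (_ : `|x| <= _); first by rewrite ler_piMl.
  by apply: le_trans xr _; rewrite /r; exact: bigmin_le_id.
split; first by rewrite -(scale1r x); apply: Ux; rewrite normr1.
pose psi (t : R) := f (0 + t *: x) - \sum_(d < k.+1) t ^+ d * taylor_term d f x.
pose dpsi (t : R) := \sum_i x 0 i * 'D_(basis_vec i) f (0 + t *: x) -
  \sum_(d < k) d.+1%:R * t ^+ d * taylor_term d.+1 f x.
have psi0 : psi 0 = 0.
  rewrite /psi scale0r addr0 big_ord_recl expr0 mul1r /= big1 ?addr0 ?subrr// => i _.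
  by rewrite expr0n mul0r.
have -> : f x - \sum_(d < k.+1) taylor_term d f x = psi 1 - psi 0.
  rewrite psi0 subr0 /psi scale1r add0r; congr (_ - _).
  by apply: eq_bigr => d _; rewrite expr1n mul1r.
rewrite -[leRHS]mulr1 -[X in _ * X](normr1 R).
apply: (@lip_MVT psi dpsi) => t; rewrite normr1 => t1.
  apply: is_deriveB.
    apply: is_derive_line; rewrite add0r; apply: Ck_is_derive oU (Ux _ t1) Cf.
  have -> : (fun u : R => \sum_(d < k.+1) u ^+ d * taylor_term d f x) =
      cst (f 0) + \sum_(d < k) (fun u : R => taylor_term d.+1 f x * u ^+ d.+1).
    apply/funext => u; rewrite /cst/= !fctE big_ord_recl expr0 mul1r/=.
    congr (_ + _); rewrite fct_sumE; apply: eq_bigr => d _.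
    by rewrite mulrC.
  rewrite -[X in is_derive _ _ _ X]add0r; apply: is_deriveD.
  apply: is_derive_sum => d.
  have dX : is_derive t 1 (fun u : R => u ^+ d.+1) (d.+1%:R * t ^+ d).
    apply: DeriveDef; first exact: exprn_derivable.
    by rewrite exp_derive/= /GRing.scale/= mulr1.
  apply: (is_derive_eq (is_deriveZ (taylor_term d.+1 f x) dX)).
  by rewrite /GRing.scale/= mulrC.
have -> : dpsi t = \sum_i x 0 i * ('D_(basis_vec i) f (t *: x) -
    \sum_(d < k) taylor_term d (fun y => 'D_(basis_vec i) f y) (t *: x)).
  rewrite /dpsi add0r; under [RHS]eq_bigr do rewrite mulrBr.
  rewrite sumrB; congr (_ - _).
  under [RHS]eq_bigr do rewrite mulr_sumr.
  rewrite exchange_big/=; apply: eq_bigr => d _.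
  rewrite mulrC -mulrA mulrCA mulKf ?pnatr_eq0// mulrC mulr_sumr.
  by apply: eq_bigr => i _; rewrite taylor_termZ; ring.
apply: le_trans (ler_norm_sum _ _ _) _; rewrite mulr_suml ler_sum// => i _.
rewrite normrM exprS mulrCA ler_pM ?coord_norm_le//.
have [K0 _ h] := hKr i; have [|_] := h (t *: x) _.
  by rewrite normrZ (le_trans _ (rle i))// (le_trans _ xr)// ler_piMl.
move/le_trans; apply; rewrite ler_wpM2l// lerXn2r ?nnegrE// normrZ.
by rewrite ler_piMl.
Qed.

Lemma smooth_on_derive n (U : set 'rV[R]_n) f (i : 'I_n) : smooth_on U f ->
  smooth_on U (fun x => 'D_(basis_vec i) f x).
Proof. by move=> Sf k; have [_ /(_ i)[]] := Sf k.+1. Qed.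

Lemma norm_basis_vec n (i : 'I_n) : `|basis_vec i : 'rV[R]_n| <= 1.
Proof.
apply: norm_row_le => // j; rewrite mxE eqxx/=.
by case: eqP => _; rewrite ?normr1 ?normr0.
Qed.

(** The mean value inequality is applied in direction [i] to [f (s e_j + u e_i) - f (u e_i)], whose
    derivative in [u] is a difference of two values of [D_i f]; the first-order Taylor expansion of
    [D_i f] at 0 evaluates it as [s] times the mixed derivative. *)
Lemma second_difference n (U : set 'rV[R]_n) f (i j : 'I_n) :
  open U -> U 0 -> smooth_on U f ->
  exists K r : R, 0 < r /\ forall s : R, 0 < s <= r ->
    `|f (s *: basis_vec j + s *: basis_vec i) - f (s *: basis_vec i) -
      f (s *: basis_vec j) + f 0 -
      s ^+ 2 * 'D_(basis_vec j) (fun x => 'D_(basis_vec i) f x) 0| <= K * s ^+ 3.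
Proof.
move=> oU U0 Sf; have [K [r [K0 r0 hr]]] := taylor_remainder oU U0 (smooth_on_derive i Sf 2%N).
set H := 'D_(basis_vec j) _ 0.
(* The points involved have norm at most [2 s]. Two Taylor remainders of size [K (2 s)^2] give
   [8 K s^2], and the increment in [u] a further factor [s]. *)
exists (8 * K), (r / 2); split; first by rewrite divr_gt0.
move=> s /andP[s0 sr].
have s0' : 0 <= s by exact: ltW.
have hn u (w : 'rV[R]_n) : `|u| <= `|s| -> `|w| <= s -> `|w + u *: basis_vec i| <= s * 2.
  rewrite (ger0_norm s0') => us ws; apply: le_trans (ler_normD _ _) _.
  rewrite mulr_natr mulr2n lerD// normrZ -[leRHS]mulr1.
  by rewrite ler_pM// norm_basis_vec.
have hrn (x : 'rV[R]_n) : `|x| <= s * 2 -> `|x| <= r.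
  by move=> /le_trans; apply; rewrite -ler_pdivlMr.
have nsj : `|s *: basis_vec j| <= s.
  by rewrite normrZ ger0_norm// -[leRHS]mulr1 ler_wpM2l// norm_basis_vec.
pose g (u : R) := f (s *: basis_vec j + u *: basis_vec i) -
  f (0 + u *: basis_vec i) - s * H * u.
pose dg (u : R) := 'D_(basis_vec i) f (s *: basis_vec j + u *: basis_vec i) -
  'D_(basis_vec i) f (0 + u *: basis_vec i) - s * H.
have -> : f (s *: basis_vec j + s *: basis_vec i) - f (s *: basis_vec i) -
    f (s *: basis_vec j) + f 0 - s ^+ 2 * H = g s - g 0.
  by rewrite /g !scale0r !add0r !addr0; ring.
have -> : 8 * K * s ^+ 3 = 8 * K * s ^+ 2 * `|s| by rewrite ger0_norm//; ring.
apply: (@lip_MVT g dg) => u us.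
  have df x : `|x| <= s * 2 -> is_derive x (basis_vec i) f ('D_(basis_vec i) f x).
    move=> /hrn/hr[Ux _]; apply: DeriveDef => //.
    by have [_ /(_ i)[d _]] := Sf 1%N; exact: d.
  apply: is_deriveB; first apply: is_deriveB.
  - by apply: is_derive_line; apply: df; exact: hn.
  - by apply: is_derive_line; apply: df; apply: hn; rewrite ?normr0.
  - have d1 := is_derive_id u (1 : R).
    apply: (is_derive_eq (is_deriveZ (s * H) d1)).
    by rewrite /GRing.scale/= mulr1.
have T x : `|x| <= s * 2 ->
    `|'D_(basis_vec i) f x - ('D_(basis_vec i) f 0 + \sum_k x 0 k *
      'D_(basis_vec k) (fun y => 'D_(basis_vec i) f y) 0)| <= K * (s * 2) ^+ 2.
  move=> xs; have [_] := hr x (hrn _ xs).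
  rewrite !big_ord_recl big_ord0 addr0 /= invr1 mul1r => /le_trans; apply.
  by rewrite ler_wpM2l// lerXn2r ?nnegrE// mulr_ge0.
have sumD (w : 'rV[R]_n) a k : \sum_l (w + a *: basis_vec k) 0 l *
      'D_(basis_vec l) (fun y => 'D_(basis_vec i) f y) 0 =
    \sum_l w 0 l * 'D_(basis_vec l) (fun y => 'D_(basis_vec i) f y) 0 +
    a * 'D_(basis_vec k) (fun y => 'D_(basis_vec i) f y) 0.
  under eq_bigr do rewrite !mxE mulrDl.
  rewrite big_split; congr (_ + _).
  rewrite /= (bigD1 k)//= !eqxx mulr1 big1 ?addr0// => l /negbTE ->.
  by rewrite mulr0 mul0r.
have := T _ (hn u _ us nsj); have := T _ (hn u 0 us _); rewrite normr0 => /(_ s0').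
rewrite !sumD -[s *: basis_vec j]add0r sumD.
set S0 := \sum_l _; set D1 := 'D_(basis_vec i) _ 0; rewrite -/H.
rewrite /dg add0r.
set F1 := 'D_(basis_vec i) f _; set F2 := 'D_(basis_vec i) f _; set D2 := 'D_(basis_vec i) f 0.
rewrite !ler_norml => /andP[a1 a2] /andP[b1 b2].
have -> : 8 * K * s ^+ 2 = K * (s * 2) ^+ 2 + K * (s * 2) ^+ 2 by ring.
move: a1 a2 b1 b2; set E := K * _ => a1 a2 b1 b2.
by apply/andP; split; lra.
Qed.

(** The second difference is unchanged when [i] and [j] are exchanged, so [s^2] times the difference
    of the two mixed derivatives is [O(s^3)]. *)
Lemma hessian_sym n (U : set 'rV[R]_n) f : open U -> U 0 -> smooth_on U f ->
  forall i j, 'D_(basis_vec i) (fun x => 'D_(basis_vec j) f x) 0 =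
    'D_(basis_vec j) (fun x => 'D_(basis_vec i) f x) 0.
Proof.
move=> oU U0 Sf i j.
have [K [r [r0 hK]]] := second_difference i j oU U0 Sf.
have [L [q [q0 hL]]] := second_difference j i oU U0 Sf.
set A := LHS in hK hL *; set B := RHS in hK hL *.
apply/eqP; rewrite -subr_eq0 -normr_le0; apply/ler_addgt0Pr => e e0; rewrite add0r.
pose M : R := `|K| + `|L| + 1.
have M0 : 0 < M by rewrite ltr_wpDl// addr_ge0.
pose s := Num.min (e / M) (Num.min r q).
have s0 : 0 < s by rewrite !lt_min r0 q0 divr_gt0.
have srq : (s <= r) && (s <= q) by rewrite !ge_min !lexx !orbT.
have /andP[sr sq] := srq; move: (hK s) (hL s).
rewrite s0 sr sq => /(_ isT) + /(_ isT).
rewrite [s *: basis_vec i + _]addrC.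
set F := f (_ + _); set Fi := f (s *: basis_vec i); set Fj := f (s *: basis_vec j).
rewrite -/A -/B => h1 h2.
have sM : s * M <= e by rewrite -ler_pdivlMr// ge_min lexx.
have s3 : 0 < s ^+ 3 by rewrite exprn_gt0.
have s2 : 0 < s ^+ 2 by rewrite exprn_gt0.
rewrite -(ler_pM2l s2) -[X in X * `|_|]gtr0_norm// -normrM.
have -> : s ^+ 2 * (A - B) = (F - Fi - Fj + f 0 - s ^+ 2 * B) -
    (F - Fj - Fi + f 0 - s ^+ 2 * A) by ring.
apply: le_trans (ler_normB _ _) _; apply: le_trans (lerD h1 h2) _.
apply: le_trans (_ : s ^+ 2 * (s * M) <= _); last by rewrite ler_pM2l.
have -> : s ^+ 2 * (s * M) = M * s ^+ 3 by ring.
rewrite -mulrDl ler_pM2r// /M; move: (ler_norm K) (ler_norm L); clear; lra.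
Qed.

End Taylor.

(** * Orders of vanishing at the origin and integral estimates *)

Section BigO.
Context {R : realType} {n : nat}.
Implicit Types (f g : 'rV[R]_n -> R) (x : 'rV[R]_n).

(** The norm is the sup norm. It is at most [r] on the Euclidean ball of radius [r], the only
    comparison that the integrals call for. *)
Definition bO k f : Prop := exists K r : R,
  [/\ 0 <= K, 0 < r & forall x, `|x| <= r -> `|f x| <= K * `|x| ^+ k].

Lemma bO_near k f g (r : R) : 0 < r -> (forall x, `|x| <= r -> f x = g x) ->
  bO k f -> bO k g.
Proof.
move=> r0 fg [K [s [K0 s0 h]]]; exists K, (Num.min r s); split => //.
  by rewrite lt_min r0.
by move=> x; rewrite le_min => /andP[xr xs]; rewrite -fg// h.
Qed.

Lemma bO_cst (c : R) : bO 0 (fun=> c).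
Proof. by exists `|c|, 1; split => // x _; rewrite expr0 mulr1. Qed.

Lemma bO_coord i : bO 1 (fun x => x 0 i).
Proof. by exists 1, 1; split => // x _; rewrite expr1 mul1r coord_norm_le. Qed.

Lemma bO_le k l f : (l <= k)%N -> bO k f -> bO l f.
Proof.
move=> lk [K [r [K0 r0 h]]]; exists K, (Num.min 1 r); split => //.
  by rewrite lt_min r0 ltr01.
move=> x; rewrite le_min => /andP[x1 xr]; apply: le_trans (h x xr) _.
by rewrite ler_wpM2l// ler_wiXn2l.
Qed.

Lemma bOD k f g : bO k f -> bO k g -> bO k (fun x => f x + g x).
Proof.
move=> [K [r [K0 r0 hf]]] [L [s [L0 s0 hg]]].
exists (K + L), (Num.min r s); split; [exact: addr_ge0|by rewrite lt_min r0|].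
move=> x; rewrite le_min => /andP[xr xs]; rewrite mulrDl.
by apply: le_trans (ler_normD _ _) _; rewrite lerD ?hf ?hg.
Qed.

Lemma bOM k l f g : bO k f -> bO l g -> bO (k + l) (fun x => f x * g x).
Proof.
move=> [K [r [K0 r0 hf]]] [L [s [L0 s0 hg]]].
exists (K * L), (Num.min r s); split; [exact: mulr_ge0|by rewrite lt_min r0|].
move=> x; rewrite le_min => /andP[xr xs]; rewrite exprD mulrACA normrM.
by rewrite ler_pM ?hf ?hg.
Qed.

Lemma bOZ k (c : R) f : bO k f -> bO k (fun x => c * f x).
Proof. by move=> hf; apply: (bOM (bO_cst c) hf). Qed.

Lemma bO0 k : bO k (fun=> 0).
Proof. by exists 0, 1; split => // x _; rewrite normr0 mul0r. Qed.

Lemma bO_sum k (I : Type) (s : seq I) (F : I -> 'rV[R]_n -> R) :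
  (forall i, bO k (F i)) -> bO k (fun x => \sum_(i <- s) F i x).
Proof.
move=> hF; elim: s => [|i s IH].
  by under eq_fun do rewrite big_nil; exact: bO0.
by under eq_fun do rewrite big_cons; exact: bOD.
Qed.

(* Products of two approximations: [f f' - g g' = (f - g) f' + g (f' - g')]. *)
Lemma bO_subM k l a b f f' g g' m : bO k (fun x => f x - g x) ->
  bO l (fun x => f' x - g' x) -> bO a f' -> bO b g ->
  (m <= k + a)%N -> (m <= b + l)%N -> bO m (fun x => f x * f' x - g x * g' x).
Proof.
move=> h1 h2 h3 h4 m1 m2.
apply: (@bO_near _ (fun x => (f x - g x) * f' x + g x * (f' x - g' x)) _ 1) => //.
  by move=> x _; ring.
by apply: bOD; [exact: bO_le m1 (bOM h1 h3)|exact: bO_le m2 (bOM h4 h2)].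
Qed.

Lemma bO_approx k f g : bO k (fun x => f x - g x) -> bO k g -> bO k f.
Proof.
move=> h1 h2; apply: (@bO_near _ (fun x => (f x - g x) + g x) _ 1) => //.
  by move=> x _; ring.
exact: bOD.
Qed.

Lemma bO_taylor_term d f : bO d (taylor_term d f).
Proof.
elim: d f => [|d IH] f /=; first exact: bO_cst.
apply: bOZ; apply: bO_sum => i; exact: (bOM (bO_coord i) (IH _)).
Qed.

Lemma bO_taylor k (U : set 'rV[R]_n) f : open U -> U 0 -> Ck k U f ->
  bO k (fun x => f x - \sum_(d < k) taylor_term d f x).
Proof.
move=> oU U0 Cf; have [K [r [K0 r0 h]]] := taylor_remainder oU U0 Cf.
by exists K, r; split => // x xr; have [] := h x xr.
Qed.

(** Multiplying by the conjugate shows that [1 + G/2 - sqrt(1 + G)] is [G^2 / 4] divided by a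
    quantity that is at least 1. *)
Lemma bO_sqrt1D (G : 'rV[R]_n -> R) : (forall x, 0 <= G x) -> bO 2 G ->
  bO 4 (fun x => Num.sqrt (1 + G x) - (1 + 2^-1 * G x)).
Proof.
move=> G0 bG; have [K [r [K0 r0 h]]] := bOM bG bG.
exists K, r; split => // x xr; apply: le_trans (h x xr).
have G1 : 0 <= 1 + G x by rewrite addr_ge0.
have := sqr_sqrtr G1; have := sqrtr_ge0 (1 + G x).
set s := Num.sqrt _ => s0 sE.
have E : (1 + 2^-1 * G x - s) * (1 + 2^-1 * G x + s) = 4^-1 * (G x * G x).
  transitivity ((1 + 2^-1 * G x) ^+ 2 - s ^+ 2); first by ring.
  by rewrite sE; field.
have d1 : 1 <= 1 + 2^-1 * G x + s by rewrite -addrA lerDl addr_ge0// mulr_ge0.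
have GG : 0 <= G x * G x by rewrite mulr_ge0.
have d0 : 0 <= 1 + 2^-1 * G x - s.
  rewrite -(pmulr_lge0 _ (lt_le_trans ltr01 d1)) E.
  by rewrite mulr_ge0.
rewrite distrC ger0_norm// ger0_norm//.
apply: le_trans (_ : (1 + 2^-1 * G x - s) * (1 + 2^-1 * G x + s) <= _).
  by rewrite ler_peMr.
by rewrite E; move: GG; clear; lra.
Qed.

Lemma norm_row_of_tuple (t : n.-tuple (measurableTypeR R)) (r : R) : 0 <= r ->
  sqn t <= r ^+ 2 -> `|row_of_tuple t| <= r.
Proof.
move=> r0 tr; apply: norm_row_le => // i; rewrite mxE.
exact: normr_tnth.
Qed.

(** On the ball of radius [e], [f] lies between [g - K e^k] and [g + K e^k], and the sandwich
    applies. Measurability is asked of [g] alone, which is a polynomial in the applications. *)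
Lemma Rintegral_approx k f g (n0 : (0 < n)%N) :
  bO k (fun x => f x - g x) -> bounded_meas (fun t => g (row_of_tuple t)) ->
  exists K r : R, [/\ 0 <= K, 0 < r & forall e : R, 0 < e <= r ->
    `|\int[lebesgueRn n]_(t in cball e) f (row_of_tuple t) -
      cball_int e (fun t => g (row_of_tuple t))| <= K * (ball_volume n e * e ^+ k)].
Proof.
move=> [K [r [K0 r0 h]]] mg; exists K, r; split => // e /andP[e0 er].
have ie s : (lebesgueRn n).-integrable (cball e)
    (EFin \o (fun t => g (row_of_tuple t) + s)).
  by apply: integrable_cball => //; apply: bounded_measD => //; exact: bounded_meas_cst.
have : forall t, cball e t -> (g (row_of_tuple t) + - (K * e ^+ k) <=
    f (row_of_tuple t) <= g (row_of_tuple t) + K * e ^+ k)%R.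
  move=> t te; have xe := norm_row_of_tuple (ltW e0) te.
  have : `|f (row_of_tuple t) - g (row_of_tuple t)| <= K * e ^+ k.
    apply: le_trans (h _ (le_trans xe er)) _.
    by rewrite ler_wpM2l// lerXn2r ?nnegrE// ltW.
  rewrite ler_norml; move: (g _) (f _) (K * _); clear => a b d /andP[h1 h2].
  by apply/andP; split; lra.
move/(le_integral_sandwich (measurable_cball e) (ie _) (ie _)) => /andP[h1 h2].
have cE s : \int[lebesgueRn n]_(t in cball e) (g (row_of_tuple t) + s) =
    cball_int e (fun t => g (row_of_tuple t)) + s * ball_volume n e.
  rewrite -(cball_int_cst n0 e0) -cball_intD//; exact: bounded_meas_cst.
rewrite cE in h1; rewrite cE in h2.
rewrite [leRHS]mulrCA [leRHS]mulrC ler_norml.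
move: h1 h2; rewrite mulNr; move: (K * _ * _) (cball_int _ _) (Rintegral _ _ _).
by clear => a b d h1 h2; apply/andP; split; lra.
Qed.

End BigO.

Lemma mulr_le_sqr (R : realFieldType) (a b d : R) :
  a ^+ 2 <= d -> b ^+ 2 <= d -> a * b <= d.
Proof. by move=> ha hb; have := sqr_ge0 (a - b); nra. Qed.

(** Gathers the errors of [covariance_quad] under one constant: [a] and [b] stand for the squared
    tangent and normal parts, [c] and [d] for [V_n e^6] and [V_n e^4], and [x] for the AM-GM bound
    of the cross term. *)
Lemma sum_errors_le (R : realFieldType) (K L M s t a b c d : R) :
  0 <= K -> 0 <= L -> 0 <= M -> 0 <= s -> 0 <= t -> 0 <= a -> 0 <= b ->
  0 <= c -> 0 <= d -> forall x, 0 <= x ->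
  s * ((a + b) * (K * c)) + t * (x * (L * d)) + b * (M * c) <=
  (K * s + L * t + M) * (c * (a + b) + d * x).
Proof.
move=> K0 L0 M0 s0 t0 a0 b0 c0 d0 x x0.
rewrite -subr_ge0 (_ : _ - _ = M * c * a + K * s * d * x + L * t * c * (a + b) +
  M * d * x); last by ring.
by rewrite !addr_ge0// !mulr_ge0// addr_ge0.
Qed.

(** * The cylinder in a tangent chart *)

Section Chart.
Context {R : realType} {n : nat}.
Variables (S : set 'rV[R]_n.+1) (p : 'rV[R]_n.+1) (c : graph_chart R n).
Hypothesis hc : is_tangent_chart S p c.
Local Notation X := (chart_map p c).
Local Notation F := (frame c).
Local Notation N := (normal c).
Local Notation h := (height c).
Local Notation U := (base c).
Local Notation D i f := (fun x => 'D_(basis_vec i) f x).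

Lemma dotvE k (u v : 'rV[R]_k) : dotv u v = (u *m v^T) 0 0.
Proof. by rewrite row_dotE. Qed.

Lemma normal_norm : N *m N^T = 1%:M.
Proof.
rewrite [LHS]mx11_scalar -dotvE; congr (_%:M).
have := normal_unit hc; rewrite /enorm => /(congr1 (fun x => x ^+ 2)).
rewrite expr1n sqr_sqrtr// dotvE; exact: row_dot_ge0.
Qed.

Lemma normal_frame : N *m F^T = 0.
Proof.
by apply: trmx_inj; rewrite trmx_mul trmxK trmx0 (normal_orthogonal hc).
Qed.

Lemma chart_sub x : X x - p = x *m F + h x *: N.
Proof. by rewrite /chart_map -(addrA p) [p + _]addrC addrK. Qed.

Lemma chart_proj x : (X x - p) *m F^T = x.
Proof.
rewrite chart_sub mulmxDl -mulmxA (frame_orthonormal hc) mulmx1.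
by rewrite -scalemxAl normal_frame scaler0 addr0.
Qed.

(** The tangential part of [X x - p] has coordinates [x], so the radius condition reads [|x| <= e].
    Smallness of [e] puts the ball inside [base], and therefore its image on the hypersurface. *)
Lemma chart_domain : exists2 r : R, 0 < r & forall e, 0 < e <= r ->
  [set t | cylinder S p c e (X (row_of_tuple t))] = cball e.
Proof.
have /nbhs_ballP[d /= d0 hd] : nbhs (0 : 'rV[R]_n) U.
  by apply: open_nbhs_nbhs; split; [exact: base_open hc|exact: base_origin hc].
exists (d / 2); first by rewrite divr_gt0.
move=> e /andP[e0 ed].
have enE x : enorm ((X x - p) *m F^T *m F) = Num.sqrt (dotv x x).
  rewrite chart_proj /enorm !dotvE trmx_mul !mulmxA -(mulmxA x).
  by rewrite (frame_orthonormal hc) mulmx1.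
have sqE (t : n.-tuple (measurableTypeR R)) :
    dotv (row_of_tuple t) (row_of_tuple t) = sqn t.
  by apply: eq_bigr => i _; rewrite !mxE -expr2.
have cE t : (Num.sqrt (sqn t) <= e) = (sqn t <= e ^+ 2).
  by rewrite -[X in _ <= X](gtr0_norm e0) -sqrtr_sqr ler_sqrt// sqr_ge0.
apply/seteqP; split => t /=.
  by rewrite /cylinder/= => -[_]; rewrite enE sqE cE.
rewrite /cball/= => te; split; last by rewrite /= enE sqE cE.
rewrite (chart_graph hc); exists (row_of_tuple t) => //.
apply: hd; rewrite -ball_normE/= sub0r normrN.
apply: le_lt_trans (norm_row_of_tuple (ltW e0) te) _.
by apply: le_lt_trans ed _; rewrite ltr_pdivrMr// ltr_pMr// ltr1n.
Qed.

Lemma height_derivable x i : U x -> derivable h x (basis_vec i).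
Proof. by move=> Ux; have [_ /(_ i)[d _]] := height_smooth hc 1%N; exact: d. Qed.

Lemma scale_graph (t d : R) (u w : 'rV[R]_n.+1) : t != 0 ->
  t^-1 *: (t *: u + d *: w) = u + (t^-1 * d) *: w.
Proof. by move=> t0; rewrite scalerDr !scalerA mulVf// scale1r. Qed.

(** The affine part is left general so that the case [A = 0] also differentiates the partial
    derivatives of the chart, for the second fundamental form. *)
Lemma derive_graph (f : 'rV[R]_n -> R) (A : 'M[R]_(n, n.+1)) (x v : 'rV[R]_n)
    (a w : 'rV[R]_n.+1) : derivable f x v ->
  'D_v (fun y => a + y *m A + f y *: w) x = v *m A + 'D_v f x *: w.
Proof.
move=> df; apply/cvg_lim => //=.
apply: (@cvg_trans _ ((fun t : R => v *m A + t^-1 *: (f (t *: v + x) - f x) *: w)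
    @ 0^')).
  apply: near_eq_cvg; near=> t.
  have t0 : t != 0 by near: t; exact: nbhs_dnbhs_neq.
  rewrite /= !mulmxDl -scalemxAl.
  have -> : a + (t *: (v *m A) + x *m A) + f (t *: v + x) *: w - (a + x *m A + f x *: w) =
      t *: (v *m A) + (f (t *: v + x) - f x) *: w.
    rewrite scalerBl; apply/rowP => i; rewrite !mxE; ring.
  exact/esym/scale_graph.
by apply: cvgD; [exact: cvg_cst|apply: cvgZr_tmp; exact: df].
Unshelve. all: by end_near. Qed.

Lemma derive_chart x i : U x ->
  'D_(basis_vec i) X x = row i F + 'D_(basis_vec i) h x *: N.
Proof.
by move=> Ux; rewrite derive_graph; [rewrite rowE|exact: height_derivable].
Qed.

Definition grad x : 'rV[R]_n := \row_i 'D_(basis_vec i) h x.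

Lemma first_form_chart x : U x -> first_form X x = 1%:M + (grad x)^T *m grad x.
Proof.
move=> Ux; apply/matrixP => i j; rewrite !mxE big_ord1 !mxE dotvE !derive_chart//.
have FF : row i F *m (row j F)^T = (i == j)%:R%:M.
  rewrite !rowE trmx_mul mulmxA -(mulmxA _ F) (frame_orthonormal hc) mulmx1.
  rewrite trmx_delta mul_delta_mx_cond; apply/matrixP => a b.
  by rewrite !ord1; case: eqP => _; rewrite ?mulr1n ?mulr0n !mxE.
have FN : row i F *m N^T = 0.
  by rewrite rowE -mulmxA (normal_orthogonal hc) mulmx0.
have NF : N *m (row j F)^T = 0.
  by rewrite rowE trmx_mul mulmxA normal_frame mul0mx.
rewrite linearD/= [(_ *: N)^T]linearZ/= mulmxDl !mulmxDr -!scalemxAl -!scalemxAr.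
rewrite normal_norm FF FN NF !scaler0 addr0 add0r scalerA scalemx1.
by rewrite !mxE eqxx !mulr1n.
Qed.

(** The bordered matrix [M] becomes triangular when either of its two off-diagonal blocks is
    eliminated; the two resulting values of its determinant are the two sides. *)
Lemma det_rank1 k (g : 'rV[R]_k) : \det (1%:M + g^T *m g) = 1 + (g *m g^T) 0 0.
Proof.
pose M : 'M[R]_(k + 1) := block_mx 1%:M (- g^T) g 1%:M.
have d1 : \det M = 1 + (g *m g^T) 0 0.
  have : M *m block_mx 1%:M g^T 0 1%:M = block_mx 1%:M 0 g (g *m g^T + 1%:M).
    by rewrite mulmx_block !mulmx1 !mul1mx !mulmx0 !addr0 subrr.
  move/(congr1 determinant); rewrite det_mulmx det_ublock !det1 !mulr1 => ->.
  by rewrite det_lblock det1 mul1r det_mx11 !mxE addrC.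
have : M *m block_mx 1%:M 0 (- g) 1%:M = block_mx (1%:M + g^T *m g) (- g^T) 0 1%:M.
  by rewrite mulmx_block !mulmx1 !mul1mx !mulmx0 mulmxN mulNmx opprK !add0r subrr.
move/(congr1 determinant); rewrite det_mulmx det_lblock !det1 !mulr1 d1 => ->.
by rewrite det_ublock det1 mulr1.
Qed.

Definition area x : R := Num.sqrt (1 + \sum_i 'D_(basis_vec i) h x ^+ 2).

Lemma area_chart x : U x -> Num.sqrt (\det (first_form X x)) = area x.
Proof.
move=> Ux; rewrite first_form_chart// det_rank1 row_dotE; congr (Num.sqrt (1 + _)).
by apply: eq_bigr => i _; rewrite !mxE -expr2.
Qed.

Definition hessian : 'M[R]_n :=
  \matrix_(i, j) 'D_(basis_vec i) (fun x => 'D_(basis_vec j) h x) 0.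

Lemma hessian_tr : hessian^T = hessian.
Proof.
apply/matrixP => i j; rewrite !mxE.
exact: (hessian_sym (base_open hc) (base_origin hc) (height_smooth hc)).
Qed.

Lemma second_form_chart : second_form X 0 N = hessian.
Proof.
apply/matrixP => i j; rewrite !mxE.
have U0 : \forall y \near (0 : 'rV[R]_n), U y.
  by apply: open_nbhs_nbhs; split; [exact: base_open hc|exact: base_origin hc].
rewrite (@near_eq_derive _ _ _ _ (fun y => row j F + y *m 0 + 'D_(basis_vec j) h y *: N)).
  rewrite derive_graph//; last first.
    have [_ /(_ j)[_ [_ /(_ i)[d _]]]] := height_smooth hc 2%N.
    by apply: d; exact: base_origin hc.
  by rewrite mulmx0 add0r dotvE -scalemxAl mxE normal_norm mxE eqxx mulr1.
by apply: filterS U0 => y Uy; rewrite derive_chart// mulmx0 addr0.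
Qed.

(** At the origin the gradient of the height vanishes, so the first form is the identity and the
    shape operator is the Hessian. *)
Lemma hessian_char_poly kappa : principal_curvatures X 0 N kappa ->
  char_poly hessian = \prod_i ('X - (kappa i)%:P).
Proof.
rewrite /principal_curvatures second_form_chart first_form_chart; last first.
  exact: base_origin hc.
rewrite (_ : grad 0 = 0) ?mulmx0 ?addr0 ?invmx1 ?mul1mx//.
by apply/rowP => i; rewrite !mxE (height_critical hc).
Qed.

(** * Polynomial approximation of the area element, the height and the volume *)

Local Notation row := row_of_tuple.

Lemma row_of_tupleN (t : n.-tuple (measurableTypeR R)) :
  row (tscale (fun=> -1) t) = -1 *: row t.
Proof. by apply/rowP => i; rewrite !mxE tnth_mktuple. Qed.

Lemma bounded_meas_taylor_term d (f : 'rV[R]_n -> R) :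
  bounded_meas (fun t : n.-tuple (measurableTypeR R) => taylor_term d f (row t)).
Proof.
elim: d f => [|d IH] f /=; first exact: bounded_meas_cst.
apply: bounded_measZ; apply: bounded_meas_sum => i; apply: bounded_measM => //.
by under eq_fun do rewrite mxE; exact: bounded_meas_tnth.
Qed.

Lemma cball_int_odd (n0 : (0 < n)%N) e (f : 'rV[R]_n -> R) :
  bounded_meas (fun t => f (row t)) -> (forall x, f (-1 *: x) = - f x) ->
  cball_int e (fun t => f (row t)) = 0.
Proof.
move=> [mf _] fN; apply: (cball_odd (c := fun=> -1)) => // [i|t].
  by rewrite normrN normr1.
by rewrite row_of_tupleN.
Qed.

Lemma cball_int_bO (n0 : (0 < n)%N) k (f : 'rV[R]_n -> R) : bO k f ->
  bounded_meas (fun t => f (row t)) ->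
  exists K r : R, [/\ 0 <= K, 0 < r & forall e : R, 0 < e <= r ->
    `|cball_int e (fun t => f (row t))| <= K * (ball_volume n e * e ^+ k)].
Proof.
move=> bf mf; have [||K [r [K0 r0 hK]]] := @Rintegral_approx _ _ k f (fun=> 0) n0.
- by under eq_fun do rewrite subr0.
- exact: bounded_meas_cst.
exists K, r; split => // e er; have := hK e er; have [e0 _] := andP er.
by rewrite cball_int_cst// mul0r subr0.
Qed.

Local Notation H := hessian.
Local Notation lin i := (taylor_term 1 (D i h)).
Local Notation quad i := (taylor_term 2 (D i h)).

(* The suffix [P] marks the Taylor polynomials used as approximants. *)
Definition areaP x : R := 1 + 2^-1 * \sum_i lin i x ^+ 2 + \sum_i lin i x * quad i x.

(** Degree 4 is kept because the remaining error of order 5, times a coordinate of order 1, gives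
    the order 6 required of the covariance. Degrees 0 and 1 vanish at [p]. *)
Definition heightP x : R := taylor_term 2 h x + taylor_term 3 h x + taylor_term 4 h x.

Lemma bO_grad i : bO 3 (fun x => 'D_(basis_vec i) h x - (lin i x + quad i x)).
Proof.
have := bO_taylor (base_open hc) (base_origin hc)
  (smooth_on_derive i (height_smooth hc) 3%N).
congr bO; apply/funext => x; congr (_ - _).
rewrite !big_ord_recl big_ord0 addr0 (_ : taylor_term _ (D i h) x = 0) ?add0r//.
exact: height_critical hc i.
Qed.

Lemma bO_height : bO 5 (fun x => h x - heightP x).
Proof.
have := bO_taylor (base_open hc) (base_origin hc) (height_smooth hc 5%N).
congr bO; apply/funext => x; congr (_ - _).
rewrite !big_ord_recl big_ord0 addr0 (_ : taylor_term _ h x = 0); last first.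
  exact: height_origin hc.
rewrite (_ : taylor_term (lift _ _) h x = 0) ?add0r /heightP ?addrA//.
rewrite /= big1 ?mulr0// => i _; rewrite (height_critical hc) mulr0//.
Qed.

(** The gradient is [lin + quad] up to order 3 and has order 1, so its square is known up to order
    4; the square of [quad], itself of order 4, is dropped. *)
Lemma bO_area : bO 4 (fun x => area x - areaP x).
Proof.
have bg i : bO 1 (fun x => 'D_(basis_vec i) h x).
  apply: (bO_approx (bO_le (isT : 1 <= 3)%N (bO_grad i))); apply: bOD.
    exact: bO_taylor_term.
  exact: (bO_le _ (bO_taylor_term 2 _)).
have bl i : bO 1 (lin i) by exact: bO_taylor_term.
have bq i : bO 2 (quad i) by exact: bO_taylor_term.
pose G (x : 'rV[R]_n) : R := \sum_i 'D_(basis_vec i) h x ^+ 2.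
have G0 x : 0 <= G x by apply: sumr_ge0 => i _; rewrite sqr_ge0.
have bG : bO 2 G.
  by apply: bO_sum => i; under eq_fun do rewrite expr2; exact: (bOM (bg i) (bg i)).
have h1 := bO_sqrt1D G0 bG.
have h2 i : bO 4 (fun x => 'D_(basis_vec i) h x * 'D_(basis_vec i) h x -
    (lin i x + quad i x) * (lin i x + quad i x)).
  apply: (bO_subM (bO_grad i) (bO_grad i) (bg i) _ (isT : 4 <= 3 + 1)%N
    (isT : 4 <= 1 + 3)%N).
  by apply: bOD => //; exact: bO_le (bq i).
have h3 i : bO 4 (fun x => quad i x * quad i x) by exact: bOM (bq i) (bq i).
have := bOD h1 (bOZ 2^-1 (bO_sum (index_enum _) (fun i => bOD (h2 i) (h3 i)))).
congr bO; apply/funext => x; rewrite /area /areaP -/(G x).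
have -> : \sum_i ('D_(basis_vec i) h x * 'D_(basis_vec i) h x -
    (lin i x + quad i x) * (lin i x + quad i x) + quad i x * quad i x) =
    G x - \sum_i lin i x ^+ 2 - 2 * \sum_i lin i x * quad i x.
  by rewrite /G mulr_sumr -!sumrB; apply: eq_bigr => i _; ring.
by field.
Qed.

Lemma bO_areaP : bO 0 areaP.
Proof.
apply: bOD; first apply: bOD; first exact: bO_cst.
- apply: bOZ; apply: bO_sum => i; under eq_fun do rewrite expr2.
  exact: (bO_le (isT : 0 <= 2)%N
    (bOM (bO_taylor_term 1 (D i h)) (bO_taylor_term 1 (D i h)))).
- apply: bO_sum => i.
  exact: (bO_le (isT : 0 <= 3)%N
    (bOM (bO_taylor_term 1 (D i h)) (bO_taylor_term 2 (D i h)))).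
Qed.

Lemma bO_area0 : bO 0 area.
Proof. exact: (bO_approx (bO_le _ bO_area) bO_areaP). Qed.

Lemma bO_areaP1 : bO 2 (fun x => areaP x - 1).
Proof.
have := bOD (bOZ 2^-1 (bO_sum (index_enum 'I_n) (fun i =>
    bOM (bO_taylor_term 1 (D i h)) (bO_taylor_term 1 (D i h)))))
  (bO_sum (index_enum 'I_n) (fun i => bO_le (isT : 2 <= 3)%N
    (bOM (bO_taylor_term 1 (D i h)) (bO_taylor_term 2 (D i h))))).
by congr bO; apply/funext => x; rewrite /areaP -(addrA 1) [1 + _]addrC addrK.
Qed.

Lemma bO_heightP : bO 2 heightP.
Proof.
apply: bOD; first apply: bOD; first exact: bO_taylor_term.
  exact: (bO_le _ (bO_taylor_term 3 _)).
exact: (bO_le _ (bO_taylor_term 4 _)).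
Qed.

Lemma bounded_meas_areaP : bounded_meas (fun t => areaP (row t)).
Proof.
apply: bounded_measD; first apply: bounded_measD; first exact: bounded_meas_cst.
- apply: bounded_measZ; apply: bounded_meas_sum => i.
  under eq_fun do rewrite expr2.
  by apply: bounded_measM; exact: bounded_meas_taylor_term.
- apply: bounded_meas_sum => i.
  by apply: bounded_measM; exact: bounded_meas_taylor_term.
Qed.

Lemma bounded_meas_heightP : bounded_meas (fun t => heightP (row t)).
Proof.
by apply: bounded_measD; first apply: bounded_measD; exact: bounded_meas_taylor_term.
Qed.

Lemma integral_dVol_approx (n0 : (0 < n)%N) k (phi : 'rV[R]_n.+1 -> R) P :
  bO k (fun x => phi (X x) * area x - P x) -> bounded_meas (fun t => P (row t)) ->
  exists K r : R, [/\ 0 <= K, 0 < r & forall e : R, 0 < e <= r ->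
    `|integral_dVol X (cylinder S p c e) phi - cball_int e (fun t => P (row t))|
      <= K * (ball_volume n e * e ^+ k)].
Proof.
move=> bP mP; have [K [r [K0 r0 hK]]] := Rintegral_approx n0 bP mP.
have [s s0 hs] := chart_domain.
have /nbhs_ballP[d /= d0 hd] : nbhs (0 : 'rV[R]_n) U.
  by apply: open_nbhs_nbhs; split; [exact: base_open hc|exact: base_origin hc].
exists K, (Num.min (Num.min r s) (d / 2)); split => //.
  by rewrite !lt_min r0 s0 divr_gt0.
move=> e /andP[e0]; rewrite !le_min => /andP[/andP[er es] ed].
rewrite /integral_dVol hs ?e0//.
rewrite (_ : \int[_]_(t in _) _ =
    \int[lebesgueRn n]_(t in cball e) (phi (X (row t)) * area (row t))).
  by apply: hK; rewrite e0.
apply: eq_Rintegral => t /set_mem te; rewrite area_chart//.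
apply: hd; rewrite -ball_normE/= sub0r normrN.
apply: le_lt_trans (norm_row_of_tuple (ltW e0) te) _.
by apply: le_lt_trans ed _; rewrite ltr_pdivrMr// ltr_pMr// ltr1n.
Qed.

Lemma hessian_symE i j : H i j = H j i.
Proof. by have /matrixP/(_ j i) := hessian_tr; rewrite mxE. Qed.

Lemma lin_row i (t : n.-tuple (measurableTypeR R)) :
  lin i (row t) = \sum_j tnth t j * H j i.
Proof.
by rewrite /= invr1 mul1r; apply: eq_bigr => j _; rewrite !mxE.
Qed.

Lemma lin_sum_sq (t : n.-tuple (measurableTypeR R)) :
  \sum_i lin i (row t) ^+ 2 = qform (H *m H) t.
Proof.
transitivity (\sum_i \sum_j \sum_k H j i * H k i * (tnth t j * tnth t k)).
  apply: eq_bigr => i _; rewrite lin_row expr2 mulr_suml; apply: eq_bigr => j _.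
  by rewrite mulr_sumr; apply: eq_bigr => k _; ring.
rewrite exchange_big /qform /=; apply: eq_bigr => j _.
rewrite exchange_big /=; apply: eq_bigr => k _.
rewrite mxE mulr_suml; apply: eq_bigr => i _.
by rewrite [H k i]hessian_symE.
Qed.

Lemma taylor2_row (t : n.-tuple (measurableTypeR R)) :
  taylor_term 2 h (row t) = 2^-1 * qform H t.
Proof.
rewrite /=; congr (_ * _); apply: eq_bigr => i _; rewrite invr1 mul1r mulr_sumr.
apply: eq_bigr => j _; rewrite hessian_symE !mxE; ring.
Qed.

(** The cubic term [lin * quad] is odd and integrates to 0, so no term in [e^3] appears. *)
Lemma cball_int_areaP (n0 : (0 < n)%N) (e : R) : 0 < e ->
  cball_int e (fun t => areaP (row t)) =
  ball_volume n e * (1 + e ^+ 2 / (2 * (n%:R + 2)) * \tr (H *m H)).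
Proof.
move=> e0; have bq := bounded_meas_qform (H *m H).
have bo : bounded_meas (fun t => \sum_i lin i (row t) * quad i (row t)).
  apply: bounded_meas_sum => i.
  by apply: bounded_measM; exact: bounded_meas_taylor_term.
rewrite (_ : (fun t => _) = fun t => 1 + 2^-1 * qform (H *m H) t +
    \sum_i lin i (row t) * quad i (row t)); last first.
  by apply/funext => t; rewrite /areaP lin_sum_sq.
rewrite cball_intD//; last first.
  by apply: bounded_measD; [exact: bounded_meas_cst|exact: bounded_measZ].
rewrite cball_intD//; [|exact: bounded_meas_cst|exact: bounded_measZ].
rewrite cball_int_cst// cball_intZ// cball_int_qform//.
rewrite (cball_int_odd n0 e (f := fun x => \sum_i lin i x * quad i x))//.
  have n2 : n%:R + 2 != 0 :> R by rewrite gt_eqF// ltr_wpDl.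
  by field.
move=> x; rewrite -sumrN; apply: eq_bigr => i _; rewrite !taylor_termZ; ring.
Qed.

Lemma volume_approx (n0 : (0 < n)%N) : exists K r : R,
  [/\ 0 <= K, 0 < r & forall e : R, 0 < e <= r ->
  `|cyl_volume S p c e -
    ball_volume n e * (1 + e ^+ 2 / (2 * (n%:R + 2)) * \tr (H *m H))|
  <= K * (ball_volume n e * e ^+ 4)].
Proof.
have [|K [r [K0 r0 hK]]] := @integral_dVol_approx n0 4 (fun=> 1) areaP _ bounded_meas_areaP.
  by under eq_fun do rewrite mul1r; exact: bO_area.
exists K, r; split => // e er; have [e0 _] := andP er.
by rewrite -cball_int_areaP//; exact: hK.
Qed.

Definition est k (f : R -> R) : Prop := exists K : R, 0 <= K /\
  \forall e \near 0^'+, `|f e| <= K * (ball_volume n e * e ^+ k).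

Lemma est_near k f : (exists K r : R, [/\ 0 <= K, 0 < r & forall e : R, 0 < e <= r ->
    `|f e| <= K * (ball_volume n e * e ^+ k)]) -> est k f.
Proof.
move=> [K [r [K0 r0 hK]]]; exists K; split => //; near=> e.
by apply: hK; apply/andP; split; near: e; [exact: nbhs_right_gt|exact: nbhs_right_le].
Unshelve. all: by end_near. Qed.

Lemma est_fam k (I : finType) (f : I -> R -> R) : (forall i, est k (f i)) ->
  exists K : R, 0 <= K /\ \forall e \near 0^'+, forall i,
    `|f i e| <= K * (ball_volume n e * e ^+ k).
Proof.
move=> /(@choice _ _ _)[K hK]; exists (\sum_i K i).
split; first by apply: sumr_ge0 => i _; have [] := hK i.
have hn : \forall e \near 0^'+, forall i, `|f i e| <= K i * (ball_volume n e * e ^+ k).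
  apply: (@filter_forall _ _ (fun i => [set e | `|f i e| <= K i *
    (ball_volume n e * e ^+ k)]) (0^'+)) => i; by have [] := hK i.
near=> e => i; have e0 : 0 < e by near: e; exact: nbhs_right_gt.
apply: (@le_trans _ _ (K i * (ball_volume n e * e ^+ k))).
  by move: i; near: e.
rewrite ler_wpM2r ?(mulr_ge0 (ltW (ball_volume_gt0 n e0)) (exprn_ge0 k (ltW e0)))//.
by rewrite (bigD1 i)//= lerDl; apply: sumr_ge0 => j _; have [] := hK j.
Unshelve. all: by end_near. Qed.

Lemma chart_coord x i : (X x - p) 0 i = (x *m F) 0 i + h x * N 0 i.
Proof. by rewrite chart_sub !mxE. Qed.

Lemma bO_frame i : bO 1 (fun x => (x *m F) 0 i).
Proof.
under eq_fun do rewrite mxE.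
by apply: bO_sum => k; exact: (bOM (bO_coord k) (bO_cst _)).
Qed.

Lemma bounded_meas_frame i : bounded_meas (fun t => (row t *m F) 0 i).
Proof.
under eq_fun do rewrite mxE; apply: bounded_meas_sum => k.
apply: bounded_measM; last exact: bounded_meas_cst.
by under eq_fun do rewrite mxE; exact: bounded_meas_tnth.
Qed.

Definition posP i x : R := (x *m F) 0 i + heightP x * N 0 i.

Lemma bO_posP i : bO 1 (posP i).
Proof.
apply: bOD; first exact: bO_frame.
exact: (bO_le (isT : 1 <= 2 + 0)%N (bOM bO_heightP (bO_cst _))).
Qed.

Lemma bounded_meas_posP i : bounded_meas (fun t => posP i (row t)).
Proof.
apply: bounded_measD; first exact: bounded_meas_frame.
by apply: bounded_measM; [exact: bounded_meas_heightP|exact: bounded_meas_cst].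
Qed.

Lemma bO_pos i : bO 5 (fun x => (X x - p) 0 i - posP i x).
Proof.
have := bOM bO_height (bO_cst (N 0 i)).
congr bO; apply/funext => x; rewrite chart_coord /posP; ring.
Qed.

Lemma bO_pos1 i : bO 1 (fun x => (X x - p) 0 i).
Proof. exact: (bO_approx (bO_le (isT : 1 <= 5)%N (bO_pos i)) (bO_posP i)). Qed.

(** * Barycenter and covariance form *)

Hypothesis n0 : (0 < n)%N.
Local Notation V e := (ball_volume n e).

Let n2 : n%:R + 2 != 0 :> R. Proof. by rewrite gt_eqF// ltr_wpDl. Qed.
Let n4 : n%:R + 4 != 0 :> R. Proof. by rewrite gt_eqF// ltr_wpDl. Qed.

(** The barycenter before division by the volume. Its linear tangential part is odd and integrates
    to 0. Order 3 is enough: only the non-vanishing of the leading term in [e^2] will be used. *)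
Lemma barycenter_approx i : est 3 (fun e =>
  integral_dVol X (cylinder S p c e) (fun q => (q - p) 0 i) -
  V e * (e ^+ 2 / (2 * (n%:R + 2)) * \tr H * N 0 i)).
Proof.
pose P x := (x *m F) 0 i + taylor_term 2 h x * N 0 i.
have bP : bO 3 (fun x => (X x - p) 0 i * area x - P x).
  have h1 : bO 3 (fun x => (X x - p) 0 i - P x).
    have := bOD (bO_le (isT : 3 <= 5)%N (bO_pos i)) (bOM (bOD (bO_taylor_term 3 h)
      (bO_le (isT : 3 <= 4)%N (bO_taylor_term 4 h))) (bO_cst (N 0 i))).
    by congr bO; apply/funext => x; rewrite /P /posP /heightP; ring.
  have h2 : bO 2 (fun x => area x - 1).
    have := bOD (bO_le (isT : 2 <= 4)%N bO_area) bO_areaP1.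
    by congr bO; apply/funext => x; rewrite addrA subrK.
  have h3 : bO 1 P.
    apply: bOD; first exact: bO_frame.
    exact: (bO_le (isT : 1 <= 2 + 0)%N (bOM (bO_taylor_term 2 h) (bO_cst _))).
  have := bO_subM h1 h2 bO_area0 h3 (isT : 3 <= 3 + 0)%N (isT : 3 <= 1 + 2)%N.
  by congr bO; apply/funext => x; rewrite mulr1.
have mP : bounded_meas (fun t => P (row t)).
  apply: bounded_measD; first exact: bounded_meas_frame.
  by apply: bounded_measM; [exact: bounded_meas_taylor_term|exact: bounded_meas_cst].
apply: est_near; have [K [r [K0 r0 hK]]] := @integral_dVol_approx n0 3
  (fun q => (q - p) 0 i) P bP mP.
exists K, r; split => // e er; have [e0 _] := andP er.
suff -> : V e * (e ^+ 2 / (2 * (n%:R + 2)) * \tr H * N 0 i) =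
    cball_int e (fun t => P (row t)) by exact: hK.
rewrite (_ : (fun t => P _) = fun t => (row t *m F) 0 i + (2^-1 * N 0 i) * qform H t).
  rewrite cball_intD//; last 2 first.
  - exact: bounded_meas_frame.
  - by apply: bounded_measZ; exact: bounded_meas_qform.
  rewrite (cball_int_odd n0 e (f := fun x => (x *m F) 0 i)); last 2 first.
  - exact: bounded_meas_frame.
  - by move=> x; rewrite scaleN1r mulNmx mxE.
  rewrite cball_intZ//; last exact: bounded_meas_qform.
  by rewrite cball_int_qform//; field.
by apply/funext => t; rewrite /P taylor2_row; ring.
Qed.

Definition covP i j x : R := posP i x * posP j x * areaP x.

Lemma bounded_meas_covP i j : bounded_meas (fun t => covP i j (row t)).
Proof.
apply: bounded_measM; last exact: bounded_meas_areaP.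
by apply: bounded_measM; exact: bounded_meas_posP.
Qed.

Lemma covariance_approx i j : est 6 (fun e =>
  cyl_covariance S p c e i j - cball_int e (fun t => covP i j (row t))).
Proof.
have bP : bO 6 (fun x => (X x - p) 0 i * (X x - p) 0 j * area x - covP i j x).
  have h1 : bO 6 (fun x => (X x - p) 0 i * (X x - p) 0 j - posP i x * posP j x).
    exact: (bO_subM (bO_pos i) (bO_pos j) (bO_pos1 j) (bO_posP i)
      (isT : 6 <= 5 + 1)%N (isT : 6 <= 1 + 5)%N).
  exact: (bO_subM h1 bO_area bO_area0 (bOM (bO_posP i) (bO_posP j))
    (isT : 6 <= 6 + 0)%N (isT : 6 <= 2 + 4)%N).
apply: est_near; have [K [r [K0 r0 hK]]] :=
  @integral_dVol_approx n0 6 (fun q => (q - p) 0 i * (q - p) 0 j) _ bP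
    (bounded_meas_covP i j).
by exists K, r; split => // e er; rewrite /cyl_covariance mxE; exact: hK.
Qed.

Lemma sq_qform k (z : 'rV[R]_k) (t : k.-tuple (measurableTypeR R)) :
  (\sum_i z 0 i * tnth t i) ^+ 2 = qform (z^T *m z) t.
Proof.
rewrite expr2 mulr_suml; apply: eq_bigr => i _; rewrite mulr_sumr.
by apply: eq_bigr => j _; rewrite !mxE big_ord1 !mxE; ring.
Qed.

(** The leading term is a second moment; the correction comes from the quadratic part of the area
    element through fourth moments, with [A = z^T z] and [B = H^2]. The part of degree 5 is odd, so
    the equality is exact. *)
Lemma cball_int_tangent (z : 'rV[R]_n) e : 0 < e ->
  cball_int e (fun t => (\sum_i z 0 i * tnth t i) ^+ 2 * areaP (row t)) =
  V e * (e ^+ 2 / (n%:R + 2) * (z *m z^T) 0 0 +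
    e ^+ 4 / (2 * (n%:R + 2) * (n%:R + 4)) * (\tr (H *m H) * (z *m z^T) 0 0 +
      2 * (z *m (H *m H) *m z^T) 0 0)).
Proof.
move=> e0; set A := z^T *m z.
have bA := bounded_meas_qform A; have bH := bounded_meas_qform (H *m H).
have bAH := bounded_measM bA bH.
have bo : bounded_meas (fun t => \sum_i lin i (row t) * quad i (row t)).
  apply: bounded_meas_sum => i.
  by apply: bounded_measM; exact: bounded_meas_taylor_term.
rewrite (_ : (fun t => _) = fun t => qform A t + 2^-1 * (qform A t * qform (H *m H) t) +
   qform A t * \sum_i lin i (row t) * quad i (row t)); last first.
  by apply/funext => t; rewrite sq_qform /areaP lin_sum_sq -/A; ring.
rewrite cball_intD//; [|exact: bounded_measD (bounded_measZ _ _)|exact: bounded_measM].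
rewrite cball_intD//; last exact: bounded_measZ.
rewrite cball_intZ// cball_int_qform// cball_int_qformM//.
have trA (B : 'M[R]_n) : \tr (A *m B) = (z *m B *m z^T) 0 0.
  by rewrite /A -mulmxA mxtrace_mulC trace_mx11.
have tA : \tr A = (z *m z^T) 0 0 by rewrite -[A]mulmx1 trA mulmx1.
rewrite !trA tA trmx_mul !hessian_tr.
rewrite (_ : cball_int e (fun t => qform A t * _) = 0); first by field; rewrite n2 n4.
have rowz (t : n.-tuple (measurableTypeR R)) :
    qform A t = (\sum_i z 0 i * row t 0 i) ^+ 2.
  by rewrite -sq_qform; congr (_ ^+ 2); apply: eq_bigr => i _; rewrite mxE.
under [X in cball_int e X]eq_fun do rewrite rowz.
apply: (cball_int_odd n0 e (f := fun x => (\sum_i z 0 i * x 0 i) ^+ 2 *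
    \sum_i lin i x * quad i x)) => //.
  by under eq_fun do rewrite -rowz; exact: bounded_measM.
move=> x; rewrite -mulrN -sumrN; congr (_ * _).
  rewrite -[RHS]sqrrN -sumrN; congr (_ ^+ 2); apply: eq_bigr => i _.
  by rewrite mxE; ring.
by apply: eq_bigr => i _; rewrite !taylor_termZ; ring.
Qed.

(** The part of lowest degree, [x_k T_2 h], is cubic, hence odd, and integrates to 0; everything
    else has order 4. *)
Lemma cball_int_cross k : est 4 (fun e =>
  cball_int e (fun t => tnth t k * (heightP (row t) * areaP (row t)))).
Proof.
pose f (x : 'rV[R]_n) : R := x 0 k * (heightP x * areaP x) - x 0 k * taylor_term 2 h x.
have bx : bounded_meas (fun t : n.-tuple (measurableTypeR R) => row t 0 k).
  by under eq_fun do rewrite mxE; exact: bounded_meas_tnth.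
have b1 : bounded_meas (fun t => row t 0 k * taylor_term 2 h (row t)).
  by apply: bounded_measM => //; exact: bounded_meas_taylor_term.
have b2 : bounded_meas (fun t => row t 0 k * (heightP (row t) * areaP (row t))).
  apply: bounded_measM => //; apply: bounded_measM; first exact: bounded_meas_heightP.
  exact: bounded_meas_areaP.
have bf : bO 4 f.
  have h1 : bO 3 (fun x => heightP x - taylor_term 2 h x).
    have := bOD (bO_taylor_term 3 h) (bO_le (isT : 3 <= 4)%N (bO_taylor_term 4 h)).
    by congr bO; apply/funext => x; rewrite /heightP; ring.
  have h2 := bO_subM h1 bO_areaP1 bO_areaP (bO_taylor_term 2 h)
    (isT : 3 <= 3 + 0)%N (isT : 3 <= 2 + 2)%N.
  have := bOM (bO_coord k) h2.
  by congr bO; apply/funext => x; rewrite /f; ring.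
have mf : bounded_meas (fun t => f (row t)).
  rewrite /f; under eq_fun do rewrite -mulN1r.
  by apply: bounded_measD => //; exact: bounded_measZ.
apply: est_near; have [K [r [K0 r0 hK]]] := cball_int_bO n0 bf mf.
exists K, r; split => // e er; have [e0 _] := andP er.
suff -> : cball_int e (fun t => tnth t k * (heightP (row t) * areaP (row t))) =
  cball_int e (fun t => f (row t)) by exact: hK.
transitivity (cball_int e (fun t => f (row t)) +
    cball_int e (fun t => row t 0 k * taylor_term 2 h (row t))).
  rewrite -cball_intD//; congr cball_int; apply/funext => t.
  by rewrite /f subrK mxE.
rewrite (cball_int_odd n0 e (f := fun x => x 0 k * taylor_term 2 h x)) ?addr0//.
by move=> x; rewrite taylor_termZ mxE; ring.
Qed.

(** The square of [T_2 h], half the Hessian form, gives the main term through fourth moments. The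
    product [2 T_2 h T_3 h] has degree 5, is odd and integrates to 0; all other contributions have
    order 6. *)
Lemma cball_int_normal : est 6 (fun e =>
  cball_int e (fun t => heightP (row t) ^+ 2 * areaP (row t)) -
  V e * (e ^+ 4 / (4 * (n%:R + 2) * (n%:R + 4)) *
    (\tr H ^+ 2 + 2 * \tr (H *m H)))).
Proof.
pose f (x : 'rV[R]_n) : R := heightP x ^+ 2 * areaP x -
  (taylor_term 2 h x ^+ 2 + 2 * (taylor_term 2 h x * taylor_term 3 h x)).
have mt := bounded_meas_taylor_term.
have b1 : bounded_meas (fun t => taylor_term 2 h (row t) ^+ 2).
  by under eq_fun do rewrite expr2; exact: bounded_measM.
have b2 : bounded_meas (fun t => 2 * (taylor_term 2 h (row t) * taylor_term 3 h (row t))).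
  by apply: bounded_measZ; exact: bounded_measM.
have b3 : bounded_meas (fun t => heightP (row t) ^+ 2 * areaP (row t)).
  under eq_fun do rewrite expr2.
  apply: bounded_measM; last exact: bounded_meas_areaP.
  by apply: bounded_measM; exact: bounded_meas_heightP.
have bf : bO 6 f.
  have h0 : bO 6 (fun x => heightP x * heightP x * (areaP x - 1)).
    exact: (bOM (bOM bO_heightP bO_heightP) bO_areaP1).
  have h3 : bO 6 (fun x => taylor_term 3 h x * taylor_term 3 h x).
    exact: (bOM (bO_taylor_term 3 h) (bO_taylor_term 3 h)).
  have h4 : bO 6 (fun x => taylor_term 4 h x * (heightP x + taylor_term 2 h x + taylor_term 3 h x)).
    apply: (bOM (bO_taylor_term 4 h) (l := 2)); apply: bOD; first apply: bOD.
    - exact: bO_heightP.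
    - exact: bO_taylor_term.
    - exact: bO_le (bO_taylor_term 3 h).
  have := bOD (bOD h0 h3) h4.
  by congr bO; apply/funext => x; rewrite /f /heightP; ring.
have mf : bounded_meas (fun t => f (row t)).
  rewrite /f; under eq_fun do rewrite -mulN1r.
  by apply: bounded_measD => //; apply: bounded_measZ; exact: bounded_measD.
apply: est_near; have [K [r [K0 r0 hK]]] := cball_int_bO n0 bf mf.
exists K, r; split => // e er; have [e0 _] := andP er.
suff -> : cball_int e (fun t => heightP (row t) ^+ 2 * areaP (row t)) =
  cball_int e (fun t => f (row t)) + V e * (e ^+ 4 / (4 * (n%:R + 2) * (n%:R + 4)) *
    (\tr H ^+ 2 + 2 * \tr (H *m H))) by rewrite addrK; exact: hK.
transitivity (cball_int e (fun t => f (row t)) +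
    (cball_int e (fun t => taylor_term 2 h (row t) ^+ 2) +
     cball_int e (fun t => 2 * (taylor_term 2 h (row t) * taylor_term 3 h (row t))))).
  rewrite -!cball_intD//; last exact: bounded_measD.
  by congr cball_int; apply/funext => t; rewrite /f subrK.
rewrite (cball_int_odd n0 e (f := fun x => 2 * (taylor_term 2 h x * taylor_term 3 h x)))//;
  last by move=> x; rewrite !taylor_termZ; ring.
congr (_ + _); rewrite addr0.
rewrite (_ : (fun t => _) = fun t => 4^-1 * (qform H t * qform H t)); last first.
  by apply/funext => t; rewrite taylor2_row; field.
have bq := bounded_meas_qform H.
rewrite cball_intZ//; last exact: bounded_measM.
by rewrite cball_int_qformM// hessian_tr; field; rewrite n2 n4.
Qed.

Lemma posP_comb (v : 'rV[R]_n.+1) (t : n.-tuple (measurableTypeR R)) :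
  \sum_i v 0 i * posP i (row t) =
  \sum_k (v *m F^T) 0 k * tnth t k + (v *m N^T) 0 0 * heightP (row t).
Proof.
under eq_bigr do rewrite mulrDr; rewrite big_split/=; congr (_ + _).
  under eq_bigr do rewrite mxE mulr_sumr.
  rewrite exchange_big/=; apply: eq_bigr => k _; rewrite [X in _ = X * _]mxE mulr_suml.
  by apply: eq_bigr => i _; rewrite !mxE; ring.
by rewrite row_dotE mulr_suml; apply: eq_bigr => i _; ring.
Qed.

(** The form of a matrix of second moments at [v] is the moment of the square of the position paired
    with [v]; this pairing is a tangent linear form plus a multiple of the height, and the square is
    expanded. *)
Lemma covP_quad (v : 'rV[R]_n.+1) e : 0 < e ->
  \sum_i \sum_j v 0 i * v 0 j * cball_int e (fun t => covP i j (row t)) =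
  cball_int e (fun t => (\sum_k (v *m F^T) 0 k * tnth t k) ^+ 2 * areaP (row t)) +
  2 * (v *m N^T) 0 0 * (\sum_k (v *m F^T) 0 k *
    cball_int e (fun t => tnth t k * (heightP (row t) * areaP (row t)))) +
  (v *m N^T) 0 0 ^+ 2 * cball_int e (fun t => heightP (row t) ^+ 2 * areaP (row t)).
Proof.
move=> e0; set z := v *m F^T; set y := (v *m N^T) 0 0.
have bA := bounded_meas_areaP; have bh := bounded_meas_heightP.
have bz : bounded_meas (fun t : n.-tuple (measurableTypeR R) => \sum_k z 0 k * tnth t k).
  by apply: bounded_meas_sum => k; apply: bounded_measZ; exact: bounded_meas_tnth.
have b1 : bounded_meas (fun t => (\sum_k z 0 k * tnth t k) ^+ 2 * areaP (row t)).
  by apply: bounded_measM => //; under eq_fun do rewrite expr2; exact: bounded_measM.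
have b2 k : bounded_meas (fun t => tnth t k * (heightP (row t) * areaP (row t))).
  by apply: bounded_measM; [exact: bounded_meas_tnth|exact: bounded_measM].
have b3 : bounded_meas (fun t => heightP (row t) ^+ 2 * areaP (row t)).
  by apply: bounded_measM => //; under eq_fun do rewrite expr2; exact: bounded_measM.
have b4 : bounded_meas (fun t => \sum_k z 0 k * (tnth t k * (heightP (row t) * areaP (row t)))).
  by apply: bounded_meas_sum => k; exact: bounded_measZ.
have bc i j : bounded_meas (fun t => v 0 i * v 0 j * covP i j (row t)).
  by apply: bounded_measZ; exact: bounded_meas_covP.
transitivity (cball_int e (fun t => \sum_i \sum_j v 0 i * v 0 j * covP i j (row t))).
  rewrite cball_int_sum//; last by move=> i; exact: bounded_meas_sum.
  apply: eq_bigr => i _; rewrite cball_int_sum//; apply: eq_bigr => j _.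
  by rewrite cball_intZ//; exact: bounded_meas_covP.
transitivity (cball_int e (fun t => (\sum_k z 0 k * tnth t k) ^+ 2 * areaP (row t) +
   2 * y * (\sum_k z 0 k * (tnth t k * (heightP (row t) * areaP (row t)))) +
   y ^+ 2 * (heightP (row t) ^+ 2 * areaP (row t)))).
  congr cball_int; apply/funext => t.
  transitivity ((\sum_i v 0 i * posP i (row t)) ^+ 2 * areaP (row t)).
    rewrite expr2 mulr_suml mulr_suml; apply: eq_bigr => i _.
    rewrite mulr_sumr mulr_suml; apply: eq_bigr => j _; rewrite /covP; ring.
  rewrite posP_comb -/z -/y.
  have -> : \sum_k z 0 k * (tnth t k * (heightP (row t) * areaP (row t))) =
      (\sum_k z 0 k * tnth t k) * (heightP (row t) * areaP (row t)).
    by rewrite mulr_suml; apply: eq_bigr => k _; ring.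
  ring.
rewrite cball_intD//; last by apply: bounded_measZ.
  rewrite cball_intD//; last by apply: bounded_measZ.
  rewrite cball_intZ// cball_intZ//; congr (_ + _ * _ + _).
  rewrite cball_int_sum//; first by apply: eq_bigr => k _; rewrite cball_intZ.
  by move=> k; exact: bounded_measZ.
by apply: bounded_measD => //; exact: bounded_measZ.
Qed.

Lemma frame_normal_norm (v : 'rV[R]_n.+1) : (v *m v^T) 0 0 =
  ((v *m F^T) *m (v *m F^T)^T) 0 0 + (v *m N^T) 0 0 ^+ 2.
Proof.
pose W : 'M[R]_(1 + n, n.+1) := col_mx N F.
have WW : W *m W^T = 1%:M.
  rewrite /W tr_col_mx mul_col_row normal_norm normal_frame.
  by rewrite (normal_orthogonal hc) (frame_orthonormal hc) -scalar_mx_block.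
have WtW : W^T *m W = 1%:M by exact: (mulmx1C (n := n.+1) WW).
transitivity (((v *m W^T) *m (v *m W^T)^T) 0 0).
  by rewrite trmx_mul trmxK !mulmxA -(mulmxA v W^T) WtW mulmx1.
rewrite /W tr_col_mx mul_mx_row tr_row_mx mul_row_col mxE addrC; congr (_ + _).
by rewrite row_dotE big_ord1 expr2.
Qed.

(** The covariance form divided by [V_n(e)], up to its error: the tangent terms of
    [cball_int_tangent] and the normal one of [cball_int_normal], without a cross term. *)
Definition model e (z : 'rV[R]_n) (y : R) : R :=
  e ^+ 2 / (n%:R + 2) * (z *m z^T) 0 0 +
  e ^+ 4 / (2 * (n%:R + 2) * (n%:R + 4)) * (\tr (H *m H) * (z *m z^T) 0 0 +
    2 * (z *m (H *m H) *m z^T) 0 0) +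
  e ^+ 4 / (4 * (n%:R + 2) * (n%:R + 4)) * (\tr H ^+ 2 + 2 * \tr (H *m H)) * y ^+ 2.

(* AM-GM with the weight [th] bounds the cross term between the tangent part
   [z] and the normal part [y]. *)
Lemma covariance_quad : exists K : R, 0 <= K /\ \forall e \near 0^'+,
  forall (v : 'rV[R]_n.+1) (th : R), 0 < th ->
  let z := v *m F^T in let y := (v *m N^T) 0 0 in let zz := (z *m z^T) 0 0 in
  `|(v *m cyl_covariance S p c e *m v^T) 0 0 - V e * model e z y| <=
  K * (V e * (e ^+ 6 * (zz + y ^+ 2) + e ^+ 4 * (th * zz + y ^+ 2 / th))).
Proof.
have [K1 [K10 h1]] := est_fam (fun ij : 'I_n.+1 * 'I_n.+1 => covariance_approx ij.1 ij.2).
have [K2 [K20 h2]] := est_fam cball_int_cross.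
have [K3 [K30 h3]] := cball_int_normal.
(* One error for each of the [(n + 1)^2] matrix entries, [n] cross moments and one normal moment. *)
exists (K1 * n.+1%:R ^+ 2 + K2 * n%:R + K3); split.
  by rewrite !addr_ge0// mulr_ge0// exprn_ge0.
near=> e => v th th0; set z := v *m F^T; set y := (v *m N^T) 0 0.
set zz := (z *m z^T) 0 0.
have e0 : 0 < e by near: e; exact: nbhs_right_gt.
have V0 := ball_volume_gt0 n e0.
have g1 ij : `|cyl_covariance S p c e ij.1 ij.2 -
    cball_int e (fun t => covP ij.1 ij.2 (row t))| <= K1 * (V e * e ^+ 6).
  by move: ij; near: e.
have g2 k : `|cball_int e (fun t => tnth t k * (heightP (row t) * areaP (row t)))|
    <= K2 * (V e * e ^+ 4).
  by move: k; near: e.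
have g3 : `|cball_int e (fun t => heightP (row t) ^+ 2 * areaP (row t)) -
    V e * (e ^+ 4 / (4 * (n%:R + 2) * (n%:R + 4)) *
    (\tr H ^+ 2 + 2 * \tr (H *m H)))| <= K3 * (V e * e ^+ 6).
  by near: e.
set C := cyl_covariance S p c e in g1 *.
have vv : \sum_i v 0 i ^+ 2 = zz + y ^+ 2.
  by rewrite -frame_normal_norm row_dotE; apply: eq_bigr => i _; rewrite expr2.
have zzE : zz = \sum_k z 0 k ^+ 2.
  by rewrite /zz row_dotE; apply: eq_bigr => i _; rewrite expr2.
have zz0 : 0 <= zz by exact: row_dot_ge0.
have CE : (v *m C *m v^T) 0 0 = \sum_i \sum_j v 0 i * v 0 j * C i j.
  rewrite row_dotE; under eq_bigr do rewrite mxE mulr_suml.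
  rewrite exchange_big/=; apply: eq_bigr => i _; apply: eq_bigr => j _; ring.
have s1 : `|(v *m C *m v^T) 0 0 - \sum_i \sum_j v 0 i * v 0 j *
    cball_int e (fun t => covP i j (row t))| <=
    n.+1%:R ^+ 2 * ((zz + y ^+ 2) * (K1 * (V e * e ^+ 6))).
  rewrite CE -sumrB; apply: le_trans (ler_norm_sum _ _ _) _.
  rewrite expr2 -mulrA -[X in X%:R * _](card_ord n.+1) mulr_natl -sumr_const.
  apply: ler_sum => i _; rewrite -sumrB; apply: le_trans (ler_norm_sum _ _ _) _.
  rewrite -[X in X%:R * _](card_ord n.+1) mulr_natl -sumr_const.
  apply: ler_sum => j _; rewrite -mulrBr normrM ler_pM//; last exact: (g1 (i, j)).
  have vle k : v 0 k ^+ 2 <= zz + y ^+ 2.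
    by rewrite -vv (bigD1 k)//= lerDl sumr_ge0// => l _; rewrite sqr_ge0.
  rewrite normrM; have := vle i; have := vle j.
  rewrite -[v 0 i ^+ 2]real_normK ?num_real// -[v 0 j ^+ 2]real_normK ?num_real//.
  by move=> h h'; exact: mulr_le_sqr.
rewrite covP_quad// -/z -/y cball_int_tangent// -/zz in s1.
set T2 := \sum_k z 0 k * _ in s1; set T3 := cball_int e _ in g3 s1.
have s2 : `|2 * y * T2| <= n%:R * ((th * zz + y ^+ 2 / th) * (K2 * (V e * e ^+ 4))).
  rewrite /T2 mulr_sumr; apply: le_trans (ler_norm_sum _ _ _) _.
  rewrite [leRHS]mulr_natl -[X in _ <= _ *+ X](card_ord n) -sumr_const.
  apply: ler_sum => k _.
  rewrite mulrA normrM ler_pM//.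
  have zk : z 0 k ^+ 2 <= zz.
    by rewrite zzE (bigD1 k)//= lerDl sumr_ge0// => l _; rewrite sqr_ge0.
  apply: le_trans (_ : th * z 0 k ^+ 2 + y ^+ 2 / th <= _); last first.
    by rewrite lerD2r ler_pM2l.
  rewrite ler_norml; apply/andP; split.
    rewrite -subr_ge0 (_ : _ - _ = (th * z 0 k + y) ^+ 2 / th); last first.
      by field; rewrite gt_eqF.
    by rewrite divr_ge0 ?sqr_ge0// ltW.
  rewrite -subr_ge0 (_ : _ - _ = (th * z 0 k - y) ^+ 2 / th); last first.
    by field; rewrite gt_eqF.
  by rewrite divr_ge0 ?sqr_ge0// ltW.
have s3 : `|y ^+ 2 * T3 - y ^+ 2 * (V e * (e ^+ 4 / (4 * (n%:R + 2) * (n%:R + 4)) *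
    (\tr H ^+ 2 + 2 * \tr (H *m H))))| <= y ^+ 2 * (K3 * (V e * e ^+ 6)).
  by rewrite -mulrBr normrM (ger0_norm (sqr_ge0 y)) ler_wpM2l ?sqr_ge0.
rewrite /model -/zz.
set a1 := e ^+ 2 / _ * zz in s1 *; set a2 := e ^+ 4 / (2 * _ * _) * _ in s1 *.
set b := e ^+ 4 / (4 * _ * _) * _ in s3 *.
set Q := (v *m C *m v^T) 0 0 in s1 *.
have -> : Q - V e * (a1 + a2 + b * y ^+ 2) =
    (Q - (V e * (a1 + a2) + 2 * y * T2 + y ^+ 2 * T3)) + 2 * y * T2 +
    (y ^+ 2 * T3 - y ^+ 2 * (V e * b)) by ring.
apply: le_trans (ler_normD _ _) _.
apply: le_trans (lerD (le_trans (ler_normD _ _) (lerD s1 s2)) s3) _.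
have y2 : 0 <= y ^+ 2 by rewrite sqr_ge0.
have th2 : 0 <= th * zz + y ^+ 2 / th.
  by rewrite addr_ge0// ?divr_ge0// ?mulr_ge0// ltW.
have e6 : 0 <= V e * e ^+ 6 by rewrite (mulr_ge0 (ltW V0))// exprn_ge0// ltW.
have e4 : 0 <= V e * e ^+ 4 by rewrite (mulr_ge0 (ltW V0))// exprn_ge0// ltW.
have nn : 0 <= n%:R :> R by [].
have nS : 0 <= n.+1%:R ^+ 2 :> R by rewrite exprn_ge0.
rewrite [V e * (_ + _)]mulrDr [V e * (e ^+ 6 * _)]mulrA [V e * (e ^+ 4 * _)]mulrA.
exact: sum_errors_le.
Unshelve. all: by end_near. Qed.

End Chart.

(** * Descriptors *)

Lemma div_error (R : numFieldType) (V x a D : R) : 0 < V ->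
  `|x - V * a| <= V * D -> `|x / V - a| <= D.
Proof.
move=> V0 h; rewrite -(ler_pM2l V0) -{1}(gtr0_norm V0) -normrM mulrBr.
by rewrite mulrCA divff ?mulr1// gt_eqF.
Qed.

(** Sign and root can only fail harmlessly. If [d = 0] then [t = 0] and the error is 0. If [E < 0]
    then [Num.sqrt E = 0], and replacing a negative [E] by 0 brings it closer to [t^2]. *)
Lemma signed_sqrt_error (R : rcfType) (t d E D : R) : (t != 0 -> d != 0) ->
  `|t ^+ 2 - E| <= D -> `|t ^+ 2 - (Num.sg d * Num.sqrt E) ^+ 2| <= D.
Proof.
move=> td tE; rewrite exprMn sqr_sg; have [d0|d0] := eqVneq d 0.
  have /eqP -> : t == 0 by apply/negPn/negP => /td; rewrite d0 eqxx.
  by rewrite mul0r subr0 expr0n normr0; apply: le_trans tE.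
rewrite mul1r; have [E0|E0] := leP 0 E; first by rewrite sqr_sqrtr.
rewrite ltr0_sqrtr// expr0n subr0; apply: le_trans tE.
by rewrite !ger0_norm ?subr_ge0 ?sqr_ge0 ?lerBrDr ?gerDl ?ltW// (lt_le_trans E0) ?sqr_ge0.
Qed.

(** * Principal frame and expansion of the eigenvalues *)

Definition tangent_model (R : realType) n (kappa : 'I_n -> R) (e : R) (mu : 'I_n) : R :=
  e ^+ 2 / (n%:R + 2) + e ^+ 4 / (2 * (n%:R + 2) * (n%:R + 4)) *
    (\sum_i kappa i ^+ 2 + 2 * kappa mu ^+ 2).

Definition normal_model (R : realType) n (kappa : 'I_n -> R) (e : R) : R :=
  e ^+ 4 / (4 * (n%:R + 2) * (n%:R + 4)) *
    (mean_curvature kappa ^+ 2 + 2 * \sum_i kappa i ^+ 2).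

Lemma trace_hessian (R : realType) (n : nat) (S : set 'rV[R]_n.+1) p c
    (kappa : 'I_n -> R) : is_tangent_chart S p c ->
  principal_curvatures (chart_map p c) 0 (normal c) kappa ->
  exists B : 'M[R]_n, [/\ B *m B^T = 1%:M,
    B *m hessian c *m B^T = diag_mx (\row_i kappa i),
    \tr (hessian c) = mean_curvature kappa &
    \tr (hessian c *m hessian c) = \sum_i kappa i ^+ 2].
Proof.
move=> hc hk.
have [B [BB BH]] := ortho_diag (hessian_tr hc) (hessian_char_poly hc hk).
exists B; split => //.
  rewrite -(tr_orthoJ _ BB) BH mxtrace_diag; apply: eq_bigr => i _.
  by rewrite mxE.
have BHH : B *m (hessian c *m hessian c) *m B^T = diag_mx (\row_i (kappa i ^+ 2)).
  transitivity ((B *m hessian c *m B^T) *m (B *m hessian c *m B^T)).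
    by rewrite !mulmxA -[X in _ = X *m _ *m _]mulmxA (mulmx1C BB) mulmx1.
  rewrite BH mulmx_diag; congr diag_mx; apply/rowP => i.
  by rewrite !mxE expr2.
rewrite -(tr_orthoJ _ BB) BHH mxtrace_diag; apply: eq_bigr => i _.
by rewrite mxE.
Qed.

(** The rows of [Q] are the principal directions in the ambient space, obtained from the frame by
    the matrix that diagonalizes the Hessian, and the normal at index [ord_max]. They diagonalize
    [model] because its tangent part involves only the identity and the square of the Hessian. *)
Lemma principal_frame (R : realType) (n : nat) (S : set 'rV[R]_n.+1) p c
    (kappa : 'I_n -> R) : is_tangent_chart S p c ->
  principal_curvatures (chart_map p c) 0 (normal c) kappa ->
  exists Q : 'M[R]_n.+1, Q *m Q^T = 1%:M /\ forall v : 'rV[R]_n.+1,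
    [/\ (v *m Q^T) 0 ord_max = (v *m (normal c)^T) 0 0,
      ((v *m (frame c)^T) *m (v *m (frame c)^T)^T) 0 0 =
        \sum_mu (v *m Q^T) 0 (lift ord_max mu) ^+ 2 &
      forall e, model c e (v *m (frame c)^T) ((v *m (normal c)^T) 0 0) =
        \sum_mu tangent_model kappa e mu * (v *m Q^T) 0 (lift ord_max mu) ^+ 2 +
        normal_model kappa e * (v *m Q^T) 0 ord_max ^+ 2].
Proof.
move=> hc hk; have [B [BB BH trH trHH]] := trace_hessian hc hk.
pose Q : 'M[R]_n.+1 := \matrix_i
  (if unlift ord_max i is Some mu then row mu (B *m frame c) else normal c).
have rQ i : row i Q = if unlift ord_max i is Some mu
    then row mu (B *m frame c) else normal c by rewrite rowK.
have GG : (B *m frame c) *m (B *m frame c)^T = 1%:M.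
  rewrite trmx_mul mulmxA -[B *m _ *m _]mulmxA.
  by rewrite (frame_orthonormal hc) mulmx1.
have NG : normal c *m (B *m frame c)^T = 0.
  by rewrite trmx_mul mulmxA (normal_frame hc) mul0mx.
have vmax (v : 'rV_n.+1) : (v *m Q^T) 0 ord_max = (v *m (normal c)^T) 0 0.
  rewrite !mxE; apply: eq_bigr => k _; rewrite !mxE.
  by rewrite unlift_none.
have vtan (v : 'rV_n.+1) mu : (v *m Q^T) 0 (lift ord_max mu) = (v *m (frame c)^T *m B^T) 0 mu.
  rewrite -mulmxA -trmx_mul !mxE; apply: eq_bigr => k _; rewrite !mxE.
  by rewrite liftK !mxE.
exists Q; split.
  apply/matrixP => i j; rewrite [RHS]mxE.
  have -> : (Q *m Q^T) i j = (row i Q *m Q^T) 0 j by rewrite -row_mul [RHS]mxE.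
  rewrite rQ; have [mu ->|->] := unliftP ord_max i; have [nu ->|->] := unliftP ord_max j.
  - rewrite vtan -mulmxA -trmx_mul -row_mul GG !mxE.
    by rewrite (inj_eq lift_inj).
  - rewrite vmax eq_sym (negPf (neq_lift _ _)) -row_mul.
    by rewrite -[_ *m _]trmxK trmx_mul trmxK NG trmx0 !mxE.
  - by rewrite vtan -mulmxA -trmx_mul NG mxE (negPf (neq_lift _ _)).
  - by rewrite vmax (normal_norm hc) mxE !eqxx.
have BtB k (w : 'M[R]_(k, n)) : w *m B^T *m B = w by rewrite -mulmxA (mulmx1C BB) mulmx1.
move=> v; have {vtan} := vtan v; set z := v *m (frame c)^T; move: z => z vtan.
have zz : (z *m z^T) 0 0 = \sum_mu (v *m Q^T) 0 (lift ord_max mu) ^+ 2.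
  have -> : z *m z^T = (z *m B^T) *m (z *m B^T)^T.
    by rewrite trmx_mul trmxK mulmxA BtB.
  by rewrite row_dotE; apply: eq_bigr => mu _; rewrite vtan expr2.
have zHz : (z *m (hessian c *m hessian c) *m z^T) 0 0 =
    \sum_mu kappa mu ^+ 2 * (v *m Q^T) 0 (lift ord_max mu) ^+ 2.
  have -> : z *m (hessian c *m hessian c) *m z^T =
      (z *m B^T *m (B *m hessian c *m B^T)) *m (z *m B^T *m (B *m hessian c *m B^T))^T.
    rewrite BH trmx_mul tr_diag_mx -BH !trmx_mul trmxK !mulmxA.
    by rewrite !BtB.
  rewrite row_dotE BH; apply: eq_bigr => mu _.
  rewrite vtan; move: (z *m B^T) => w.
  have -> : (w *m diag_mx (\row_i kappa i)) 0 mu = w 0 mu * kappa mu.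
    by rewrite mul_mx_diag !mxE.
  ring.
split => //.
move=> e; rewrite /model trH trHH zz zHz vmax.
rewrite /tangent_model /normal_model.
rewrite [in RHS](eq_bigr (fun mu => e ^+ 2 / (n%:R + 2) *
  (v *m Q^T) 0 (lift ord_max mu) ^+ 2 +
  e ^+ 4 / (2 * (n%:R + 2) * (n%:R + 4)) * (\sum_i kappa i ^+ 2 *
   (v *m Q^T) 0 (lift ord_max mu) ^+ 2 +
   2 * (kappa mu ^+ 2 * (v *m Q^T) 0 (lift ord_max mu) ^+ 2)))); last first.
  by move=> mu _; rewrite -mulr_suml; ring.
rewrite big_split/= -!mulr_sumr big_split/= -mulr_sumr.
congr (_ + _ * (_ + _) + _ * _ * _).
by under [in RHS]eq_bigr do rewrite -mulr_suml; rewrite mulr_sumr.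
Qed.

Lemma near_sq_le (R : realType) (A b : R) : 0 < b ->
  \forall e \near 0^'+, A * e ^+ 2 <= b.
Proof.
move=> b0; have A0 : 0 < `|A| + 1 by rewrite ltr_wpDl.
near=> e; have e0 : 0 < e by near: e; exact: nbhs_right_gt.
have e1 : e <= 1 by near: e; exact: nbhs_right_le.
have eb : e <= b / (`|A| + 1) by near: e; apply: nbhs_right_le; rewrite divr_gt0.
rewrite ler_pdivlMr// in eb; apply: le_trans eb.
have e2 : e ^+ 2 <= e by rewrite expr2 ger_pMl.
apply: le_trans (ler_wpM2r (sqr_ge0 e) (ler_norm A)) _.
rewrite [leRHS]mulrC; apply: ler_pM => //; first exact: sqr_ge0.
by rewrite lerDl.
Unshelve. all: by end_near. Qed.

Lemma covariance_sym (R : realType) n (S : set 'rV[R]_n.+1) p c e :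
  (cyl_covariance S p c e)^T = cyl_covariance S p c e.
Proof.
apply/matrixP => i j; rewrite !mxE; congr integral_dVol.
by apply/funext => q; rewrite mulrC.
Qed.

(** Two bounds of the same error: the first is sharp in the tangent part [T], for the tangent
    eigenvalues, the second in the normal part [y], for the normal one. The crude coefficient
    [e^2 / (2 (n + 2))] is half of the leading tangent weight, so tangent and normal weights stay
    separated. *)
Lemma covariance_expansion (R : realType) (n : nat) (S : set 'rV[R]_n.+1) p c
    (kappa : 'I_n -> R) : is_tangent_chart S p c -> (0 < n)%N ->
  principal_curvatures (chart_map p c) 0 (normal c) kappa ->
  exists (Q : 'M[R]_n.+1) (K : R), [/\ Q *m Q^T = 1%:M, 0 <= K,
    forall v : 'rV[R]_n.+1, (v *m Q^T) 0 ord_max = (v *m (normal c)^T) 0 0 &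
    \forall e \near 0^'+, forall v : 'rV[R]_n.+1,
      let T := \sum_(mu < n) (v *m Q^T) 0 (lift ord_max mu) ^+ 2 in
      let y := (v *m Q^T) 0 ord_max in
      let D := (v *m cyl_covariance S p c e *m v^T) 0 0 - ball_volume n e *
        (\sum_(mu < n) tangent_model kappa e mu * (v *m Q^T) 0 (lift ord_max mu) ^+ 2 +
         normal_model kappa e * y ^+ 2) in
      `|D| <= ball_volume n e * (K * e ^+ 6 * T + e ^+ 2 / (2 * (n%:R + 2)) * y ^+ 2) /\
      `|D| <= ball_volume n e * (e ^+ 2 / (2 * (n%:R + 2)) * T + K * e ^+ 6 * y ^+ 2)].
Proof.
move=> hc n0 hk; have [Q [QQ Qv]] := principal_frame hc hk.
have [K1 [K10 HK]] := covariance_quad hc n0.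
have n2 : 0 < n%:R + 2 :> R by rewrite ltr_wpDl.
(* The crude coefficient is [2 b e^2]. One [b e^2] absorbs [K1 e^6], the other the cross term, which
   contributes [(K1 / L) e^2] with [K1 / L <= b]. *)
pose b : R := (4 * (n%:R + 2))^-1.
have b0 : 0 < b by rewrite invr_gt0 mulr_gt0.
pose L : R := (K1 + b) / b.
have L0 : 0 < L by rewrite divr_gt0// ltr_wpDl.
have LK : K1 / L <= b by rewrite ler_pdivrMr// /L mulrC divfK ?gt_eqF// lerDl ltW.
(* [th] of order [e^2], resp. [e^-2], charges the cross term to [y], resp. to [T]. *)
exists Q, (K1 * (1 + L)); split => //.
- by rewrite mulr_ge0// addr_ge0// ltW.
- by move=> v; have [] := Qv v.
near=> e; have e0 : 0 < e by near: e; exact: nbhs_right_gt.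
have V0 := ball_volume_gt0 n e0.
have e1 : e <= 1 by near: e; exact: nbhs_right_le.
have Ke : K1 * e ^+ 2 <= b by near: e; exact: near_sq_le.
have He : forall (v : 'rV[R]_n.+1) (th : R), 0 < th ->
    let z := v *m (frame c)^T in let y := (v *m (normal c)^T) 0 0 in
    let zz := (z *m z^T) 0 0 in
    `|(v *m cyl_covariance S p c e *m v^T) 0 0 - ball_volume n e * model c e z y| <=
    K1 * (ball_volume n e * (e ^+ 6 * (zz + y ^+ 2) + e ^+ 4 * (th * zz + y ^+ 2 / th))).
  by near: e; exact: HK.
move=> v; have [vy vT vM] := Qv v.
set T := \sum_(mu < n) (v *m Q^T) 0 (lift ord_max mu) ^+ 2.
set y := (v *m Q^T) 0 ord_max; set D := _ - ball_volume n e * _.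
have bE : e ^+ 2 / (2 * (n%:R + 2)) = 2 * (b * e ^+ 2).
  by rewrite /b; field; rewrite gt_eqF.
have e2 : 0 < e ^+ 2 by rewrite exprn_gt0.
have K6 : K1 * e ^+ 6 <= b * e ^+ 2.
  have -> : K1 * e ^+ 6 = (K1 * e ^+ 2) * e ^+ 4 by ring.
  apply: ler_pM => //; first by rewrite mulr_ge0// ltW.
  - by rewrite exprn_ge0// ltW.
  - by rewrite (_ : e ^+ 4 = e ^+ 2 * e ^+ 2) ?ger_pMl// ?exprn_ile1 ?ltW//; ring.
have T0 : 0 <= T by apply: sumr_ge0 => i _; exact: sqr_ge0.
have y0 : 0 <= y ^+ 2 by exact: sqr_ge0.
have key th : 0 < th -> `|D| <= ball_volume n e *
    (K1 * (e ^+ 6 * (T + y ^+ 2) + e ^+ 4 * (th * T + y ^+ 2 / th))).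
  move=> th0; have := He v th th0; rewrite /= vM vT -/T -vy -/y -/D.
  by rewrite mulrCA.
have LKe : K1 / L * e ^+ 2 <= b * e ^+ 2 by rewrite ler_pM2r.
rewrite bE; split.
  apply: le_trans (key (L * e ^+ 2) _) _; first by rewrite mulr_gt0.
  rewrite ler_pM2l//.
  have -> : K1 * (e ^+ 6 * (T + y ^+ 2) + e ^+ 4 * (L * e ^+ 2 * T + y ^+ 2 / (L * e ^+ 2))) =
    K1 * (1 + L) * e ^+ 6 * T + (K1 * e ^+ 6 + K1 / L * e ^+ 2) * y ^+ 2.
    by field; rewrite !gt_eqF.
  by rewrite lerD2l ler_wpM2r// mulr_natl mulr2n lerD.
apply: le_trans (key (L * e ^+ 2)^-1 _) _; first by rewrite invr_gt0 mulr_gt0.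
rewrite ler_pM2l//.
have -> : K1 * (e ^+ 6 * (T + y ^+ 2) +
    e ^+ 4 * ((L * e ^+ 2)^-1 * T + y ^+ 2 / (L * e ^+ 2)^-1)) =
    (K1 * e ^+ 6 + K1 / L * e ^+ 2) * T + K1 * (1 + L) * e ^+ 6 * y ^+ 2.
  by field; rewrite !gt_eqF.
by rewrite lerD2r ler_wpM2r// mulr_natl mulr2n lerD.
Unshelve. all: by end_near. Qed.

(** The last clause keeps the normal eigenvector within 45 degrees of the normal line: its Rayleigh
    quotient is [lam ord_max], too small to allow a larger tangent part. *)
Lemma eigenvalue_expansion (R : realType) (n : nat) (S : set 'rV[R]_n.+1) p c
    (kappa : 'I_n -> R) (lam : R -> 'I_n.+1 -> R) (e : R -> 'I_n.+1 -> 'rV[R]_n.+1) :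
  is_tangent_chart S p c -> (0 < n)%N ->
  principal_curvatures (chart_map p c) 0 (normal c) kappa ->
  (\forall eps \near 0^'+,
    labeled_eigensystem kappa (cyl_covariance S p c eps) (lam eps) (e eps)) ->
  exists K : R, 0 <= K /\ \forall eps \near 0^'+,
    [/\ `|lam eps ord_max - ball_volume n eps * normal_model kappa eps| <=
          ball_volume n eps * (K * eps ^+ 6),
        forall mu, `|lam eps (lift ord_max mu) - ball_volume n eps * tangent_model kappa eps mu|
          <= ball_volume n eps * (K * eps ^+ 6) &
        2^-1 <= (e eps ord_max *m (normal c)^T) 0 0 ^+ 2].
Proof.
move=> hc n0 hk hlam.
have [Q [K [QQ K0 Qv HK]]] := covariance_expansion hc n0 hk.
have n2 : 0 < n%:R + 2 :> R by rewrite ltr_wpDl.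
have n4 : 0 < n%:R + 4 :> R by rewrite ltr_wpDl.
pose q := \sum_i kappa i ^+ 2.
have q0 : 0 <= q by apply: sumr_ge0 => i _; exact: sqr_ge0.
pose A : R := (mean_curvature kappa ^+ 2 + 2 * q) / (4 * (n%:R + 2) * (n%:R + 4)).
have A0 : 0 <= A.
  by rewrite divr_ge0 ?addr_ge0 ?sqr_ge0 ?mulr_ge0// ltW.
(* With [b eps^2] as unit, the tangent weights are at least 16, the crude error is 8, and the normal
   weight and [K eps^6] are at most 1 each; all separations below follow from these numbers. *)
pose b : R := (16 * (n%:R + 2))^-1.
have b0 : 0 < b by rewrite invr_gt0 mulr_gt0.
exists K; split => //.
near=> eps; have e0 : 0 < eps by near: eps; exact: nbhs_right_gt.
have He : forall v : 'rV[R]_n.+1,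
      let T := \sum_(mu < n) (v *m Q^T) 0 (lift ord_max mu) ^+ 2 in
      let y := (v *m Q^T) 0 ord_max in
      let D := (v *m cyl_covariance S p c eps *m v^T) 0 0 - ball_volume n eps *
        (\sum_(mu < n) tangent_model kappa eps mu * (v *m Q^T) 0 (lift ord_max mu) ^+ 2 +
         normal_model kappa eps * y ^+ 2) in
      `|D| <= ball_volume n eps * (K * eps ^+ 6 * T + eps ^+ 2 / (2 * (n%:R + 2)) * y ^+ 2) /\
      `|D| <= ball_volume n eps * (eps ^+ 2 / (2 * (n%:R + 2)) * T + K * eps ^+ 6 * y ^+ 2).
  by near: eps; exact: HK.
have V0 := ball_volume_gt0 n e0; set V := ball_volume n eps in V0 He *.
have e1 : eps <= 1 by near: eps; exact: nbhs_right_le.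
have Ae : A * eps ^+ 2 <= b by near: eps; exact: near_sq_le.
have Ke : K * eps ^+ 2 <= b by near: eps; exact: near_sq_le.
have [cC ev lmax lmon] : labeled_eigensystem kappa (cyl_covariance S p c eps) (lam eps) (e eps).
  by near: eps.
have e2 : 0 < eps ^+ 2 by rewrite exprn_gt0.
have e4 : eps ^+ 4 <= eps ^+ 2.
  by rewrite (_ : eps ^+ 4 = eps ^+ 2 * eps ^+ 2) ?ger_pMl// ?exprn_ile1 ?ltW//; ring.
have K6 : K * eps ^+ 6 <= b * eps ^+ 2.
  have -> : K * eps ^+ 6 = (K * eps ^+ 2) * eps ^+ 4 by ring.
  by apply: ler_pM => //; rewrite ?mulr_ge0// ?exprn_ge0// ltW.
have nuE : normal_model kappa eps = A * eps ^+ 2 * eps ^+ 2.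
  by rewrite /normal_model /A -/q; field; rewrite !gt_eqF.
have nu0 : 0 <= normal_model kappa eps.
  by rewrite nuE; exact: (mulr_ge0 (mulr_ge0 A0 (ltW e2)) (ltW e2)).
have nub : normal_model kappa eps <= b * eps ^+ 2 by rewrite nuE ler_pM2r.
have bE : eps ^+ 2 / (2 * (n%:R + 2)) = 8 * (b * eps ^+ 2).
  by rewrite /b; field; rewrite gt_eqF.
have bE' : eps ^+ 2 / (n%:R + 2) = 16 * (b * eps ^+ 2).
  by rewrite /b; field; rewrite gt_eqF.
have mge mu : 16 * (b * eps ^+ 2) <= tangent_model kappa eps mu.
  rewrite /tangent_model bE' lerDl; apply: mulr_ge0.
    by rewrite ltW// divr_gt0 ?exprn_gt0// !mulr_gt0.
  by rewrite addr_ge0 // mulr_ge0// sqr_ge0.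
have VE (v : 'rV[R]_n.+1) : V * (\sum_(mu < n) tangent_model kappa eps mu *
    (v *m Q^T) 0 (lift ord_max mu) ^+ 2 + normal_model kappa eps * (v *m Q^T) 0 ord_max ^+ 2) =
  \sum_(mu < n) (V * tangent_model kappa eps mu) * (v *m Q^T) 0 (lift ord_max mu) ^+ 2 +
   V * normal_model kappa eps * (v *m Q^T) 0 ord_max ^+ 2.
  by rewrite mulrDr mulr_sumr mulrA; congr (_ + _); apply: eq_bigr => mu _; rewrite mulrA.
have Csym := covariance_sym S p c eps.
have be0 : 0 < b * eps ^+ 2 by rewrite mulr_gt0.
have K60 : 0 <= K * eps ^+ 6 by rewrite mulr_ge0// exprn_ge0// ltW.
have lmaxE : `|lam eps ord_max - V * normal_model kappa eps| <= V * (K * eps ^+ 6).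
  apply: (normal_eigenvalue (f := fun mu => V * tangent_model kappa eps mu)
    (dt := V * (eps ^+ 2 / (2 * (n%:R + 2)))) Csym cC QQ _ lmax).
    move=> v; rewrite /= -VE; have [_] := He v; rewrite /=.
    by rewrite [V * (_ + _ * _ ^+ 2)]mulrDr ![V * (_ * _)]mulrA.
  move=> mu; rewrite -!mulrBr ler_pM2l// bE.
  by have := mge mu; lra.
split => //.
  move=> mu; apply: (tangent_eigenvalue (f := fun mu => V * tangent_model kappa eps mu)
    (g := V * normal_model kappa eps)
    (dn := V * (eps ^+ 2 / (2 * (n%:R + 2)))) Csym cC QQ _ lmax).
  - move=> v; rewrite /= -VE; have [+ _] := He v; rewrite /=.
    by rewrite [V * (_ + _ * _ ^+ 2)]mulrDr ![V * (_ * _)]mulrA.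
  (* The tangent weights are ordered as the squared curvatures, so the clause of the labeling is
     exactly what the count asks for. *)
  - move=> nu nu'; rewrite ltr_pM2l// /tangent_model ltrD2l => h.
    apply: lmon; move: h; rewrite ltr_pM2l ?ltrD2l ?ltr_pM2l//.
    by rewrite divr_gt0 ?exprn_gt0// !mulr_gt0.
  - rewrite -!mulrDr ler_pM2l// bE.
    by have := mge mu; lra.
have [eC eu] := ev ord_max; set v := e eps ord_max in eC eu *.
have vv : (v *m v^T) 0 0 = 1.
  rewrite -dotvE -[dotv v v]sqr_sqrtr; last by rewrite dotvE row_dot_ge0.
  by rewrite -/(enorm v) eu expr1n.
have := He v; rewrite /= -Qv; set T := \sum_(mu < n) (v *m Q^T) 0 _ ^+ 2.
set y := (v *m Q^T) 0 ord_max.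
have Ty : T + y ^+ 2 = 1.
  rewrite -vv.
  have -> : v *m v^T = (v *m Q^T) *m (v *m Q^T)^T.
    by rewrite trmx_mul trmxK mulmxA -[v *m Q^T *m Q]mulmxA (mulmx1C QQ) mulmx1.
  by rewrite [RHS]row_dotE (bigD1_ord ord_max)//= addrC; congr (_ + _).
have T0 : 0 <= T by apply: sumr_ge0 => i _; exact: sqr_ge0.
have y0 : 0 <= y ^+ 2 by exact: sqr_ge0.
have -> : (v *m cyl_covariance S p c eps *m v^T) 0 0 = lam eps ord_max.
  by rewrite eC -scalemxAl; rewrite [LHS]mxE vv mulr1.
move=> -[_].
set X := \sum_(mu < n) _ => D2.
have XT : 16 * (b * eps ^+ 2) * T <= X.
  by rewrite /T mulr_sumr; apply: ler_sum => mu _; rewrite ler_wpM2r ?sqr_ge0.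
have nuy : normal_model kappa eps * y ^+ 2 >= 0 by rewrite mulr_ge0.
have Ky : K * eps ^+ 6 * y ^+ 2 <= K * eps ^+ 6 by rewrite ler_piMr//; lra.
have {D2} : V * (X + normal_model kappa eps * y ^+ 2 -
    (eps ^+ 2 / (2 * (n%:R + 2)) * T + K * eps ^+ 6 * y ^+ 2)) <=
    V * (normal_model kappa eps + K * eps ^+ 6).
  rewrite mulrBr [leRHS]mulrDr.
  move: D2 lmaxE; rewrite !ler_distl => /andP[D2 _] /andP[_ D3].
  exact: le_trans D2 D3.
rewrite ler_pM2l// bE => D2.
(* Hence [T <= 3/8] and [y^2 >= 5/8]. *)
have : 8 * (b * eps ^+ 2) * T <= 3 * (b * eps ^+ 2) by lra.
have -> : 8 * (b * eps ^+ 2) * T = (8 * T) * (b * eps ^+ 2) by ring.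
by rewrite ler_pM2r//; lra.
Unshelve. all: by end_near. Qed.

Lemma volume_near (R : realType) (n : nat) (S : set 'rV[R]_n.+1) p c
    (kappa : 'I_n -> R) : is_tangent_chart S p c -> (0 < n)%N ->
  principal_curvatures (chart_map p c) 0 (normal c) kappa ->
  exists K : R, 0 <= K /\ \forall e \near 0^'+,
    `|cyl_volume S p c e / ball_volume n e -
      (1 + e ^+ 2 / (2 * (n%:R + 2)) * \sum_i kappa i ^+ 2)| <= K * e ^+ 4.
Proof.
move=> hc n0 hk; have [_ [_ _ _ trHH]] := trace_hessian hc hk.
have [K [r [K0 r0 H]]] := volume_approx hc n0.
exists K; split => //; near=> e.
have e0 : 0 < e by near: e; exact: nbhs_right_gt.
have er : e <= r by near: e; exact: nbhs_right_le.
have V0 := ball_volume_gt0 n e0.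
have := H e; rewrite e0 er trHH => /(_ isT).
by rewrite [leRHS]mulrCA; exact: div_error.
Unshelve. all: by end_near. Qed.

(** Up to the factor [1 / V_p], the product is [V_n e^2 H <v, N> / (2 (n + 2))] with an error at
    most [(n + 1) L V_n e^3]. As [|<v, N>| >= 1/2], the main term has size at least
    [V_n e^2 |H| / (4 (n + 2))] and wins for small [e]. *)
Lemma barycenter_normal (R : realType) (n : nat) (S : set 'rV[R]_n.+1) p c
    (kappa : 'I_n -> R) : is_tangent_chart S p c -> (0 < n)%N ->
  principal_curvatures (chart_map p c) 0 (normal c) kappa -> mean_curvature kappa != 0 ->
  \forall e \near 0^'+, forall v : 'rV[R]_n.+1, enorm v = 1 ->
    2^-1 <= (v *m (normal c)^T) 0 0 ^+ 2 -> dotv v (cyl_barycenter S p c e) != 0.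
Proof.
move=> hc n0 hk t0; have [_ [_ _ trH _]] := trace_hessian hc hk.
have [K [K0 HK]] := volume_near hc n0 hk.
have [L [L0 HL]] := est_fam (barycenter_approx hc n0).
set t := mean_curvature kappa in t0 trH.
have n2 : 0 < n%:R + 2 :> R by rewrite ltr_wpDl.
have tb : 0 < `|t| / (4 * (n%:R + 2)) by rewrite divr_gt0 ?normr_gt0// mulr_gt0.
have L1 : 0 < n.+1%:R * L + 1 by rewrite ltr_wpDl// mulr_ge0.
near=> e; have e0 : 0 < e by near: e; exact: nbhs_right_gt.
have e1 : e <= 1 by near: e; exact: nbhs_right_le.
have Le : (n.+1%:R * L + 1) * e <= `|t| / (4 * (n%:R + 2)).
  rewrite -ler_pdivlMl// mulrC; near: e; apply: nbhs_right_le.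
  by rewrite divr_gt0.
have Ke : K * e ^+ 2 <= 2^-1 by near: e; apply: near_sq_le; rewrite invr_gt0.
have V0 := ball_volume_gt0 n e0.
have vol : `|cyl_volume S p c e / ball_volume n e -
      (1 + e ^+ 2 / (2 * (n%:R + 2)) * \sum_i kappa i ^+ 2)| <= K * e ^+ 4.
  by near: e; exact: HK.
pose f i := integral_dVol (chart_map p c) (cylinder S p c e) (fun q => (q - p) 0 i).
have bary : forall i, `|f i - ball_volume n e *
    (e ^+ 2 / (2 * (n%:R + 2)) * t * normal c 0 i)| <= L * (ball_volume n e * e ^+ 3).
  by rewrite /f -trH; near: e; exact: HL.
have e2 : 0 < e ^+ 2 by rewrite exprn_gt0.
(* [barycenter] divides by the volume, and the inverse of 0 is 0: positivity is what keeps this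
   factor from vanishing. *)
have vol0 : 0 < cyl_volume S p c e.
  have : 0 < cyl_volume S p c e / ball_volume n e.
    move: vol; rewrite ler_distl => /andP[+ _]; apply: lt_le_trans.
    have K4 : K * e ^+ 4 <= 2^-1.
      have -> : K * e ^+ 4 = K * e ^+ 2 * e ^+ 2 by ring.
      by apply: le_trans Ke; rewrite ler_piMr ?exprn_ile1 ?mulr_ge0 ?sqr_ge0// ltW.
    have : 0 <= e ^+ 2 / (2 * (n%:R + 2)) * \sum_i kappa i ^+ 2.
      apply: mulr_ge0; first by rewrite divr_ge0 ?mulr_ge0// ltW.
      by apply: sumr_ge0 => i _; exact: sqr_ge0.
    by lra.
  by rewrite pmulr_lgt0// invr_gt0.
move=> v v1; set y := (v *m (normal c)^T) 0 0 => y2.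
have -> : dotv v (cyl_barycenter S p c e) = (cyl_volume S p c e)^-1 * \sum_i v 0 i * f i.
  by rewrite /dotv mulr_sumr; apply: eq_bigr => i _; rewrite !mxE mulrCA.
rewrite mulf_neq0 ?invr_eq0 ?(gt_eqF vol0)//; apply/eqP => sum0.
have vle i : `|v 0 i| <= 1.
  have vv : dotv v v = 1.
    rewrite -[dotv v v]sqr_sqrtr; first by rewrite -/(enorm v) v1 expr1n.
    by rewrite dotvE row_dot_ge0.
  rewrite -(ler_pXn2r (n := 2))// ?nnegrE// real_normK ?num_real// expr1n -vv.
  rewrite /dotv (bigD1 i)//= -expr2 lerDl sumr_ge0// => j _.
  by rewrite -expr2 sqr_ge0.
have : `|\sum_i v 0 i * (f i - ball_volume n e *
    (e ^+ 2 / (2 * (n%:R + 2)) * t * normal c 0 i))| <=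
    n.+1%:R * (L * (ball_volume n e * e ^+ 3)).
  apply: le_trans (ler_norm_sum _ _ _) _.
  rewrite [leRHS]mulr_natl -[X in _ <= _ *+ X](card_ord n.+1) -sumr_const.
  by apply: ler_sum => i _; rewrite normrM -[leRHS]mul1r ler_pM.
under eq_bigr do rewrite mulrBr.
rewrite sumrB sum0 sub0r normrN.
have -> : \sum_i v 0 i * (ball_volume n e * (e ^+ 2 / (2 * (n%:R + 2)) * t * normal c 0 i)) =
    ball_volume n e * (e ^+ 2 / (2 * (n%:R + 2)) * t * y).
  rewrite /y row_dotE !mulr_sumr; apply: eq_bigr => i _; move: (ball_volume n e) => V; ring.
move: (ball_volume n e) V0 => V V0.
have -> : n.+1%:R * (L * (V * e ^+ 3)) = V * (e ^+ 2 * (n.+1%:R * L * e)) by ring.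
have -> : V * (e ^+ 2 / (2 * (n%:R + 2)) * t * y) = V * (e ^+ 2 * (t * y / (2 * (n%:R + 2)))).
  by field; rewrite gt_eqF.
rewrite normrM gtr0_norm// ler_pM2l// normrM (gtr0_norm e2) ler_pM2l// normrM normfV.
rewrite normrM (gtr0_norm (mulr_gt0 _ n2))//.
apply/negP; rewrite -ltNge.
have y1 : 2^-1 <= `|y|.
  rewrite -(ler_pXn2r (n := 2))// ?nnegrE ?invr_ge0// real_normK ?num_real//.
  by apply: le_trans y2; lra.
apply: lt_le_trans (_ : `|t| / (4 * (n%:R + 2)) <= _).
  by apply: lt_le_trans Le; rewrite ltr_pM2r// ltrDl.
have -> : `|t| / (4 * (n%:R + 2)) = `|t| * 2^-1 / (2 * (n%:R + 2)).
  by field; rewrite gt_eqF.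
by rewrite ler_pM2r ?invr_gt0 ?mulr_gt0// ler_pM2l// normr_gt0.
Unshelve. all: by end_near. Qed.

(** * Inversion of the expansions *)

Section Descriptors.
Variables (R : rcfType) (N e w q L : R).
Hypotheses (N2 : 0 < N + 2) (N4 : 0 < N + 4) (e0 : 0 < e).
Hypothesis wE : `|w - (1 + e ^+ 2 / (2 * (N + 2)) * q)| <= L * e ^+ 4.

(** Serves two descriptors. For [q] the sum of the squared curvatures and [a = H^2 + 2 q], read off
    the normal eigenvalue, [j = 2] leaves [H^2] and [j = 3] leaves [H^2 - q], the scalar curvature.
    The main terms cancel exactly, and only the errors of [x] and [w] remain, divided by [e^4] and
    [e^2]. *)
Lemma normal_descriptor_error (x a j K : R) : 0 <= j ->
  `|x - e ^+ 4 / (4 * (N + 2) * (N + 4)) * a| <= K * e ^+ 6 ->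
  `|a - j * q - 2 * (N + 2) / e ^+ 2 * (2 * (N + 4) / e ^+ 2 * x + j * (1 - w))| <=
  (4 * (N + 2) * (N + 4) * K + 2 * j * (N + 2) * L) * e ^+ 2.
Proof.
move=> j0 xE; have e2 : 0 < e ^+ 2 by rewrite exprn_gt0.
move: wE xE; set dw := w - _; set dx := x - _ => dwE dxE.
have -> : a - j * q - 2 * (N + 2) / e ^+ 2 * (2 * (N + 4) / e ^+ 2 * x + j * (1 - w)) =
    2 * j * (N + 2) / e ^+ 2 * dw - 4 * (N + 2) * (N + 4) / e ^+ 4 * dx.
  by rewrite /dx /dw; field; rewrite !gt_eqF.
have -> : (4 * (N + 2) * (N + 4) * K + 2 * j * (N + 2) * L) * e ^+ 2 =
    2 * j * (N + 2) / e ^+ 2 * (L * e ^+ 4) + 4 * (N + 2) * (N + 4) / e ^+ 4 * (K * e ^+ 6).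
  by field; rewrite !gt_eqF.
apply: le_trans (ler_normB _ _) _; apply: lerD; rewrite normrM ger0_norm.
- by rewrite ler_wpM2l// divr_ge0 ?mulr_ge0// ltW.
- by rewrite divr_ge0 ?mulr_ge0// ltW.
- by rewrite ler_wpM2l// divr_ge0 ?mulr_ge0 ?exprn_ge0// ltW.
- by rewrite divr_ge0 ?mulr_ge0 ?exprn_ge0// ltW.
Qed.

(** Here [k] is a squared principal curvature: the volume excess removes [q] from the coefficient
    [q + 2 k] of the tangent eigenvalue. *)
Lemma tangent_descriptor_error (x k K : R) :
  `|x - (e ^+ 2 / (N + 2) + e ^+ 4 / (2 * (N + 2) * (N + 4)) * (q + 2 * k))| <= K * e ^+ 6 ->
  `|k - (N + 2) / e ^+ 2 * ((N + 4) / e ^+ 2 * (x - e ^+ 2 / (N + 2)) - w + 1)| <=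
  ((N + 2) * (N + 4) * K + (N + 2) * L) * e ^+ 2.
Proof.
move=> xE; have e2 : 0 < e ^+ 2 by rewrite exprn_gt0.
move: wE xE; set dw := w - _; set dx := x - _ => dwE dxE.
have -> : k - (N + 2) / e ^+ 2 * ((N + 4) / e ^+ 2 * (x - e ^+ 2 / (N + 2)) - w + 1) =
    (N + 2) / e ^+ 2 * dw - (N + 2) * (N + 4) / e ^+ 4 * dx.
  by rewrite /dx /dw; field; rewrite !gt_eqF.
have -> : ((N + 2) * (N + 4) * K + (N + 2) * L) * e ^+ 2 =
    (N + 2) / e ^+ 2 * (L * e ^+ 4) + (N + 2) * (N + 4) / e ^+ 4 * (K * e ^+ 6).
  by field; rewrite !gt_eqF.
apply: le_trans (ler_normB _ _) _; apply: lerD; rewrite normrM ger0_norm.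
- by rewrite ler_wpM2l// divr_ge0 ?mulr_ge0// ltW.
- by rewrite divr_ge0 ?mulr_ge0// ltW.
- by rewrite ler_wpM2l// divr_ge0 ?mulr_ge0 ?exprn_ge0// ltW.
- by rewrite divr_ge0 ?mulr_ge0 ?exprn_ge0// ltW.
Qed.

End Descriptors.

Theorem corollary6p4 (R : realType) (n : nat) (hn : (0 < n)%N)
    (S : set 'rV[R]_n.+1) (hS : smooth_hypersurface S)
    (p : 'rV[R]_n.+1) (hp : S p)
    (c : graph_chart R n) (hc : is_tangent_chart S p c)
    (kappa : 'I_n -> R)
    (hkappa : principal_curvatures (chart_map p c) 0 (normal c) kappa)
    (lam : R -> 'I_n.+1 -> R) (e : R -> 'I_n.+1 -> 'rV[R]_n.+1)
    (hlam : \forall eps \near 0^'+,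
      labeled_eigensystem kappa (cyl_covariance S p c eps) (lam eps) (e eps)) :
  [/\ exists K : R, \forall eps \near 0^'+,
        `| mean_curvature kappa ^+ 2 -
           mean_descriptor eps (cyl_volume S p c eps) (lam eps ord_max)
             (e eps ord_max) (cyl_barycenter S p c eps) ^+ 2 |
        <= K * eps ^+ 2,
      exists K : R, \forall eps \near 0^'+,
        `| scalar_curvature kappa -
           scalar_descriptor n eps (cyl_volume S p c eps) (lam eps ord_max) |
        <= K * eps ^+ 2
    & forall mu : 'I_n, exists K : R, \forall eps \near 0^'+,
        `| kappa mu ^+ 2 -
           principal_sq_descriptor n eps (cyl_volume S p c eps)
             (lam eps (lift ord_max mu)) |
        <= K * eps ^+ 2].
Proof.
have [K [K0 HK]] := eigenvalue_expansion hc hn hkappa hlam.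
have [L [L0 HL]] := volume_near hc hn hkappa.
have n2 : 0 < n%:R + 2 :> R by rewrite ltr_wpDl.
have n4 : 0 < n%:R + 4 :> R by rewrite ltr_wpDl.
split.
- exists (4 * (n%:R + 2) * (n%:R + 4) * K + 2 * 2 * (n%:R + 2) * L).
  (* For [H = 0] the leading term of the barycenter vanishes and its sign is not controlled;
     [signed_sqrt_error] asks for a non-zero sign only when [H] is non-zero. *)
  have sgn : \forall eps \near 0^'+, mean_curvature kappa != 0 ->
      forall v : 'rV[R]_n.+1, enorm v = 1 ->
      2^-1 <= (v *m (normal c)^T) 0 0 ^+ 2 -> dotv v (cyl_barycenter S p c eps) != 0.
    have [t0|t0] := eqVneq (mean_curvature kappa) 0; first by apply: nearW.
    by apply: filterS (barycenter_normal hc hn hkappa t0) => eps h _.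
  apply: filterS (filterI (filterI (nbhs_right_gt 0) HK) (filterI HL (filterI hlam sgn))).
  move=> eps [[e0 [lamE _ y2]] [volE [[_ ev _ _] sg]]]; have V0 := ball_volume_gt0 n e0.
  apply: signed_sqrt_error => [t0|]; first exact: sg t0 _ (ev ord_max).2 y2.
  have := normal_descriptor_error n2 n4 e0 volE (ler0n R 2) (div_error V0 lamE).
  by rewrite addrK.
- exists (4 * (n%:R + 2) * (n%:R + 4) * K + 2 * 3 * (n%:R + 2) * L).
  apply: filterS (filterI (nbhs_right_gt 0) (filterI HK HL)).
  move=> eps [e0 [[lamE _ _] volE]]; have V0 := ball_volume_gt0 n e0.
  have := normal_descriptor_error n2 n4 e0 volE (ler0n R 3) (div_error V0 lamE).
  set q := \sum_i _; rewrite (_ : _ + 2 * q - 3 * q = scalar_curvature kappa)//.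
  by rewrite /scalar_curvature -/q; ring.
- move=> mu; exists ((n%:R + 2) * (n%:R + 4) * K + (n%:R + 2) * L).
  apply: filterS (filterI (nbhs_right_gt 0) (filterI HK HL)).
  move=> eps [e0 [[_ /(_ mu) lamE _] volE]]; have V0 := ball_volume_gt0 n e0.
  exact: tangent_descriptor_error n2 n4 e0 volE _ _ _ (div_error V0 lamE).
Unshelve. all: by end_near. Qed.
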